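(* Let $d\ge3$ be an integer, $\alpha\in(d-1,d)$, $\omega(n)=|n|^\alpha$, and let $\{\alpha\}$ denote the fractional part of $\alpha$. For $N\in\mathbb N$ let $H^\pm_{N,\omega}(x,t)=\big|\sum_{N\le n<2N}e^{it\omega(\pm n)\pm inx}\big|$. Then for each $t\ne0$: (a) if $\{\alpha\}>\frac2{d+1}$, then $\|H^\pm_{N,\omega}(\cdot,t)\|_{L^\infty_x}\lesssim N^{1-\frac1{d(d+1)}+}$; (b) if $\{\alpha\}\le\frac2{d+1}$, then $\|H^\pm_{N,\omega}(\cdot,t)\|_{L^\infty_x}\lesssim N^{1-\frac{1-\{\alpha\}}{d(d-1)}+}$. In particular, for every $g\in BV(\mathbb T)$, $\mathbb T=\mathbb R/(2\pi\mathbb Z)$, the function $e^{it(-\Delta)^{\frac\alpha2}}g$ is continuous in $x$ for each $t\ne0$.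
   Context: $A\lesssim N^{s+}$ means: for every $\epsilon>0$ there is a constant $C$ (which may depend on $\epsilon,\alpha,t$ but not on $N$) with $A\le CN^{s+\epsilon}$ for all $N\in\mathbb N$. $BV(\mathbb T)$ is the set of functions of bounded variation. $e^{it(-\Delta)^{\alpha/2}}g=\sum_{n\in\mathbb Z}\widehat g(n)e^{it|n|^\alpha+inx}$; continuity means having a continuous representative. *)

(* Defs.v *)
From HB Require Import structures.
From mathcomp Require Import all_boot all_order all_algebra.
From mathcomp Require Import all_classical all_reals all_analysis.
From mathcomp Require Import complex.

Set Implicit Arguments.
Unset Strict Implicit.
Unset Printing Implicit Defensive.

Import Order.TTheory GRing.Theory Num.Theory.
Import numFieldNormedType.Exports.

Local Open Scope classical_set_scope.
Local Open Scope ring_scope.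
Local Open Scope complex_scope.

Definition frac_part {R : realType} (a : R) : R := a - (Num.floor a)%:~R.

Definition expi {R : realType} (y : R) : R[i] := cos y +i* sin y.

(* The modulus of [R[i]] in the library takes values in [R[i]]; [cmod] is the
   same number as an element of [R]. *)
Definition cmod {R : realType} (z : R[i]) : R := ComplexField.Normc.normc z.

(* Functions on T = R/(2 pi Z) are 2pi-periodic functions on R; norms and
   integrals over T are taken on the fundamental domain [0, 2pi] with
   (unnormalized) Lebesgue measure. *)
Definition torus_measure (R : realType) : {measure set _ -> \bar R} :=
  mrestr (@lebesgue_measure R) (measurable_itv `[0, 2 * pi]).

Definition torus_norm {R : realType} (p : \bar R) (f : R -> R[i]) : \bar R :=
  Lnorm (torus_measure R) p (fun x => (cmod (f x))%:E).

Definition torus_integral {R : realType} (f : R -> R[i]) : R[i] :=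
  Rintegral (torus_measure R) setT (fun x => complex.Re (f x))
  +i* Rintegral (torus_measure R) setT (fun x => complex.Im (f x)).

Definition fourier_coef {R : realType} (g : R -> R[i]) (n : int) : R[i] :=
  ((2 * pi)^-1)%:C * torus_integral (fun y => g y * expi (- (n%:~R * y))).

(* A complex function has bounded variation iff its real and imaginary parts
   have; the library notion is for real-valued functions. *)
Definition BV_torus {R : realType} (g : R -> R[i]) : Prop :=
  [/\ periodic g (2 * pi),
      bounded_variation 0 (2 * pi) (fun x => complex.Re (g x)) &
      bounded_variation 0 (2 * pi) (fun x => complex.Im (g x))].

Definition omega {R : realType} (alpha : R) (n : int) : R :=
  `|n%:~R| `^ alpha.

(* [minus] selects the sign: [H false] is H^+ and [H true] is H^-. *)
Definition H {R : realType} (minus : bool) (w : int -> R) (N : nat)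
    (x t : R) : R :=
  cmod (\sum_(N <= n < 2 * N)
    let k : int := (-1) ^+ minus * n%:Z in
    expi (t * w k + k%:~R * x)).

(* A_N <~ N^(s+); here N ranges over the positive integers. *)
Definition lesssim_plus {R : realType} (A : nat -> \bar R) (s : R) : Prop :=
  forall eps : R, 0 < eps -> exists C : R, forall N : nat, (0 < N)%N ->
    (A N <= (C * N%:R `^ (s + eps))%:E)%E.

Definition evolution_partial_sum {R : realType} (w : int -> R) (t : R)
    (g : R -> R[i]) (M : nat) (x : R) : R[i] :=
  \sum_(0 <= j < (2 * M).+1)
    let n : int := j%:Z - M%:Z in
    fourier_coef g n * expi (t * w n + n%:~R * x).

(* [u] represents sum_n ghat(n) e^(it w(n) + inx), the series being summed in
   L^2(T); this determines [u] up to almost everywhere equality. *)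
Definition represents_evolution {R : realType} (w : int -> R) (t : R)
    (g u : R -> R[i]) : Prop :=
  periodic u (2 * pi) /\
  torus_norm 2%:E (fun x => evolution_partial_sum w t g M x - u x)
    @[M --> \oo] --> (0 : \bar R).

(* Main.v *)
(* On a window of length H = N^((k-alpha)/k), Taylor expansion turns t n^alpha + n x
   into a polynomial of degree k-1 in h, up to a remainder of bounded variation. After
   averaging over shifts by h < H it suffices to bound the moment of order k(k-1)/2,
   over n ~ N, of the corresponding polynomial exponential sums. Duality and
   Cauchy-Schwarz separate this moment into the number of solutions of Vinogradov's system
   of degree k-1 and a bilinear form in the two top Taylor coefficients at n. The first
   factor is the mean value theorem, proved by an efficient-congruencing form of p-adic
   decoupling; the second is a two-dimensional large sieve, estimated by the spacing of
   n^(alpha-k+1). This gives a saving of (1 - max(0, alpha-k+1))/(k(k-1)) in the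
   exponent; take k = d for (b) and k = d+1 for (a).
   For g of bounded variation, integrating by parts against g costs only its variation
   and gains 1/n, so dyadic blocks of the Fourier series of the evolution are
   O(N^(-delta)) uniformly in x, and the series converges uniformly. *)
Require Import Defs.
From HB Require Import structures.
From mathcomp Require Import all_boot all_order all_algebra.
From mathcomp Require Import all_classical all_reals all_analysis.
From mathcomp Require Import measurable_realfun ess_sup_inf complex.
From mathcomp Require Import ring lra zify.

Set Implicit Arguments.
Unset Strict Implicit.
Unset Printing Implicit Defensive.

Import Order.TTheory GRing.Theory Num.Theory.
Import numFieldNormedType.Exports.

Local Open Scope classical_set_scope.
Local Open Scope ring_scope.
Local Open Scope complex_scope.

(** * Complex moduli and finite inequalities *)

(** With k as in the overview, s = k(k-1)/2 is critical twice: it is the exponent at which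
    Vinogradov's system of degree k-1 has about H^s solutions, and it is the sum 1 + ... + (k-1), so
    that the box of possible power sums also has about H^s points. Hence all the saving in the s-th
    moment comes from the bilinear form, a factor ((1 + N lam)/N)^(1/2) with lam = N^(alpha-k). The
    window is as long as H^k lam <= 1 allows. At the resolution H^-(k-1) the top coefficient then
    cannot separate points at distance below H; the next one, whose derivative is k-1 times the top
    one, does so inside a window. In the decoupling argument phases are polynomials modulo p^M, and
    translating them is exact. Suitable multiples of a power of X - eta vanish on a residue class of
    eta, so one factor of a bilinear sum can be decoupled in lower degree while the other stays
    fixed. This costs no power; the gain is that the fixed factor, living on a class modulo p^b, has
    b fewer scales to pass. Repeated exchange of the two factors accumulates this gain until it
    exceeds every trivial loss. *)

Section ComplexModulus.
Variable R : realType.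
Implicit Types (z w : R[i]) (x y : R).

Lemma cmod0 : cmod (0 : R[i]) = 0.
Proof. exact: ComplexField.Normc.normc0. Qed.

Lemma cmod1 : cmod (1 : R[i]) = 1.
Proof. exact: ComplexField.Normc.normc1. Qed.

Lemma cmodM z w : cmod (z * w) = cmod z * cmod w.
Proof. exact: ComplexField.Normc.normcM. Qed.

Lemma cmodX z n : cmod (z ^+ n) = cmod z ^+ n.
Proof. by elim: n => [|n IH]; rewrite ?expr0 ?cmod1// !exprS cmodM IH. Qed.

Lemma cmod_ge0 z : 0 <= cmod z.
Proof. by case: z => a b; rewrite /cmod /= sqrtr_ge0. Qed.

Lemma ler_cmodD z w : cmod (z + w) <= cmod z + cmod w.
Proof. exact: le_normcD. Qed.

Lemma cmodN z : cmod (- z) = cmod z.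
Proof. exact: normcN. Qed.

Lemma cmodC x : cmod x%:C = `|x|.
Proof. by rewrite /cmod /= expr0n addr0 sqrtr_sqr. Qed.

Lemma ler_cmod_sum (I : Type) (r : seq I) (P : pred I) (F : I -> R[i]) :
  cmod (\sum_(i <- r | P i) F i) <= \sum_(i <- r | P i) cmod (F i).
Proof.
elim/big_rec2: _ => [|i y z _ le_zy]; first by rewrite cmod0.
by rewrite (le_trans (ler_cmodD _ _))// lerD2l.
Qed.

Lemma mulJ_cmod z : z * z^*%C = (cmod z ^+ 2)%:C.
Proof.
have -> : (cmod z ^+ 2)%:C = `|z| ^+ 2 by rewrite normc_def rmorphXn/=; case: z.
by rewrite sqr_normc.
Qed.

Lemma cmodJ z : cmod z^*%C = cmod z.
Proof. by case: z => a b; rewrite /cmod /= sqrrN. Qed.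

Lemma expi0 : expi (0 : R) = 1.
Proof. by rewrite /expi cos0 sin0. Qed.

Lemma expiD x y : expi (x + y) = expi x * expi y.
Proof.
rewrite /expi sinD cosD; apply/eqP; rewrite eq_complex /=.
by apply/andP; split; apply/eqP; ring.
Qed.

Lemma cmod_expi x : cmod (expi x) = 1.
Proof. by rewrite /cmod /expi /= cos2Dsin2 sqrtr1. Qed.

Lemma expiN x : expi (- x) = (expi x)^*%C.
Proof. by rewrite /expi cosN sinN. Qed.

Lemma expiMn x n : expi (n%:R * x) = expi x ^+ n.
Proof.
elim: n => [|n IH]; first by rewrite mul0r expi0.
by rewrite exprS -IH -expiD mulrS mulrDl mul1r.
Qed.

Lemma expi2pi : expi (2 * pi : R) = 1.
Proof. by rewrite mulr2n mulrDl mul1r -mulr2n /expi cos2pi sin2pi. Qed.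

Lemma expi2pin n : expi (n%:R * (2 * pi) : R) = 1.
Proof. by rewrite expiMn expi2pi expr1n. Qed.

Lemma expi_sum (I : Type) (r : seq I) (P : pred I) (F : I -> R) :
  expi (\sum_(i <- r | P i) F i) = \prod_(i <- r | P i) expi (F i).
Proof. exact: (big_morph expi expiD expi0). Qed.

End ComplexModulus.

(** * Hölder, power mean and Cauchy-Schwarz inequalities for finite sums *)

Section FiniteInequalities.
Variable R : realType.

Lemma weighted_AMGM (x y mu : R) : 0 <= x -> 0 <= y -> 0 < mu < 1 ->
  x `^ (1 - mu) * y `^ mu <= (1 - mu) * x + mu * y.
Proof.
move=> x0 y0 /andP[m0 m1].
have n0 : 0 < 1 - mu by rewrite subr_gt0.
have := @conjugate_powR R (x `^ (1 - mu)) (y `^ mu) (1 - mu)^-1 mu^-1 (powR_ge0 _ _) (powR_ge0 _ _).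
rewrite !invr_gt0 !invrK subrK => /(_ n0 m0 erefl).
rewrite -!powRrM !divff ?gt_eqF// !powRr1// => /le_trans; apply.
by rewrite mulrC (mulrC y).
Qed.

(* Rescaling both families to have sum 1 reduces this to weighted AM-GM. *)
Lemma hoelder_sum (I : finType) (P : pred I) (F G : I -> R) (mu : R) :
  0 < mu < 1 -> (forall i, 0 <= F i) -> (forall i, 0 <= G i) ->
  \sum_(i | P i) F i `^ (1 - mu) * G i `^ mu <=
  (\sum_(i | P i) F i) `^ (1 - mu) * (\sum_(i | P i) G i) `^ mu.
Proof.
move=> mu01 F0 G0; have /andP[m0 m1] := mu01.
have n0 : 0 < 1 - mu by rewrite subr_gt0.
set A := \sum_(i | P i) F i; set B := \sum_(i | P i) G i.
have A0 : 0 <= A by apply: sumr_ge0.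
have B0 : 0 <= B by apply: sumr_ge0.
have RHS0 : 0 <= A `^ (1 - mu) * B `^ mu by rewrite mulr_ge0 ?powR_ge0.
have [A00|Apos] := eqVneq A 0.
  suff -> : \sum_(i | P i) F i `^ (1 - mu) * G i `^ mu = 0 by [].
  apply: big1 => i Pi; have /eqP := A00; rewrite psumr_eq0// => /allP /(_ i).
  by rewrite mem_index_enum Pi => /(_ isT) /eqP ->; rewrite powR0 ?mul0r// gt_eqF.
have [B00|Bpos] := eqVneq B 0.
  suff -> : \sum_(i | P i) F i `^ (1 - mu) * G i `^ mu = 0 by [].
  apply: big1 => i Pi; have /eqP := B00; rewrite psumr_eq0// => /allP /(_ i).
  by rewrite mem_index_enum Pi => /(_ isT) /eqP ->; rewrite powR0 ?mulr0// gt_eqF.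
have {}Apos : 0 < A by rewrite lt_neqAle eq_sym Apos.
have {}Bpos : 0 < B by rewrite lt_neqAle eq_sym Bpos.
have step i : F i `^ (1 - mu) * G i `^ mu <=
    A `^ (1 - mu) * B `^ mu * ((1 - mu) * (F i / A) + mu * (G i / B)).
  have -> : F i `^ (1 - mu) * G i `^ mu =
     A `^ (1 - mu) * B `^ mu * ((F i / A) `^ (1 - mu) * (G i / B) `^ mu).
    rewrite mulrACA -!powRM ?divr_ge0//.
    by rewrite ![_ * (_ / _)]mulrC !divfK// gt_eqF.
  by rewrite ler_wpM2l// weighted_AMGM// divr_ge0.
apply: le_trans (ler_sum _ (fun i _ => step i)) _.
rewrite -mulr_sumr big_split/= -!mulr_sumr -!mulr_suml -/A -/B !divff ?gt_eqF//.
by rewrite !mulr1 subrK mulr1.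
Qed.

Lemma powR_sum_le (I : finType) (P : pred I) (F : I -> R) (mu : R) :
  0 < mu < 1 -> (forall i, 0 <= F i) ->
  \sum_(i | P i) F i `^ mu <= (#|P|)%:R `^ (1 - mu) * (\sum_(i | P i) F i) `^ mu.
Proof.
move=> mu01 F0.
have := @hoelder_sum I P (fun=> 1) F mu mu01 (fun=> ler01) F0.
rewrite sumr_const; under eq_bigr do rewrite powR1 mul1r.
by [].
Qed.

Lemma exprn_sum_le (I : finType) (P : pred I) (F : I -> R) m :
  (forall i, 0 <= F i) ->
  (\sum_(i | P i) F i) ^+ m.+1 <= (#|P|)%:R ^+ m * \sum_(i | P i) F i ^+ m.+1.
Proof.
move=> F0.
case: m => [|m]; first by rewrite expr0 mul1r expr1; under [leRHS]eq_bigr do rewrite expr1.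
pose mu : R := m.+2%:R^-1.
have m2 : (1 : R) < m.+2%:R by rewrite ltr1n.
have mp : (0 : R) < m.+2%:R by rewrite ltr0n.
have mu01 : 0 < mu < 1 by rewrite /mu invr_gt0 mp invf_lt1.
have S0 : 0 <= \sum_(i | P i) F i by apply: sumr_ge0.
have := powR_sum_le P mu01 (fun i => exprn_ge0 m.+2 (F0 i)).
have e i : (F i ^+ m.+2) `^ mu = F i.
  by rewrite -powR_mulrn// -powRrM /mu divff ?gt_eqF// powRr1.
under eq_bigr do rewrite e.
set T := \sum_(i | P i) F i ^+ m.+2 => H.
have T0 : 0 <= T by apply: sumr_ge0 => i _; apply: exprn_ge0.
have /= := lerXn2r m.+2 S0 (mulr_ge0 (powR_ge0 _ _) (powR_ge0 _ _)) H.
rewrite exprMn -!powR_mulrn ?powR_ge0// -!powRrM.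
rewrite /mu mulVf ?gt_eqF// (powRr1 T0) mulrBl mul1r mulVf ?gt_eqF//.
by rewrite -natr1 addrK powR_mulrn.
Qed.

Lemma cauchy_schwarz_sum (I : finType) (P : pred I) (F G : I -> R) :
  (forall i, 0 <= F i) -> (forall i, 0 <= G i) ->
  \sum_(i | P i) F i * G i <=
    Num.sqrt (\sum_(i | P i) F i ^+ 2) * Num.sqrt (\sum_(i | P i) G i ^+ 2).
Proof.
move=> F0 G0.
have h01 : 0 < (2^-1 : R) < 1 by apply/andP; split; lra.
have := @hoelder_sum I P (fun i => F i ^+ 2) (fun i => G i ^+ 2) _ h01
  (fun i => exprn_ge0 2 (F0 i)) (fun i => exprn_ge0 2 (G0 i)).
have -> : (1 - 2^-1 : R) = 2^-1 by lra.
rewrite !powR12_sqrt ?sumr_ge0//; try by move=> i _; apply: exprn_ge0.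
by under eq_bigr do rewrite !powR12_sqrt ?exprn_ge0// !sqrtr_sqr !ger0_norm//.
Qed.

End FiniteInequalities.

(** * Decoupling for the moment curve over the p-adics *)

Section Characters.
Variable R : realType.

Definition chi (N : nat) (z : 'Z_N) : R[i] := expi (2 * pi * (nat_of_ord z)%:R / N%:R).

Lemma cmod_chi N (z : 'Z_N) : cmod (chi z) = 1.
Proof. exact: cmod_expi. Qed.

Lemma chi_nat N n : (1 < N)%N ->
  chi (n%:R : 'Z_N) = expi (2 * pi * n%:R / N%:R).
Proof.
move=> N1; rewrite /chi val_Zp_nat// [in RHS](divn_eq n N) natrD natrM.
have N0 : (N%:R : R) != 0 by rewrite pnatr_eq0; lia.
set q := (n %/ N)%N; set r := (n %% N)%N.
have -> : 2 * pi * (q%:R * N%:R + r%:R) / N%:R = q%:R * (2 * pi) + 2 * pi * r%:R / N%:R :> R by field.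
by rewrite expiD expi2pin mul1r.
Qed.

Lemma chi0 N : chi (0 : 'Z_N) = 1.
Proof. by rewrite /chi mulr0 mul0r expi0. Qed.

Lemma chiD N (z w : 'Z_N) : (1 < N)%N -> chi (z + w) = chi z * chi w.
Proof.
move=> N1; rewrite -[z]natr_Zp -[w]natr_Zp -natrD !chi_nat//.
by rewrite natrD mulrDr mulrDl expiD.
Qed.

End Characters.

Section ExponentialSums.
Variable R : realType.

Definition expsum N Q (z : 'I_Q -> nat) (a : 'I_Q -> R[i]) (P : {poly 'Z_N}) : R[i] :=
  \sum_(x < Q) a x * chi R (P.[(z x)%:R]).

Definition restr Q (S : pred 'I_Q) (a : 'I_Q -> R[i]) x : R[i] := if S x then a x else 0.

(** Half of the critical exponent k(k+1) of the moment curve of degree [k]. *)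
Definition tri k := (k * k.+1)./2.

Lemma tri2 k : (2 * tri k = k * k.+1)%N.
Proof.
rewrite /tri mul2n -[RHS](odd_double_half (k * k.+1)).
by rewrite oddM/= andbN.
Qed.

Lemma tri_gt0 k : (0 < k)%N -> (0 < tri k)%N.
Proof. by move=> k0; have := tri2 k; lia. Qed.

Lemma triS k : tri k.+1 = (tri k + k.+1)%N.
Proof. by have := tri2 k; have := tri2 k.+1; lia. Qed.

(** This invariance underlies both the averaging arguments and the orthogonality relations below. *)
Lemma sum_translate (V : nmodType) N k (F : {poly 'Z_N} -> V) (P : {poly 'Z_N}) :
  (size P <= k.+1)%N ->
  \sum_(al : 'rV['Z_N]_k.+1) F (rVpoly al + P) = \sum_(al : 'rV['Z_N]_k.+1) F (rVpoly al).
Proof.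
move=> sP; rewrite [RHS](reindex_inj (addIr (poly_rV P))).
by apply: eq_bigr => al _; rewrite linearD/= poly_rV_K.
Qed.

Variable p : nat.
Hypothesis p_pr : prime p.

Let p0 : (0 < p)%N := prime_gt0 p_pr.
Let p1 : (1 < p)%N := prime_gt1 p_pr.

Lemma pM_gt1 M : (0 < M)%N -> (1 < p ^ M)%N.
Proof. by move=> M0; rewrite -(exp1n M) ltn_exp2r. Qed.

(* The l^(k(k+1)) decoupling inequality for the curve (x, ..., x^k) over Z/p^M:
   exponential sums with frequencies [z x] and all polynomials of degree at most [k]
   as phases, decomposed according to the residue of [z x] modulo p^n. *)
Definition dec k n (D : R) := forall M, (0 < M)%N -> (k * n <= M)%N ->
  forall Q (z : 'I_Q -> nat) (a : 'I_Q -> R[i]),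
  \sum_(al : 'rV['Z_(p ^ M)]_k.+1) cmod (expsum z a (rVpoly al)) ^+ (2 * tri k) <=
  D * p%:R ^+ (n * (tri k).-1) * \sum_(J < p ^ n) \sum_(al : 'rV['Z_(p ^ M)]_k.+1)
    cmod (expsum z (restr (fun x => z x %% p ^ n == J)%N a) (rVpoly al)) ^+ (2 * tri k).

(* Averaging over the translates by [Phi b], which preserve the weight, turns the
   sum over the points of [S] into one along a curve of lower degree [l]. *)
Lemma dec_transfer k l n D M m (Phi : {poly 'Z_(p ^ m)} -> {poly 'Z_(p ^ M)})
    (w : {poly 'Z_(p ^ M)} -> R) Q (z y : 'I_Q -> nat) (a : 'I_Q -> R[i])
    (S : pred 'I_Q) :
  dec l n D -> (0 < M)%N -> (0 < m)%N -> (l * n <= m)%N ->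
  (forall P, 0 <= w P) ->
  (forall b : {poly 'Z_(p ^ m)}, (size (Phi b) <= k.+1)%N) ->
  (forall (b : {poly 'Z_(p ^ m)}) P, w (P + Phi b) = w P) ->
  (forall b : {poly 'Z_(p ^ m)}, (size b <= l.+1)%N -> exists kap : R[i], cmod kap = 1 /\
     forall x, S x -> chi R ((Phi b).[(z x)%:R]) = kap * chi R (b.[(y x)%:R])) ->
  \sum_(al : 'rV['Z_(p ^ M)]_k.+1)
    w (rVpoly al) * cmod (expsum z (restr S a) (rVpoly al)) ^+ (2 * tri l) <=
  D * p%:R ^+ (n * (tri l).-1) * \sum_(J < p ^ n) \sum_(al : 'rV['Z_(p ^ M)]_k.+1)
    w (rVpoly al) * cmod (expsum z
       (restr (fun x => S x && (y x %% p ^ n == J)%N) a) (rVpoly al)) ^+ (2 * tri l).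
Proof.
move=> hdec M0 m0 lnm w0 sPhi wPhi hPhi.
(* The untranslated phase goes into the coefficients, so that [b] is the only phase when [dec l] is
   applied. *)
pose a' (P : {poly 'Z_(p ^ M)}) := fun x => restr S a x * chi R (P.[(z x)%:R]).
have key (S' : pred 'I_Q) (P : {poly 'Z_(p ^ M)}) (b : {poly 'Z_(p ^ m)}) :
    (size b <= l.+1)%N ->
    w (P + Phi b) * cmod (expsum z (restr (fun x => S x && S' x) a) (P + Phi b)) ^+ (2 * tri l)
    = w P * cmod (expsum y (restr S' (a' P)) b) ^+ (2 * tri l).
  move=> sb; rewrite wPhi; congr (_ * _ ^+ _).
  have [kap [kap1 hkap]] := hPhi b sb.
  rewrite -[RHS]mul1r -kap1 -cmodM; congr cmod.
  rewrite /expsum mulr_sumr; apply: eq_bigr => x _.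
  rewrite /a' /restr; case Sx: (S x) => /=; last by rewrite !mul0r if_same mul0r mulr0.
  case: ifP => _; last by rewrite !mul0r mulr0.
  rewrite hornerD chiD ?pM_gt1// hkap//; ring.
pose B := 'rV['Z_(p ^ m)]_l.+1.
have B0 : 0 < (#|B|)%:R :> R by rewrite ltr0n; apply/card_gt0P; exists 0.
have avg (S' : pred 'I_Q) :
   (#|B|)%:R * \sum_(al : 'rV['Z_(p ^ M)]_k.+1)
     w (rVpoly al) * cmod (expsum z (restr (fun x => S x && S' x) a) (rVpoly al)) ^+ (2 * tri l)
   = \sum_(al : 'rV['Z_(p ^ M)]_k.+1) w (rVpoly al) *
     \sum_(b : B) cmod (expsum y (restr S' (a' (rVpoly al))) (rVpoly b)) ^+ (2 * tri l).
  transitivity (\sum_(b : B) \sum_(al : 'rV['Z_(p ^ M)]_k.+1)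
     w (rVpoly al) * cmod (expsum y (restr S' (a' (rVpoly al))) (rVpoly b)) ^+ (2 * tri l)).
    rewrite mulr_natl -sumr_const; apply: eq_bigr => b _.
    rewrite -(sum_translate (fun P => w P * cmod (expsum z (restr (fun x => S x && S' x) a) P) ^+ (2 * tri l)) (sPhi (rVpoly b))).
    by apply: eq_bigr => al _; rewrite key// size_poly.
  by rewrite exchange_big/=; apply: eq_bigr => al _; rewrite mulr_sumr.
have eqT (b : pred 'I_Q) : restr b a = restr (fun x => b x && predT x) a.
  by apply/funext => x; rewrite /restr andbT.
rewrite -(ler_pM2l B0) eqT avg mulrCA.
have -> : (#|B|)%:R * \sum_(J < p ^ n) \sum_(al : 'rV['Z_(p ^ M)]_k.+1)
    w (rVpoly al) * cmod (expsum z
       (restr (fun x => S x && (y x %% p ^ n == J)%N) a) (rVpoly al)) ^+ (2 * tri l)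
  = \sum_(al : 'rV['Z_(p ^ M)]_k.+1) w (rVpoly al) * \sum_(J < p ^ n)
     \sum_(b : B) cmod (expsum y (restr (fun x => y x %% p ^ n == J)%N (a' (rVpoly al))) (rVpoly b)) ^+ (2 * tri l).
  rewrite mulr_sumr; under eq_bigr do rewrite avg.
  by rewrite exchange_big/=; apply: eq_bigr => al _; rewrite mulr_sumr.
rewrite mulr_sumr; apply: ler_sum => al _.
rewrite [leRHS]mulrCA ler_wpM2l//.
have -> : restr predT (a' (rVpoly al)) = a' (rVpoly al) by apply/funext => x.
exact: hdec.
Qed.

End ExponentialSums.

Arguments chi : simpl never.

(** * Residue classes modulo powers of p and affine rescaling *)

Section Blocks.
Variable R : realType.
Variable p : nat.
Hypothesis p_pr : prime p.

Let p0 : (0 < p)%N := prime_gt0 p_pr.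
Let p1 : (1 < p)%N := prime_gt1 p_pr.
Let pX0 c : (0 < p ^ c)%N.
Proof. by rewrite expn_gt0 p0. Qed.

Definition blk Q (z : 'I_Q -> nat) c xi : pred 'I_Q := fun x => (z x %% p ^ c == xi)%N.

Lemma modn_split c u n :
  (n %% p ^ (c + u) = n %% p ^ c + p ^ c * (n %/ p ^ c %% p ^ u))%N.
Proof.
have c0 := pX0 c; have u0 := pX0 u.
set t := (n %% p ^ c)%N; set r := (n %/ p ^ c %% p ^ u)%N.
have en : (n = (n %/ p ^ c %/ p ^ u) * p ^ (c + u) + (t + p ^ c * r))%N.
  rewrite {1}(divn_eq n (p ^ c)) {1}(divn_eq (n %/ p ^ c) (p ^ u)) -/t -/r expnD.
  by ring.
rewrite {1}en modnMDl modn_small// expnD.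
have : (t < p ^ c)%N by rewrite ltn_mod.
have : (r < p ^ u)%N by rewrite ltn_mod.
by nia.
Qed.

Lemma blk_child Q (z : 'I_Q -> nat) c u xi J x : (xi < p ^ c)%N ->
  blk z (c + u)%N (xi + p ^ c * J)%N x = blk z c xi x && (z x %/ p ^ c %% p ^ u == J)%N.
Proof.
move=> xic; rewrite /blk modn_split.
set t := (z x %% p ^ c)%N; set r := (_ %% p ^ u)%N.
have tc : (t < p ^ c)%N by rewrite ltn_mod.
have [->|ne] := eqVneq t xi; first by rewrite /= eqn_add2l eqn_pmul2l.
rewrite /=; apply/negP => /eqP e; move/eqP : ne; apply.
have := congr1 (modn^~ (p ^ c)%N) e.
by rewrite /= ![(_ + p ^ c * _)%N]addnC ![(p ^ c * _)%N]mulnC !modnMDl !modn_small.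
Qed.

Lemma child_lt c u xi J : (xi < p ^ c)%N -> (J < p ^ u)%N ->
  (xi + p ^ c * J < p ^ (c + u))%N.
Proof. by rewrite expnD; nia. Qed.

Lemma chi_lift M m n : (0 < m)%N -> (m <= M)%N ->
  chi R ((p ^ (M - m) * n)%N%:R : 'Z_(p ^ M)) = chi R (n%:R : 'Z_(p ^ m)).
Proof.
move=> m0 mM; rewrite !chi_nat ?pM_gt1//; last exact: leq_trans mM.
have e : (p ^ M = p ^ (M - m) * p ^ m)%N by rewrite -expnD subnK.
congr expi; rewrite e !natrM; field.
by rewrite !pnatr_eq0 -!lt0n !pX0.
Qed.

(** If [Psi j] behaves like (X - zeta)^j on a class of zeta modulo p^c, it contributes p^(cj) there;
    the scaling brings this to p^(M-m), so the translate acts as the phase [b] at precision p^m. The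
    constant coefficient of [b] is dropped, since it only changes a unimodular factor. *)
Definition lift_shift M m (c l : nat) (Psi : nat -> {poly 'Z_(p ^ M)}) (b : {poly 'Z_(p ^ m)})
    : {poly 'Z_(p ^ M)} :=
  \sum_(j < l) (nat_of_ord (b`_j.+1)%R * p ^ (M - m - c * j.+1))%N%:R *: Psi j.+1.

Lemma size_lift_shift k M m c l (Psi : nat -> {poly 'Z_(p ^ M)}) (b : {poly 'Z_(p ^ m)}) :
  (forall j, (size (Psi j) <= k.+1)%N) -> (size (lift_shift c l Psi b) <= k.+1)%N.
Proof.
move=> sPsi; apply: (leq_trans (size_sum _ _ _)); apply/bigmax_leqP => j _.
by apply: leq_trans (size_scale_leq _ _) _.
Qed.

Lemma chi_lift_shift M m c l (Psi : nat -> {poly 'Z_(p ^ M)}) zeta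
    (cst : nat -> 'Z_(p ^ M)) (b : {poly 'Z_(p ^ m)}) :
  (0 < m)%N -> (m <= M)%N -> (size b <= l.+1)%N ->
  (forall j y, (j < l)%N -> (p ^ (M - m - c * j.+1))%N%:R *
     (Psi j.+1).[(zeta + p ^ c * y)%N%:R] = cst j + (p ^ (M - m) * y ^ j.+1)%N%:R) ->
  exists kap : R[i], cmod kap = 1 /\ forall y,
    chi R ((lift_shift c l Psi b).[(zeta + p ^ c * y)%N%:R]) = kap * chi R (b.[y%:R]).
Proof.
move=> m0 mM sb hPsi.
have pm1 := pM_gt1 p_pr m0; have pM1 : (1 < p ^ M)%N by apply: pM_gt1 => //; exact: leq_trans mM.
exists (chi R (\sum_(j < l) (nat_of_ord (b`_j.+1)%R)%:R * cst j) * (chi R b`_0)^*%C); split.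
  by rewrite cmodM cmodJ !cmod_chi mulr1.
move=> y; rewrite /lift_shift horner_sum.
under eq_bigr do rewrite hornerZ natrM -mulrA hPsi// mulrDr.
rewrite big_split/= chiD// -mulrA; congr (_ * _).
rewrite (horner_coef_wide _ sb) big_ord_recl expr0 mulr1 chiD// mulrA.
rewrite (mulrC (chi R b`_0)^*%C).
rewrite mulJ_cmod cmod_chi expr1n mul1r.
under eq_bigr do rewrite -natrM mulnCA.
rewrite -natr_sum -big_distrr/= chi_lift//; congr chi.
by rewrite natr_sum; apply: eq_bigr => j _; rewrite natrM natr_Zp natrX.
Qed.

Lemma blk_transfer k l n D M m (Psi : nat -> {poly 'Z_(p ^ M)})
    (cst : nat -> 'Z_(p ^ M)) (w : {poly 'Z_(p ^ M)} -> R)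
    Q (z : 'I_Q -> nat) (a : 'I_Q -> R[i]) c zeta :
  dec p l n D -> (0 < m)%N -> (m <= M)%N -> (l * n <= m)%N -> (zeta < p ^ c)%N ->
  (forall P, 0 <= w P) ->
  (forall j, (size (Psi j) <= k.+1)%N) ->
  (forall (b : {poly 'Z_(p ^ m)}) P, w (P + lift_shift c l Psi b) = w P) ->
  (forall j y, (j < l)%N -> (p ^ (M - m - c * j.+1))%N%:R *
     (Psi j.+1).[(zeta + p ^ c * y)%N%:R] = cst j + (p ^ (M - m) * y ^ j.+1)%N%:R) ->
  \sum_(al : 'rV['Z_(p ^ M)]_k.+1)
    w (rVpoly al) * cmod (expsum z (restr (blk z c zeta) a) (rVpoly al)) ^+ (2 * tri l) <=
  D * p%:R ^+ (n * (tri l).-1) * \sum_(J < p ^ n) \sum_(al : 'rV['Z_(p ^ M)]_k.+1)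
    w (rVpoly al) * cmod (expsum z (restr (blk z (c + n)%N (zeta + p ^ c * J)%N) a)
      (rVpoly al)) ^+ (2 * tri l).
Proof.
move=> hdec m0 mM lnm zc w0 sPsi wPsi hPsi.
have := @dec_transfer R p p_pr k l n D M m (lift_shift c l Psi) w Q z
  (fun x => z x %/ p ^ c)%N a (blk z c zeta) hdec (leq_trans m0 mM) m0 lnm w0
  (fun b => size_lift_shift c l b sPsi) wPsi.
have H (b : {poly 'Z_(p ^ m)}) : (size b <= l.+1)%N -> exists kap : R[i], cmod kap = 1 /\
    (forall x, blk z c zeta x ->
     chi R (lift_shift c l Psi b).[(z x)%:R] = kap * chi R b.[(z x %/ p ^ c)%N%:R]).
  move=> sb; have [kap [k1 hk]] := chi_lift_shift m0 mM sb hPsi.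
  exists kap; split=> // x /eqP zx; rewrite -hk -zx.
  by rewrite {1}(divn_eq (z x) (p ^ c)) addnC mulnC.
move=> /(_ H) /le_trans; apply; rewrite le_eqVlt; apply/orP; left; apply/eqP.
congr (_ * _); apply: eq_bigr => J _; apply: eq_bigr => al _.
congr (_ * cmod (expsum _ _ _) ^+ _); apply/funext => x.
by rewrite /restr blk_child.
Qed.

(** On the block z = xi + p^c y, and (X - xi)^j becomes p^(cj) y^j. The bound on [M] leaves
    precision p^(kn) for the variable y, which is what [dec] asks for. *)
Lemma dec_rescale k n D M c xi Q (z : 'I_Q -> nat) (a : 'I_Q -> R[i]) :
  (0 < k)%N -> (0 < n)%N -> dec p k n D -> (k * (c + n) <= M)%N -> (xi < p ^ c)%N ->
  \sum_(al : 'rV['Z_(p ^ M)]_k.+1)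
    cmod (expsum z (restr (blk z c xi) a) (rVpoly al)) ^+ (2 * tri k) <=
  D * p%:R ^+ (n * (tri k).-1) * \sum_(J < p ^ n) \sum_(al : 'rV['Z_(p ^ M)]_k.+1)
    cmod (expsum z (restr (blk z (c + n)%N (xi + p ^ c * J)%N) a) (rVpoly al)) ^+ (2 * tri k).
Proof.
move=> k0 n0 hdec kM xic.
have := @blk_transfer k k n D M (k * n)%N
  (fun j => if (j <= k)%N then ('X - (xi%:R)%:P) ^+ j else 0) (fun=> 0) (fun=> 1) Q z a c xi hdec.
have kn0 : (0 < k * n)%N by rewrite muln_gt0 k0.
have knM : (k * n <= M)%N by nia.
move=> /(_ kn0 knM (leqnn _) xic (fun=> ler01)).
under eq_bigr do rewrite mul1r.
under [X in _ * X]eq_bigr do under eq_bigr do rewrite mul1r.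
apply => //.
- move=> j; case: ifP => jk; last by rewrite size_poly0.
  by rewrite (leq_trans (size_exp_leq _ _))// size_XsubC mul1n ltnS.
- move=> j y jk; rewrite jk horner_exp !hornerE natrD (addrC xi%:R) addrK -natrX -natrM.
  congr (_%:R); rewrite expnMn -expnM mulnA -expnD subnK//.
  have : (c * j.+1 <= c * k)%N by rewrite leq_mul2l jk orbT.
  by lia.
Qed.

End Blocks.

(** * Polynomials vanishing at one point and osculating a monomial at another *)

Section OsculatingPolynomials.
Variable A : comUnitRingType.

(** A truncated geometric series inverts X + u modulo X^l, and the r-th power of this inverse
    inverts (X + u)^r. *)
Lemma inverse_mod_Xn (u : A) l r : u \is a GRing.unit ->
  exists S q : {poly A}, ('X + u%:P) ^+ r * S = 1 + 'X^l * q.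
Proof.
move=> uu; pose x : {poly A} := (- u^-1) *: 'X.
pose S0 : {poly A} := u^-1 *: \sum_(i < l) x ^+ i.
have TS : ('X + u%:P) * S0 = 1 - x ^+ l.
  have -> : 'X + u%:P = u *: (1 - x).
    by rewrite /x scaleNr opprK scalerDr scalerA divrr// scale1r alg_polyC addrC.
  rewrite /S0 -scalerAl -scalerAr scalerA divrr// scale1r.
  by rewrite -[RHS]opprB subrX1 -mulNr opprB.
exists (S0 ^+ r), (- (- u^-1) ^+ l *: \sum_(i < r) (1 - x ^+ l) ^+ i).
rewrite -exprMn TS; apply/eqP; rewrite -subr_eq0 opprD addrA subrX1; apply/eqP.
rewrite [X in X * _](_ : _ = - x ^+ l); last by rewrite addrAC subrr sub0r.
by rewrite {1}/x exprZn -scalerAr scaleNr !mulNr -scalerAl subrr.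
Qed.

(* [Psi] is the antiderivative of [(X - eta)^r h], where [h] has degree less than
   [l] and is chosen so that the derivative is [j (X - zeta)^(j-1)] to order [l]
   at [zeta]. *)
Lemma osculating_poly (eta zeta : A) r l j : zeta - eta \is a GRing.unit ->
  (forall i, (0 < i <= r + l)%N -> (i%:R : A) \is a GRing.unit) -> (j < l)%N ->
  exists Psi q : {poly A}, exists cst : A, exists q' : {poly A},
   [/\ (size Psi <= (r + l).+1)%N, Psi = q * ('X - eta%:P) ^+ r.+1 &
     forall y, Psi.[zeta + y] = cst + y ^+ j.+1 + y ^+ l.+1 * q'.[y]].
Proof.
move=> uu natu jl; set u := zeta - eta; pose T := 'X + u%:P.
have [S [qS hS]] := @inverse_mod_Xn u l r uu.
(* In the variable y centred at [zeta], the derivative (y + u)^r h has to equal (j+1) y^j modulo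
   y^l, which determines h modulo y^l. *)
pose g : {poly A} := (j.+1%:R *: 'X^j) * S.
pose h := take_poly l g.
(* Re-expanding in powers of X - eta lets the product with (X - eta)^r be integrated term by term;
   the denominators r+1, ..., r+l are units by hypothesis. *)
pose h1 := h \Po ('X - u%:P).
have l0 : (0 < l)%N by apply: leq_ltn_trans jl.
have sh1 : (size h1 <= l)%N.
  rewrite /h1 (leq_trans (size_comp_poly_leq _ _))// size_XsubC muln1.
  have := size_take_poly l g; rewrite -/h; move: (size h) => s; case: s => //.
pose cf i := h1`_i / (r.+1 + i)%:R.
have un i : (i < l)%N -> ((r.+1 + i)%:R : A) \is a GRing.unit.
  by move=> il; apply: natu; lia.
pose Psi := \sum_(i < l) cf i *: ('X - eta%:P) ^+ (r.+1 + i).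
pose G := Psi \Po ('X + zeta%:P).
have GE : G = \sum_(i < l) cf i *: T ^+ (r.+1 + i).
  rewrite /G /Psi linear_sum/=; apply: eq_bigr => i _.
  rewrite comp_polyZ; congr (_ *: _).
  rewrite -[LHS]/((('X - eta%:P) ^+ (r.+1 + i)) \Po ('X + zeta%:P)).
  rewrite rmorphXn/=; congr (_ ^+ _).
  by rewrite comp_polyB comp_polyX comp_polyC /T /u polyCB addrA.
have dG : G^`() = T ^+ r * h.
  have -> : h = h1 \Po T.
    rewrite /h1 -comp_polyA comp_polyB comp_polyX comp_polyC /T addrK.
    by rewrite comp_polyXr.
  rewrite -[h1 in RHS](take_poly_id sh1) /take_poly poly_def linear_sum/= mulr_sumr.
  rewrite GE linear_sum/=; apply: eq_bigr => i _.
  rewrite derivZ deriv_exp derivD derivX derivC addr0 mul1r addSn/=.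
  rewrite comp_polyZ rmorphXn/= comp_polyX -scalerAr -exprD -scaler_nat scalerA.
  by rewrite /cf -addSn mulrC mulrCA divrr ?mulr1// un// -mulrnA.
have coG i : (i < l)%N -> G`_i.+1 = (i == j)%:R.
  move=> il; have := congr1 (fun P : {poly A} => P`_i) dG.
  rewrite coef_deriv (_ : T ^+ r * h = j.+1%:R *: 'X^j + 'X^l *
     (j.+1%:R *: 'X^j * qS - T ^+ r * drop_poly l g)); last first.
    rewrite -[h](addrK (drop_poly l g * 'X^l)) poly_take_drop mulrBr /g.
    by rewrite mulrCA hS; ring.
  rewrite coefD coefZ coefXn coefXnM il addr0 -[G`_i.+1 *+ _]mulr_natr => e.
  have uni : (i.+1%:R : A) \is a GRing.unit by apply: natu; lia.
  apply: (mulIr uni); rewrite e; case: eqVneq => [->|]; first by rewrite mulrC.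
  by rewrite mulr0 mul0r.
exists Psi, (\sum_(i < l) cf i *: ('X - eta%:P) ^+ i), G`_0, (drop_poly l.+1 G); split.
- apply: (leq_trans (size_sum _ _ _)); apply/bigmax_leqP => i _.
  apply: leq_trans (size_scale_leq _ _) _.
  rewrite (leq_trans (size_exp_leq _ _))// size_XsubC mul1n; have := ltn_ord i; lia.
- rewrite mulr_suml; apply: eq_bigr => i _.
  by rewrite -scalerAl -exprD addnC.
- move=> y; have -> : Psi.[zeta + y] = G.[y] by rewrite horner_comp !hornerE addrC.
  rewrite -[G in LHS](poly_take_drop l.+1) hornerD hornerM hornerXn mulrC.
  suff -> : take_poly l.+1 G = (G`_0)%:P + 'X^(j.+1) by rewrite !hornerE mulrC.
  apply/polyP => i; rewrite coef_take_poly coefD coefC coefXn.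
  case: i => [|i]; first by rewrite ltn0Sn/= addr0.
  rewrite ltnS eqSS/= add0r; case: ltnP => [il|li]; first by rewrite coG.
  by rewrite gtn_eqF//; lia.
Qed.
End OsculatingPolynomials.

(** * Decoupling one factor of a bilinear sum in lower degree *)

Section LowerDegree.
Variable R : realType.
Variable p : nat.
Hypothesis p_pr : prime p.

Let p0 : (0 < p)%N := prime_gt0 p_pr.
Let p1 : (1 < p)%N := prime_gt1 p_pr.
Let pX0 c : (0 < p ^ c)%N.
Proof. by rewrite expn_gt0 p0. Qed.

Lemma Zpk_eq0 M n : (0 < M)%N -> (M <= n)%N -> ((p ^ n)%N%:R : 'Z_(p ^ M)) = 0.
Proof.
move=> M0 Mn; rewrite -(subnK Mn) expnD natrM.
by rewrite [X in _ * X](_ : _ = 0) ?mulr0// pchar_Zp// pM_gt1.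
Qed.

Lemma Zpk_sub_unit M zeta eta : (0 < M)%N -> zeta != eta %[mod p] ->
  (zeta%:R - eta%:R : 'Z_(p ^ M)) \is a GRing.unit.
Proof.
move=> M0 ne; have pM1 := pM_gt1 p_pr M0.
have -> : zeta%:R - eta%:R = (zeta + eta * (p ^ M).-1)%N%:R :> 'Z_(p ^ M).
  rewrite natrD natrM -subn1 natrB ?pX0//.
  by rewrite pchar_Zp// sub0r mulrN1.
rewrite unitZpE// coprimeXl//; rewrite prime_coprime//.
apply/negP => /dvdnP [q e]; move/negP: ne; apply; apply/eqP.
have e2 : (zeta + eta * p ^ M = q * p + eta)%N.
  rewrite -e -addnA; congr addn; by rewrite -mulnSr prednK ?pX0.
have : (zeta + eta * p ^ M = q * p + eta %[mod p])%N by rewrite e2.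
rewrite modnMDl -(prednK M0) expnS mulnCA -[(p * _)%N]mulnC addnC modnMDl.
by [].
Qed.

Lemma blk_shift_eq0 M b e Q (z : 'I_Q -> nat) eta x t (q : 'Z_(p ^ M)) :
  (0 < M)%N -> blk p z b eta x -> (M <= b * e + t)%N ->
  (p ^ t)%N%:R * (q * ((z x)%:R - eta%:R) ^+ e) = 0.
Proof.
move=> M0 /eqP zx le; rewrite mulrCA.
rewrite (divn_eq (z x) (p ^ b)) zx natrD addrK natrM exprMn [X in q * X]mulrCA -[(p ^ b)%N%:R ^+ e]natrX -[(p ^ t)%N%:R * _]natrM.
by rewrite -expnM -expnD addnC Zpk_eq0// !mulr0.
Qed.

(** The translates are multiples of (X - eta)^(r+1), which is divisible by p^((r+1)b) on the [eta]
    block; with l(c+n) <= (r+1)b they vanish there modulo p^M, so the [eta] factor is an invariant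
    weight. On the [zeta] block they act as phases of degree [l], and ln <= c kills the osculation
    error of order l+1. The condition k < p makes the integers up to k invertible, and zeta - eta is
    a unit because the classes differ modulo p. *)
Lemma lower_step k l r n D M c b zeta eta e Q (z : 'I_Q -> nat) (a : 'I_Q -> R[i]) :
  (k = r + l)%N -> (0 < l)%N -> (k < p)%N -> (0 < n)%N ->
  dec p l n D -> (0 < c)%N -> (0 < b)%N ->
  (zeta < p ^ c)%N -> zeta != eta %[mod p] ->
  (l * n <= c)%N -> (l * (c + n) <= r.+1 * b)%N -> (r.+1 * b <= M)%N ->
  \sum_(al : 'rV['Z_(p ^ M)]_k.+1)
    cmod (expsum z (restr (blk p z b eta) a) (rVpoly al)) ^+ e *
    cmod (expsum z (restr (blk p z c zeta) a) (rVpoly al)) ^+ (2 * tri l) <=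
  D * p%:R ^+ (n * (tri l).-1) * \sum_(J < p ^ n) \sum_(al : 'rV['Z_(p ^ M)]_k.+1)
    cmod (expsum z (restr (blk p z b eta) a) (rVpoly al)) ^+ e *
    cmod (expsum z (restr (blk p z (c + n)%N (zeta + p ^ c * J)%N) a)
      (rVpoly al)) ^+ (2 * tri l).
Proof.
move=> kE l0 kp n0 hdec c0 b0 zc ne lnc lcn rbM.
pose m := (l * n)%N.
have m0 : (0 < m)%N by rewrite muln_gt0 l0.
have mclM : (m + c * l <= M)%N by rewrite /m; nia.
have mM : (m <= M)%N by lia.
have M0 : (0 < M)%N by lia.
have pM1 := pM_gt1 p_pr M0.
have uu := Zpk_sub_unit M0 ne.
have natu i : (0 < i <= r + l)%N -> (i%:R : 'Z_(p ^ M)) \is a GRing.unit.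
  move=> /andP[i0 il]; rewrite unitZpE// coprimeXl// prime_coprime// gtnNdvd//.
  by rewrite (leq_ltn_trans il)// -kE.
have ex j : exists T : {poly 'Z_(p ^ M)} * 'Z_(p ^ M), (size T.1 <= k.+1)%N /\
   ((0 < j <= l)%N -> (exists q, T.1 = q * ('X - eta%:R%:P) ^+ r.+1) /\
    exists q', forall y, T.1.[zeta%:R + y] = T.2 + y ^+ j + y ^+ l.+1 * q'.[y]).
  case: j => [|j]; first by exists (0, 0); rewrite size_poly0.
  have [jl|lj] := ltnP j l; last by exists (0, 0); rewrite size_poly0.
  have [Psi [q [cst [q' [h1 h2 h3]]]]] := osculating_poly uu natu jl.
  exists (Psi, cst); rewrite /= kE; split=> // _; split; first by exists q.
  by exists q'.
have {ex} [F hF] := boolp.choice ex.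
pose Psi j := (F j).1; pose cst j : 'Z_(p ^ M) := (p ^ (M - m - c * j.+1))%N%:R * (F j.+1).2.
pose w (P : {poly 'Z_(p ^ M)}) := cmod (expsum z (restr (blk p z b eta) a) P) ^+ e.
apply: (@blk_transfer R p p_pr k l n D M m Psi cst w) => //.
- by move=> P; rewrite /w exprn_ge0// cmod_ge0.
- by move=> j; exact: (hF j).1.
- move=> be P; rewrite /w; congr (cmod _ ^+ _); apply: eq_bigr => x _.
  rewrite /restr; case: ifP => bx; last by rewrite !mul0r.
  rewrite hornerD (_ : (lift_shift _ _ _ _).[_] = 0) ?addr0//.
  rewrite /lift_shift horner_sum big1// => j _.
  have [|[q hq] _] := (hF j.+1).2; first by rewrite /= ltn_ord.
  rewrite /Psi hq hornerZ hornerM horner_exp hornerXsubC natrM -mulrA.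
  rewrite (blk_shift_eq0 _ M0 bx) ?mulr0//.
  have := ltn_ord j; move: (nat_of_ord j) => i il.
  have : (c * i.+1 <= c * l)%N by rewrite leq_mul2l il orbT.
  rewrite /m in mclM mM *; nia.
- move=> j y jl; have [|_ [q' hq']] := (hF j.+1).2; first by rewrite /= jl.
  have cjl : (c * j.+1 <= c * l)%N by rewrite leq_mul2l jl orbT.
  rewrite /Psi natrD hq' !mulrDr /cst -!natrX -natrM !expnMn -!expnM.
  rewrite [X in _ + X](_ : _ = 0); last first.
    rewrite mulrA -natrM mulnA -expnD natrM (Zpk_eq0 M0) ?mul0r//.
    by rewrite mulnS; lia.
  rewrite addr0 mulnA -expnD; congr (_ + (_ ^ _ * _)%N%:R); lia.
Qed.

End LowerDegree.

Lemma sum_mul_split (R : realType) m n (F : nat -> R) :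
  \sum_(i < m * n) F i = \sum_(i < m) \sum_(j < n) F (i + m * j)%N.
Proof.
rewrite exchange_big/=; elim: n => [|n IH]; first by rewrite muln0 !big_ord0.
rewrite big_ord_recr/= -IH -(big_mkord predT F) -(big_mkord predT F).
have le : (m * n <= m * n.+1)%N by rewrite leq_mul2l leqnSn orbT.
rewrite (big_cat_nat (leq0n _) le)/=.
congr (_ + _); rewrite -{1}[(m * n)%N]add0n big_addn mulnS addnK big_mkord.
by [].
Qed.

Section LowerDecoupling.
Variable R : realType.
Variable p : nat.
Hypothesis p_pr : prime p.

Let p0 : (0 < p)%N := prime_gt0 p_pr.
Let p1 : (1 < p)%N := prime_gt1 p_pr.
Let pX0 c : (0 < p ^ c)%N.
Proof. by rewrite expn_gt0 p0. Qed.
Let pR0 : 0 < p%:R :> R.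
Proof. by rewrite ltr0n. Qed.

Definition bsum N Q (z : 'I_Q -> nat) (a : 'I_Q -> R[i]) c xi (P : {poly 'Z_N}) : R :=
  cmod (expsum z (restr (blk p z c xi) a) P).

Lemma bsum_ge0 N Q (z : 'I_Q -> nat) (a : 'I_Q -> R[i]) c xi (P : {poly 'Z_N}) :
  0 <= bsum z a c xi P.
Proof. exact: cmod_ge0. Qed.

Lemma bsum_split N Q (z : 'I_Q -> nat) (a : 'I_Q -> R[i]) c u xi (P : {poly 'Z_N}) :
  (xi < p ^ c)%N ->
  bsum z a c xi P <= \sum_(J < p ^ u) bsum z a (c + u)%N (xi + p ^ c * J)%N P.
Proof.
move=> xic; rewrite /bsum.
suff -> : expsum z (restr (blk p z c xi) a) P =
   \sum_(J < p ^ u) expsum z (restr (blk p z (c + u)%N (xi + p ^ c * J)%N) a) P.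
  exact: ler_cmod_sum.
rewrite /expsum exchange_big/=; apply: eq_bigr => x _.
rewrite -mulr_suml; congr (_ * _); rewrite /restr.
under eq_bigr do rewrite blk_child//.
case: ifP => _ /=; last by rewrite big1.
have rl : (z x %/ p ^ c %% p ^ u < p ^ u)%N by rewrite ltn_mod.
by rewrite -big_mkcond (big_pred1 (Ordinal rl)).
Qed.

Lemma bsumX_split N Q (z : 'I_Q -> nat) (a : 'I_Q -> R[i]) c u xi (P : {poly 'Z_N}) m :
  (xi < p ^ c)%N -> (0 < m)%N ->
  bsum z a c xi P ^+ m <= p%:R ^+ (u * m.-1) *
    \sum_(J < p ^ u) bsum z a (c + u)%N (xi + p ^ c * J)%N P ^+ m.
Proof.
case: m => // m xic _ /=.
have /lerXn2r := @bsum_split N Q z a c u xi P xic.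
move=> /(_ m.+1 (bsum_ge0 _ _ _ _ _) _) /le_trans; apply.
  by rewrite nnegrE sumr_ge0// => J _; exact: bsum_ge0.
apply: le_trans (exprn_sum_le _ _ _) _; first by move=> J; exact: bsum_ge0.
by rewrite card_ord natrX -exprM.
Qed.

Lemma lower_multi k l r n D M c b zeta eta e Q (z : 'I_Q -> nat) (a : 'I_Q -> R[i]) t :
  (k = r + l)%N -> (0 < l)%N -> (k < p)%N -> (0 < n)%N -> 0 <= D ->
  dec p l n D -> (0 < c)%N -> (0 < b)%N ->
  (zeta < p ^ c)%N -> zeta != eta %[mod p] ->
  (0 < t -> l * n <= c)%N -> (l * (c + t * n) <= r.+1 * b)%N -> (r.+1 * b <= M)%N ->
  \sum_(al : 'rV['Z_(p ^ M)]_k.+1)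
    bsum z a b eta (rVpoly al) ^+ e * bsum z a c zeta (rVpoly al) ^+ (2 * tri l) <=
  D ^+ t * p%:R ^+ (t * n * (tri l).-1) * \sum_(J < p ^ (t * n)) \sum_(al : 'rV['Z_(p ^ M)]_k.+1)
    bsum z a b eta (rVpoly al) ^+ e *
    bsum z a (c + t * n)%N (zeta + p ^ c * J)%N (rVpoly al) ^+ (2 * tri l).
Proof.
move=> kE l0 kp n0 D0 hdec c0 b0 zc ne; elim: t => [|t IH] hc hl hM.
  by rewrite mul0n expn0 big_ord1 !expr0 !mul1r muln0 !addn0.
have lc := hc isT.
apply: (le_trans (IH _ _ hM)); [by []|nia|].
have -> : D ^+ t.+1 * p%:R ^+ (t.+1 * n * (tri l).-1) =
  D ^+ t * p%:R ^+ (t * n * (tri l).-1) * (D * p%:R ^+ (n * (tri l).-1)).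
  by rewrite exprSr (mulSn t) mulnDl exprD; ring.
rewrite -[leRHS]mulrA ler_wpM2l ?mulr_ge0 ?exprn_ge0 ?(ltW pR0)//.
have -> : (t.+1 * n = t * n + n)%N by rewrite mulSn addnC.
rewrite expnD (sum_mul_split _ _ (fun J => \sum_(al : 'rV['Z_(p ^ M)]_k.+1)
    bsum z a b eta (rVpoly al) ^+ e *
    bsum z a (c + (t * n + n))%N (zeta + p ^ c * J)%N (rVpoly al) ^+ (2 * tri l))).
rewrite mulr_sumr; apply: ler_sum => J _.
have zJ : (zeta + p ^ c * J < p ^ (c + t * n))%N by apply: child_lt.
have neJ : zeta + p ^ c * J != eta %[mod p].
  by rewrite -(prednK c0) expnS -mulnA [(p * _)%N]mulnC addnC modnMDl.
have c'0 : (0 < c + t * n)%N by rewrite addn_gt0 c0.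
have := @lower_step R p p_pr k l r n D M (c + t * n)%N b _ eta e Q z a kE l0 kp n0 hdec c'0 b0 zJ neJ.
move=> /(_ _ _ hM); have -> : (c + t * n + n = c + t.+1 * n)%N by rewrite mulSn; lia.
move=> /(_ (leq_trans lc (leq_addr _ _)) hl) /le_trans; apply.
rewrite ler_wpM2l ?mulr_ge0 ?exprn_ge0 ?(ltW pR0)//.
rewrite le_eqVlt; apply/orP; left; apply/eqP.
apply: eq_bigr => J' _; apply: eq_bigr => al _; congr (_ * bsum _ _ _ _ _ ^+ _).
  by rewrite mulSn; lia.
by rewrite mulnDr expnD mulnA addnA.
Qed.

(** A single inequality of length [n] is iterated. The iteration can start only at a scale [c1] that
    is at least ln and lies a multiple of [n] below [c']; the gap between [c] and [c1] is at most
    (l+1)n and is crossed trivially, at a cost that [C] pays. *)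
Lemma lower_dec l (eps : R) : (0 < l)%N -> 0 < eps ->
  (forall eps' : R, 0 < eps' -> exists2 n, (0 < n)%N & dec p l n (p%:R `^ (eps' * n%:R))) ->
  exists2 C : R, 0 < C & forall k r M c c' b zeta eta e Q (z : 'I_Q -> nat) (a : 'I_Q -> R[i]),
  (k = r + l)%N -> (k < p)%N -> (0 < c <= c')%N -> (0 < b)%N ->
  (zeta < p ^ c)%N -> zeta != eta %[mod p] ->
  (l * c' <= r.+1 * b)%N -> (r.+1 * b <= M)%N ->
  \sum_(al : 'rV['Z_(p ^ M)]_k.+1)
    bsum z a b eta (rVpoly al) ^+ e * bsum z a c zeta (rVpoly al) ^+ (2 * tri l) <=
  C * p%:R `^ (eps * c'%:R) * p%:R ^+ ((c' - c) * (tri l).-1) *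
  \sum_(J < p ^ (c' - c)) \sum_(al : 'rV['Z_(p ^ M)]_k.+1)
    bsum z a b eta (rVpoly al) ^+ e *
    bsum z a c' (zeta + p ^ c * J)%N (rVpoly al) ^+ (2 * tri l).
Proof.
move=> l0 e0 /(_ _ e0) [n n0 hdec].
exists (p%:R ^+ (l.+1 * n * tri l)); first by rewrite exprn_gt0.
move=> k r M c c' b zeta eta e Q z a kE kp /andP[c0 cc'] b0 zc ne lc' rbM.
have [c1 [t [cc1 c'E c1c tl]]] : exists c1 t, [/\ (c <= c1)%N, (c' = c1 + t * n)%N,
    (c1 - c <= l.+1 * n)%N & (0 < t -> l * n <= c1)%N].
  have [le|lt] := leqP c' (maxn c (l * n)).
    by exists c', 0; split=> //; [rewrite mul0n addn0|rewrite mulSn; lia].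
  exists (maxn c (l * n) + (c' - maxn c (l * n)) %% n)%N, ((c' - maxn c (l * n)) %/ n)%N.
  split; [by lia| | |by lia].
    by rewrite -addnA [X in (_ + X)%N]addnC -divn_eq subnKC// ltnW.
  have : ((c' - maxn c (l * n)) %% n < n)%N by rewrite ltn_mod.
  by rewrite mulSn; lia.
set u := (c1 - c)%N; have uE : (c1 = c + u)%N by rewrite subnKC.
have tr0 : (0 < tri l)%N by apply: tri_gt0.
pose S x xi := \sum_(al : 'rV['Z_(p ^ M)]_k.+1)
    bsum z a b eta (rVpoly al) ^+ e * bsum z a x xi (rVpoly al) ^+ (2 * tri l).
have triv : S c zeta <= p%:R ^+ (u * (2 * tri l).-1) * \sum_(J < p ^ u) S c1 (zeta + p ^ c * J)%N.
  rewrite exchange_big/= mulr_sumr; apply: ler_sum => al _.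
  rewrite -mulr_sumr mulrCA ler_wpM2l ?exprn_ge0 ?bsum_ge0// uE.
  by apply: bsumX_split; rewrite // muln_gt0.
have D0 : 0 <= p%:R `^ (eps * n%:R) :> R by apply: powR_ge0.
have multi J : (J < p ^ u)%N -> S c1 (zeta + p ^ c * J)%N <=
    (p%:R `^ (eps * n%:R)) ^+ t * p%:R ^+ (t * n * (tri l).-1) *
    \sum_(J' < p ^ (t * n)) S c' (zeta + p ^ c * (J + p ^ u * J'))%N.
  move=> Ju; have zJ : (zeta + p ^ c * J < p ^ c1)%N by rewrite uE child_lt.
  have neJ : zeta + p ^ c * J != eta %[mod p].
    by rewrite -(prednK c0) expnS -mulnA [(p * _)%N]mulnC addnC modnMDl.
  have := @lower_multi k l r n _ M c1 b (zeta + p ^ c * J)%N eta e Q z a t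
    kE l0 kp n0 D0 hdec (leq_trans c0 cc1) b0 zJ neJ tl.
  rewrite -c'E => /(_ lc' rbM) /le_trans; apply.
  rewrite ler_wpM2l ?mulr_ge0 ?exprn_ge0 ?(ltW pR0)//.
  rewrite le_eqVlt; apply/orP; left; apply/eqP; apply: eq_bigr => J' _.
  by rewrite /S mulnDr mulnA -expnD -uE addnA.
apply: (le_trans triv).
have c'cE : (c' - c = u + t * n)%N by lia.
rewrite c'cE expnD (sum_mul_split _ _ (fun J => S c' (zeta + p ^ c * J)%N)).
have step : \sum_(J < p ^ u) S c1 (zeta + p ^ c * J)%N <=
   (p%:R `^ (eps * n%:R)) ^+ t * p%:R ^+ (t * n * (tri l).-1) *
    \sum_(J < p ^ u) \sum_(J' < p ^ (t * n)) S c' (zeta + p ^ c * (J + p ^ u * J'))%N.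
  by rewrite mulr_sumr; apply: ler_sum => J _; apply: multi.
apply: (le_trans (ler_wpM2l _ step)); first by rewrite exprn_ge0// ltW.
rewrite mulrA ler_wpM2r//.
  apply: sumr_ge0 => J _; apply: sumr_ge0 => J' _; apply: sumr_ge0 => al _.
  by rewrite mulr_ge0// exprn_ge0// bsum_ge0.
have pge1 : 1 <= p%:R :> R by rewrite ler1n.
have h1 : (p%:R `^ (eps * n%:R)) ^+ t <= p%:R `^ (eps * c'%:R) :> R.
  rewrite -powR_mulrn ?powR_ge0// -powRrM ler_powR// -mulrA ler_pM2l// -natrM ler_nat.
  by rewrite c'E mulnC leq_addl.
rewrite mulrCA [leRHS]mulrAC [leRHS]mulrC ler_pM ?exprn_ge0 ?powR_ge0 ?mulr_ge0//.
rewrite -!exprD; apply: ler_weXn2l => //.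
have {}c1c : (u <= l.+1 * n)%N := c1c.
clear -c1c tr0; clearbody u.
have : (u * tri l <= l.+1 * n * tri l)%N by rewrite leq_mul2r c1c orbT.
have -> : (u * (2 * tri l).-1 = u * (tri l).-1 + u * tri l)%N by nia.
rewrite mulnDl; lia.
Qed.

End LowerDecoupling.

(** * Bilinear sums over two residue classes *)

Section Interpolation.
Variable R : realType.

Lemma powR_interpolate (F : R) A A1 A2 m : 0 <= F -> (0 < A)%N -> (0 < A2)%N ->
  (m.+1 * A = m * A1 + A2)%N ->
  F ^+ A = (F ^+ A1) `^ (1 - m.+1%:R^-1) * (F ^+ A2) `^ (m.+1%:R^-1).
Proof.
move=> F0 A0 A20 e.
have mn0 : (m.+1%:R : R) != 0 by rewrite pnatr_eq0.
have [->|Fn0] := eqVneq F 0.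
  by rewrite !expr0n (gtn_eqF A0) (gtn_eqF A20)/= powR0 ?mulr0// invr_eq0.
rewrite -!powR_mulrn// -!powRrM -powRD; last by rewrite Fn0 implybT.
congr (_ `^ _); apply: (mulfI mn0); rewrite -natrM e natrD natrM mulrDr.
rewrite [X in _ = _ + X]mulrCA divff// mulr1; congr (_ + _).
rewrite mulrCA mulrBr mulr1 divff// -[m.+1%:R]natr1 addrK; ring.
Qed.

End Interpolation.

Section Bilinear.
Variable R : realType.
Variable p : nat.
Hypothesis p_pr : prime p.

Let p0 : (0 < p)%N := prime_gt0 p_pr.
Let p1 : (1 < p)%N := prime_gt1 p_pr.
Let pX0 c : (0 < p ^ c)%N.
Proof. by rewrite expn_gt0 p0. Qed.
Let pR0 : 0 < p%:R :> R.
Proof. by rewrite ltr0n. Qed.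
Let pR1 : 1 <= p%:R :> R.
Proof. by rewrite ler1n. Qed.

Section Fixed.
Variables (k n M Q : nat) (z : 'I_Q -> nat) (a : 'I_Q -> R[i]).
Hypothesis k1 : (1 < k)%N.
Hypothesis kp : (k < p)%N.
Hypothesis knM : (k * n <= M)%N.

Local Notation f c xi al := (bsum p z a c xi (rVpoly (al : 'rV['Z_(p ^ M)]_k.+1))).

(** What decoupling the block [xi] modulo p^c down to scale p^n would give with constant 1. *)
Definition Xsum c xi : R := p%:R ^+ ((n - c) * (tri k).-1) *
  \sum_(J < p ^ (n - c)) \sum_(al : 'rV['Z_(p ^ M)]_k.+1) f n (xi + p ^ c * J)%N al ^+ (2 * tri k).

(** The total exponent is critical for degree [k], and the share of the first block is critical for
    degree [l], so that lower degree decoupling applies to it. *)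
Definition Ysum l c xi b eta : R := \sum_(al : 'rV['Z_(p ^ M)]_k.+1)
  f c xi al ^+ (2 * tri l) * f b eta al ^+ (2 * (tri k - tri l)).

Definition th l : R := (tri l)%:R / (tri k)%:R.

Lemma Xsum_ge0 c xi : 0 <= Xsum c xi.
Proof.
rewrite mulr_ge0 ?exprn_ge0 ?(ltW pR0)// sumr_ge0// => J _; rewrite sumr_ge0// => al _.
by rewrite exprn_ge0// bsum_ge0.
Qed.

Lemma Ysum_ge0 l c xi b eta : 0 <= Ysum l c xi b eta.
Proof. by apply: sumr_ge0 => al _; rewrite mulr_ge0 ?exprn_ge0 ?bsum_ge0. Qed.

Lemma Xsum_split c c1 xi : (c <= c1 <= n)%N ->
  Xsum c xi = p%:R ^+ ((c1 - c) * (tri k).-1) * \sum_(J < p ^ (c1 - c)) Xsum c1 (xi + p ^ c * J)%N.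
Proof.
move=> /andP[cc1 c1n]; rewrite /Xsum -mulr_sumr mulrA -exprD -mulnDl.
have e : (n - c = (c1 - c) + (n - c1))%N by lia.
rewrite -e; congr (_ * _); rewrite e expnD.
rewrite (sum_mul_split _ _ (fun J => \sum_(al : 'rV['Z_(p ^ M)]_k.+1) f n (xi + p ^ c * J)%N al ^+ (2 * tri k))).
apply: eq_bigr => J _; apply: eq_bigr => J' _; apply: eq_bigr => al _.
by rewrite mulnDr mulnA -expnD subnKC// addnA.
Qed.

Lemma Xsum_le c c1 xi J : (c <= c1 <= n)%N -> (J < p ^ (c1 - c))%N ->
  Xsum c1 (xi + p ^ c * J)%N <= Xsum c xi.
Proof.
move=> h Jl; rewrite (Xsum_split _ h).
have /ler_wpM2r : 1 <= p%:R ^+ ((c1 - c) * (tri k).-1) :> R by rewrite exprn_ege1.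
move=> /(_ (\sum_(J < p ^ (c1 - c)) Xsum c1 (xi + p ^ c * J)%N)).
rewrite mul1r sumr_ge0; last by move=> i _; exact: Xsum_ge0.
move=> /(_ isT); apply: le_trans.
rewrite (bigD1 (Ordinal Jl))//= lerDl sumr_ge0// => i _; exact: Xsum_ge0.
Qed.

Let tk0 : (0 < tri k)%N.
Proof. by apply: tri_gt0; lia. Qed.
Let tkR0 : 0 < (tri k)%:R :> R.
Proof. by rewrite ltr0n. Qed.

Lemma tri_lt l : (l < k)%N -> (tri l < tri k)%N.
Proof.
move=> lk; have := tri2 l; have := tri2 k.
have : (l * l.+1 < k * k.+1)%N by apply: ltn_mul; lia.
lia.
Qed.

Lemma th_gt0 l : (0 < l)%N -> 0 < th l.
Proof. by move=> l0; rewrite divr_gt0// ltr0n tri_gt0. Qed.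

Lemma th_lt1 l : (l < k)%N -> th l < 1.
Proof. by move=> lk; rewrite ltr_pdivrMr// mul1r ltr_nat tri_lt. Qed.

Lemma th0 : th 0 = 0.
Proof. by rewrite /th mul0r. Qed.

Lemma bsum_le_Xsum C et c xi : 0 <= C -> (forall m, (0 < m)%N -> dec p k m (C * p%:R `^ (et * m%:R))) ->
  (c < n)%N -> (xi < p ^ c)%N ->
  \sum_(al : 'rV['Z_(p ^ M)]_k.+1) f c xi al ^+ (2 * tri k) <=
  C * p%:R `^ (et * (n - c)%:R) * Xsum c xi.
Proof.
move=> C0 hC cn xic; have nc0 : (0 < n - c)%N by rewrite subn_gt0.
have hM : (k * (c + (n - c)) <= M)%N by rewrite subnKC// ltnW.
have := @dec_rescale R p p_pr k (n - c) _ M c xi Q z a (ltnW k1) nc0 (hC _ nc0) hM xic.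
by rewrite subnKC 1?ltnW// /Xsum mulrA.
Qed.

(** With j = k - l, the identity (j+1) tri(l) = j tri(l-1) + tri(k) - tri(j) fixes the Hölder
    exponents. In the second factor the blocks have changed places: the critical exponent now sits
    on [eta]. *)
Lemma Ysum_hoelder l c xi b eta : (0 < l < k)%N ->
  Ysum l c xi b eta <= Ysum l.-1 c xi b eta `^ (1 - (k - l).+1%:R^-1) *
     Ysum (k - l) b eta c xi `^ ((k - l).+1%:R^-1).
Proof.
move=> /andP[l0 lk].
have m01 : 0 < ((k - l).+1%:R^-1 : R) < 1.
  by rewrite invr_gt0 ltr0n /= invf_lt1 ?ltr0n// ltr1n ltnS subn_gt0.
have hf := @hoelder_sum R 'rV['Z_(p ^ M)]_k.+1 predT
  (fun al => f c xi al ^+ (2 * tri l.-1) * f b eta al ^+ (2 * (tri k - tri l.-1)))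
  (fun al => f b eta al ^+ (2 * tri (k - l)) * f c xi al ^+ (2 * (tri k - tri (k - l)))) _ m01.
apply: le_trans (hf _ _); last 2 first.
- by move=> al; rewrite mulr_ge0 ?exprn_ge0 ?bsum_ge0.
- by move=> al; rewrite mulr_ge0 ?exprn_ge0 ?bsum_ge0.
rewrite le_eqVlt; apply/orP; left; apply/eqP; apply: eq_bigr => al _.
have t1 := tri_lt lk; have [kl0 klk] : (0 < k - l)%N /\ (k - l < k)%N by lia.
have t2 := tri_lt klk; have t3 := tri_gt0 kl0; have t4 := tri_gt0 l0.
have e0 := tri2 k; have e1 := tri2 l; have e2 := tri2 l.-1; have e3 := tri2 (k - l).
rewrite !powRM ?exprn_ge0 ?bsum_ge0//.
have [i [j [lE kE]]] : exists i j, l = i.+1 /\ k = (i.+1 + j)%N.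
  by exists l.-1, (k - l)%N; lia.
have jE : (k - l = j)%N by lia.
have iE : l.-1 = i by lia.
rewrite jE iE in e2 e3 t2 t3 *.
have g1 : (2 * tri k = 2 * tri j + i.+1 * (i + 2 * j + 2))%N by rewrite e0 e3 kE; ring.
have g2 : (2 * tri k = 2 * tri l + j * (j + 2 * i + 3))%N by rewrite e0 e1 kE lE; ring.
have g3 : (2 * tri k = 2 * tri i + j.+1 * (j + 2 * i + 2))%N by rewrite e0 e2 kE; ring.
rewrite (@powR_interpolate R (f c xi al) (2 * tri l)%N (2 * tri i)%N
  (2 * (tri k - tri j))%N j) ?bsum_ge0//; last 3 first.
- by lia.
- by lia.
- by rewrite mulnBr g1 addKn e1 e2 lE; ring.
rewrite (@powR_interpolate R (f b eta al) (2 * (tri k - tri l))%N (2 * (tri k - tri i))%N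
    (2 * tri j)%N j) ?bsum_ge0//; last 3 first.
- by lia.
- by lia.
- by rewrite !(mulnBr 2%N) {1}g2 g3 !addKn e3; ring.
by ring.
Qed.

End Fixed.
End Bilinear.

Section BilinearIteration.
Variable R : realType.
Variable p : nat.
Hypothesis p_pr : prime p.

Let p0 : (0 < p)%N := prime_gt0 p_pr.
Let p1 : (1 < p)%N := prime_gt1 p_pr.
Let pX0 c : (0 < p ^ c)%N.
Proof. by rewrite expn_gt0 p0. Qed.
Let pR0 : 0 < p%:R :> R.
Proof. by rewrite ltr0n. Qed.
Let pR1 : 1 <= p%:R :> R.
Proof. by rewrite ler1n. Qed.

Definition pw (x : R) : R := p%:R `^ x.

Lemma pwD x y : pw (x + y) = pw x * pw y.
Proof. by rewrite /pw powRD// (gt_eqF pR0) implybT. Qed.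

Lemma pw_ge0 x : 0 <= pw x.
Proof. exact: powR_ge0. Qed.

Lemma ler_pw x y : x <= y -> pw x <= pw y.
Proof. exact: ler_powR. Qed.

Lemma pwX n : p%:R ^+ n = pw n%:R.
Proof. by rewrite /pw powR_mulrn// ltW. Qed.

Lemma pwM x y : pw x `^ y = pw (x * y).
Proof. by rewrite /pw powRrM. Qed.

Lemma pw_ge1 x : 0 <= x -> 1 <= pw x.
Proof. by move=> x0; rewrite -(powRr0 (p%:R : R)) ler_powR. Qed.

Variable k : nat.
Hypothesis k1 : (1 < k)%N.
Hypothesis kp : (k < p)%N.

Definition uniform_lower_dec (eps C1 : R) := forall l, (0 < l < k)%N ->
  forall M c c' b zeta eta e Q (z : 'I_Q -> nat) (a : 'I_Q -> R[i]),
  (0 < c <= c')%N -> (0 < b)%N ->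
  (zeta < p ^ c)%N -> zeta != eta %[mod p] ->
  (l * c' <= (k - l).+1 * b)%N -> ((k - l).+1 * b <= M)%N ->
  \sum_(al : 'rV['Z_(p ^ M)]_k.+1)
    bsum p z a b eta (rVpoly al) ^+ e * bsum p z a c zeta (rVpoly al) ^+ (2 * tri l) <=
  C1 * pw (eps * c'%:R) * p%:R ^+ ((c' - c) * (tri l).-1) *
  \sum_(J < p ^ (c' - c)) \sum_(al : 'rV['Z_(p ^ M)]_k.+1)
    bsum p z a b eta (rVpoly al) ^+ e *
    bsum p z a c' (zeta + p ^ c * J)%N (rVpoly al) ^+ (2 * tri l).

Lemma exists_uniform_lower_dec (eps : R) : 0 < eps ->
  (forall l, (0 < l < k)%N -> forall eps' : R, 0 < eps' ->
     exists2 n, (0 < n)%N & dec p l n (p%:R `^ (eps' * n%:R))) ->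
  exists2 C1 : R, 1 <= C1 & uniform_lower_dec eps C1.
Proof.
move=> e0 h.
have /boolp.choice [F hF] : forall l, exists C : R, 0 <= C /\ ((0 < l < k)%N ->
  forall M c c' b zeta eta e Q (z : 'I_Q -> nat) (a : 'I_Q -> R[i]),
  (0 < c <= c')%N -> (0 < b)%N ->
  (zeta < p ^ c)%N -> zeta != eta %[mod p] ->
  (l * c' <= (k - l).+1 * b)%N -> ((k - l).+1 * b <= M)%N ->
  \sum_(al : 'rV['Z_(p ^ M)]_k.+1)
    bsum p z a b eta (rVpoly al) ^+ e * bsum p z a c zeta (rVpoly al) ^+ (2 * tri l) <=
  C * pw (eps * c'%:R) * p%:R ^+ ((c' - c) * (tri l).-1) *
  \sum_(J < p ^ (c' - c)) \sum_(al : 'rV['Z_(p ^ M)]_k.+1)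
    bsum p z a b eta (rVpoly al) ^+ e *
    bsum p z a c' (zeta + p ^ c * J)%N (rVpoly al) ^+ (2 * tri l)).
  move=> l; case: (boolP (0 < l < k)%N) => [lk|_]; last by exists 0.
  have /andP[l0 lk'] := lk.
  have [C C0 hC] := lower_dec p_pr l0 e0 (h l lk).
  exists C; split; first exact: ltW.
  move=> _ M c c' b zeta eta e Q z a.
  by apply: hC => //; rewrite subnK// ltnW.
exists (1 + \sum_(l < k) F l); first by rewrite lerDl sumr_ge0// => l _; exact: (hF l).1.
move=> l lk M c c' b zeta eta e Q z a cc b0 zc ne lc rb.
apply: (le_trans ((hF l).2 lk M c c' b zeta eta e Q z a cc b0 zc ne lc rb)).
rewrite ler_wpM2r//.
  apply: sumr_ge0 => J _; apply: sumr_ge0 => al _.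
  by rewrite mulr_ge0// exprn_ge0// bsum_ge0.
rewrite ler_wpM2r ?exprn_ge0 ?(ltW pR0)// ler_wpM2r ?pw_ge0//.
have /andP[_ lk'] := lk.
rewrite (bigD1 (Ordinal lk'))//= addrCA lerDl addr_ge0// sumr_ge0// => i _.
exact: (hF i).1.
Qed.

Lemma th_tri l : th R k l * (tri k)%:R = (tri l)%:R.
Proof. by rewrite /th divfK// pnatr_eq0 -lt0n tri_gt0// ltnW. Qed.

Lemma th_ge0 l : 0 <= th R k l.
Proof. by rewrite /th divr_ge0. Qed.

Section Push.
Variables (n M Q : nat) (z : 'I_Q -> nat) (a : 'I_Q -> R[i]).
Hypothesis knM : (k * n <= M)%N.
Local Notation X := (Xsum p k n M z a).
Local Notation Y := (Ysum p k M z a).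

(** The first block is decoupled in degree [l] down to scale [c1], the hypothesis is applied to each
    piece, and the pieces are recombined by concavity of x^(th l). The powers of p cancel exactly
    because [th l] times [tri k] is [tri l]. *)
Lemma Ysum_push (eps C1 : R) l c c1 b xi eta (B : R) :
  uniform_lower_dec eps C1 -> 0 <= C1 -> 0 <= B -> (0 < l < k)%N ->
  (0 < c <= c1)%N -> (c1 <= n)%N -> (0 < b)%N -> (xi < p ^ c)%N -> xi != eta %[mod p] ->
  (l * c1 <= (k - l).+1 * b)%N -> ((k - l).+1 * b <= M)%N ->
  (forall J, (J < p ^ (c1 - c))%N -> Y l c1 (xi + p ^ c * J)%N b eta <=
      B * (X c1 (xi + p ^ c * J)%N `^ th R k l * X b eta `^ (1 - th R k l))) ->
  Y l c xi b eta <= C1 * pw (eps * c1%:R) * B *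
     (X c xi `^ th R k l * X b eta `^ (1 - th R k l)).
Proof.
move=> hld C10 B0 lk cc1 c1n b0 xc ne lc rb hJ.
have /andP[l0 lk'] := lk; have /andP[c0 cle] := cc1.
have := hld l lk M c c1 b xi eta (2 * (tri k - tri l))%N Q z a cc1 b0 xc ne lc rb.
under eq_bigr do rewrite mulrC.
rewrite -/(Y l c xi b eta) => /le_trans; apply.
have sumle : \sum_(J < p ^ (c1 - c)) \sum_(al : 'rV['Z_(p ^ M)]_k.+1)
    bsum p z a b eta (rVpoly al) ^+ (2 * (tri k - tri l)) *
    bsum p z a c1 (xi + p ^ c * J)%N (rVpoly al) ^+ (2 * tri l) <=
   B * X b eta `^ (1 - th R k l) * \sum_(J < p ^ (c1 - c)) X c1 (xi + p ^ c * J)%N `^ th R k l.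
  rewrite mulr_sumr; apply: ler_sum => J _.
  under eq_bigr do rewrite mulrC.
  rewrite -/(Y l c1 (xi + p ^ c * J)%N b eta) (le_trans (hJ J (ltn_ord J)))//.
  by rewrite -[leRHS]mulrA [X in _ <= _ * X]mulrC.
have th01 : 0 < th R k l < 1 by rewrite (th_gt0 R p_pr k1 kp knM) //= (th_lt1 R p_pr k1 kp knM).
have := @powR_sum_le R _ predT (fun J : 'I_(p ^ (c1 - c)) => X c1 (xi + p ^ c * J)%N) _ th01
   (fun J => Xsum_ge0 p_pr _ _ _ _ _ _ _).
rewrite card_ord => hpow0.
have {hpow0}hpow : \sum_(J < p ^ (c1 - c)) X c1 (xi + p ^ c * J)%N `^ th R k l <=
   (p ^ (c1 - c))%N%:R `^ (1 - th R k l) *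
   (\sum_(J < p ^ (c1 - c)) X c1 (xi + p ^ c * J)%N) `^ th R k l by [].
set T := p%:R ^+ _.
have T0 : 0 <= C1 * pw (eps * c1%:R) * T by rewrite !mulr_ge0 ?pw_ge0 ?exprn_ge0 ?(ltW pR0).
apply: (le_trans (ler_wpM2l T0 sumle)).
have B'0 : 0 <= C1 * pw (eps * c1%:R) * T * (B * X b eta `^ (1 - th R k l)).
  by rewrite !mulr_ge0 ?pw_ge0 ?powR_ge0 ?exprn_ge0 ?(ltW pR0).
rewrite [leLHS]mulrA; apply: (le_trans (ler_wpM2l B'0 hpow)).
rewrite (Xsum_split p_pr z a k1 kp knM xi (c1 := c1)) ?cle//.
rewrite powRM ?exprn_ge0 ?(ltW pR0)//; last by apply: sumr_ge0 => J _; exact: Xsum_ge0.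
set S := (\sum_(J < _) _) `^ _; set u := (c1 - c)%N.
have -> : (p%:R ^+ (u * (tri k).-1)) `^ th R k l = T * (p ^ u)%N%:R `^ (1 - th R k l).
  have tk0 : (0 < tri k)%N := tri_gt0 (ltnW k1).
  have tl0 : (0 < tri l)%N := tri_gt0 l0.
  rewrite /T -/u natrX !pwX !pwM -pwD; congr pw; rewrite !natrM.
  have := th_tri l; rewrite -{1}(prednK tk0) -{1}(prednK tl0) -!natr1 => e.
  have -> : (tri l).-1%:R = th R k l * ((tri k).-1%:R + 1) - 1 :> R by rewrite e addrK.
  by ring.
rewrite le_eqVlt; apply/orP; left; apply/eqP; ring.
Qed.

End Push.
End BilinearIteration.

Section Combine.
Variable R : realType.

Lemma triR l : (tri l)%:R = l%:R * (l%:R + 1) / 2 :> R.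
Proof.
have := congr1 (fun m => m%:R : R) (tri2 l); rewrite /= !natrM -[l.+1%:R]natr1; lra.
Qed.

(** The identity behind [Ysum_hoelder], divided by [tri k]. *)
Lemma th_rec k l m : (k = l.+1 + m)%N ->
  th R k l.+1 = (1 - m.+1%:R^-1) * th R k l + m.+1%:R^-1 * (1 - th R k m).
Proof.
move=> ->; rewrite /th !triR natrD -[l.+1%:R]natr1 -[m.+1%:R]natr1.
have : 0 <= (l%:R : R) by []. have : 0 <= (m%:R : R) by [].
move: (l%:R : R) (m%:R : R) => x y y0 x0; field.
by apply/andP; split; [|apply/andP; split]; apply: lt0r_neq0; nra.
Qed.

Lemma powR_combine (U Ua Ub A1 A2 P1 P2 x y t1 t2 mu : R) : 0 < mu < 1 ->
  U <= Ua `^ (1 - mu) * Ub `^ mu -> 0 <= Ua -> 0 <= Ub ->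
  Ua <= A1 * P1 * (x `^ t1 * y `^ (1 - t1)) ->
  Ub <= A2 * P2 * (y `^ t2 * x `^ (1 - t2)) ->
  1 <= A1 -> 1 <= A2 -> 0 <= P1 -> 0 <= P2 -> 0 <= x -> 0 <= y ->
  0 < (1 - mu) * t1 + mu * (1 - t2) < 1 ->
  U <= A1 * A2 * (P1 `^ (1 - mu) * P2 `^ mu) *
    (x `^ ((1 - mu) * t1 + mu * (1 - t2)) * y `^ (1 - ((1 - mu) * t1 + mu * (1 - t2)))).
Proof.
move=> /andP[m0 m1] hU Ua0 Ub0 hUa hUb A11 A21 P10 P20 x0 y0 /andP[t0 t1'].
have n0 : 0 <= 1 - mu by lra.
have A10 : 0 <= A1 by lra.
have A20 : 0 <= A2 by lra.
apply: (le_trans hU).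
have hA : Ua `^ (1 - mu) <= A1 * P1 `^ (1 - mu) * (x `^ (t1 * (1 - mu)) * y `^ ((1 - t1) * (1 - mu))).
  apply: (le_trans (ge0_ler_powR n0 _ _ hUa)).
  - by rewrite nnegrE.
  - by rewrite nnegrE !mulr_ge0 ?powR_ge0.
  rewrite !powRM ?mulr_ge0 ?powR_ge0// -!powRrM ler_wpM2r ?mulr_ge0 ?powR_ge0//.
  by rewrite ler_wpM2r ?powR_ge0// ler1_powR//; lra.
have hB : Ub `^ mu <= A2 * P2 `^ mu * (y `^ (t2 * mu) * x `^ ((1 - t2) * mu)).
  apply: (le_trans (ge0_ler_powR (ltW m0) _ _ hUb)).
  - by rewrite nnegrE.
  - by rewrite nnegrE !mulr_ge0 ?powR_ge0.
  rewrite !powRM ?mulr_ge0 ?powR_ge0// -!powRrM ler_wpM2r ?mulr_ge0 ?powR_ge0//.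
  by rewrite ler_wpM2r ?powR_ge0// ler1_powR//; lra.
apply: (le_trans (ler_pM _ _ hA hB)); rewrite ?powR_ge0//.
have -> : x `^ ((1 - mu) * t1 + mu * (1 - t2)) = x `^ (t1 * (1 - mu)) * x `^ ((1 - t2) * mu).
  rewrite -powRD; first by rewrite mulrC [mu * _]mulrC.
  by apply/implyP => /eqP e; exfalso; move: t0; lra.
have -> : y `^ (1 - ((1 - mu) * t1 + mu * (1 - t2))) =
   y `^ ((1 - t1) * (1 - mu)) * y `^ (t2 * mu).
  rewrite -powRD; first by congr (_ `^ _); ring.
  by apply/implyP => /eqP e; exfalso; move: t1'; lra.
by rewrite le_eqVlt; apply/orP; left; apply/eqP; ring.
Qed.

End Combine.

(** * Iteration of the bilinear estimate *)

Section Iteration.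
Variable R : realType.
Variable p : nat.
Hypothesis p_pr : prime p.
Variable k : nat.
Hypothesis k1 : (1 < k)%N.
Hypothesis kp : (k < p)%N.

Let pR0 : 0 < p%:R :> R.
Proof. by rewrite ltr0n prime_gt0. Qed.

Local Notation pw := (@pw R p).

(** After [i] rounds the gain has the profile l(k-l) in the degree. The relation lc = (k-l+1)b makes
    [c] the finest scale that lower degree decoupling against a block at scale [b] can reach.
    Divisibility of [b] by k!^(i+1) keeps the scales of the remaining rounds integral, and k^(i+1) b
    < n keeps them below [n]. The last term in the exponent collects the losses of lower degree
    decoupling. *)
Definition bilinear_bound (et eps : R) i (C : R) :=
  forall n M Q (z : 'I_Q -> nat) (a : 'I_Q -> R[i]) b l c xi eta,
  (k * n <= M)%N -> (0 < b)%N -> (k`! ^ i.+1 %| b)%N -> (k ^ i.+1 * b < n)%N ->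
  (l < k)%N -> ((0 < l)%N -> (l * c = (k - l).+1 * b)%N) -> (0 < c < n)%N ->
  (xi < p ^ c)%N -> (eta < p ^ b)%N -> xi != eta %[mod p] ->
  Ysum p k M z a l c xi b eta <=
   C * pw (et * n%:R - et * i%:R / k%:R ^+ 2 * (l%:R * (k%:R - l%:R)) * b%:R
           + i%:R * k%:R * (eps * n%:R)) *
   (Xsum p k n M z a c xi `^ th R k l * Xsum p k n M z a b eta `^ (1 - th R k l)).

Variables (et C0 : R).
Hypothesis et0 : 0 <= et.
Hypothesis C01 : 1 <= C0.
Hypothesis dec0 : forall m, (0 < m)%N -> dec p k m (C0 * p%:R `^ (et * m%:R)).

(** The source of the whole gain: for l = 0 only the second block is present, and decoupling it from
    scale [b] instead of scale 0 saves [et * b] in the exponent. *)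
Lemma Ysum0_le n M Q (z : 'I_Q -> nat) (a : 'I_Q -> R[i]) b c xi eta :
  (k * n <= M)%N -> (b < n)%N -> (eta < p ^ b)%N ->
  Ysum p k M z a 0 c xi b eta <= C0 * pw (et * (n%:R - b%:R)) *
   (Xsum p k n M z a c xi `^ th R k 0 * Xsum p k n M z a b eta `^ (1 - th R k 0)).
Proof.
move=> knM bn eb; rewrite th0 subr0 powRr0 mul1r powRr1; last exact: Xsum_ge0.
have C00 : 0 <= C0 by rewrite (le_trans ler01).
have := bsum_le_Xsum p_pr z a k1 knM C00 dec0 bn eb.
rewrite natrB ?(ltnW bn)// => h; apply: le_trans h.
rewrite le_eqVlt; apply/orP; left; apply/eqP; apply: eq_bigr => al _.
by rewrite muln0 expr0 mul1r subn0.
Qed.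

Lemma bilinear_bound0 eps : bilinear_bound et eps 0 C0.
Proof.
move=> n M Q z a b l c xi eta knM b0 _ kbn lk lc /andP[c0 cn] xc eb ne.
have bn : (b < n)%N by rewrite (leq_ltn_trans _ kbn)// expn1 leq_pmull// ltnW.
have C00 : 0 <= C0 by rewrite (le_trans ler01).
rewrite mulr0 !mul0r subr0 addr0.
have pwle x : pw (et * (n%:R - x%:R)) <= pw (et * n%:R).
  by rewrite ler_pw// ler_wpM2l// lerBlDr lerDl.
have X0 c' xi' := @Xsum_ge0 R p p_pr k n M Q z a c' xi'.
case: l lk lc => [|l] lk lc.
  apply: (le_trans (Ysum0_le z a c xi knM bn eb)).
  by rewrite ler_wpM2r ?mulr_ge0 ?powR_ge0// ler_wpM2l.
set t := th R k l.+1.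
have t01 : 0 < t < 1 by rewrite (th_gt0 R p_pr k1 kp knM) //= (th_lt1 R p_pr k1 kp knM).
have := @hoelder_sum R 'rV['Z_(p ^ M)]_k.+1 predT
  (fun al => bsum p z a b eta (rVpoly al) ^+ (2 * tri k))
  (fun al => bsum p z a c xi (rVpoly al) ^+ (2 * tri k)) t t01.
move=> /(_ (fun al => exprn_ge0 _ (bsum_ge0 _ _ _ _ _ _)) (fun al => exprn_ge0 _ (bsum_ge0 _ _ _ _ _ _))) h.
have tlk := tri_lt R p_pr k1 kp knM lk.
have bX (be : R) A B : 0 <= be -> (2 * tri k)%N%:R * A = B%:R -> (be ^+ (2 * tri k)) `^ A = be ^+ B.
  by move=> be0 e; rewrite -powR_mulrn// -powRrM e powR_mulrn.
have et1 : (2 * tri k)%N%:R * t = (2 * tri l.+1)%N%:R :> R.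
  by rewrite !natrM -mulrA [_ * t]mulrC (th_tri R k1).
have {h}hY : Ysum p k M z a l.+1 c xi b eta <=
    (\sum_(al : 'rV['Z_(p ^ M)]_k.+1) bsum p z a b eta (rVpoly al) ^+ (2 * tri k)) `^ (1 - t) *
    (\sum_(al : 'rV['Z_(p ^ M)]_k.+1) bsum p z a c xi (rVpoly al) ^+ (2 * tri k)) `^ t.
  apply: le_trans h; rewrite le_eqVlt; apply/orP; left; apply/eqP; apply: eq_bigr => al _.
  rewrite mulrC; congr (_ * _); apply/esym; apply: bX; rewrite ?bsum_ge0//.
  by rewrite mulrBr mulr1 et1 -natrB ?leq_pmul2l 1?ltnW// -mulnBr.
apply: (le_trans hY).
have hb := bsum_le_Xsum p_pr z a k1 knM C00 dec0 bn eb.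
have hc := bsum_le_Xsum p_pr z a k1 knM C00 dec0 cn xc.
have S0 c' xi' : 0 <= \sum_(al : 'rV['Z_(p ^ M)]_k.+1) bsum p z a c' xi' (rVpoly al) ^+ (2 * tri k).
  by apply: sumr_ge0 => al _; rewrite exprn_ge0// bsum_ge0.
have D0 c' : (c' < n)%N -> C0 * pw (et * (n - c')%:R) <= C0 * pw (et * n%:R).
  by move=> c'n; rewrite ler_wpM2l// natrB ?pwle// ltnW.
have hD c' xi' : (c' < n)%N -> (xi' < p ^ c')%N ->
    \sum_(al : 'rV['Z_(p ^ M)]_k.+1) bsum p z a c' xi' (rVpoly al) ^+ (2 * tri k) <=
    C0 * pw (et * n%:R) * Xsum p k n M z a c' xi'.
  move=> c'n xc'; apply: (le_trans (bsum_le_Xsum p_pr z a k1 knM C00 dec0 c'n xc')).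
  by rewrite ler_wpM2r// D0.
have /andP[t0 t1] := t01; have n0 : 0 <= 1 - t by rewrite subr_ge0 ltW.
have P0 : 0 <= C0 * pw (et * n%:R) by rewrite mulr_ge0// pw_ge0.
have e1 := ge0_ler_powR n0 (S0 b eta) (mulr_ge0 P0 (X0 b eta)) (hD b eta bn eb).
have e2 := ge0_ler_powR (ltW t0) (S0 c xi) (mulr_ge0 P0 (X0 c xi)) (hD c xi cn xc).
apply: (le_trans (ler_pM (powR_ge0 _ _) (powR_ge0 _ _) e1 e2)).
rewrite !(powRM _ P0) ?X0// mulrACA -powRD; last by rewrite subrK oner_eq0.
by rewrite subrK powRr1// [X in _ * X]mulrC.
Qed.

(** The exponent reached inside one round. Besides the profile l(k-l) of the earlier rounds it
    carries the gain (k-l)/k, which equals 1 at l = 0, where [Ysum0_le] supplies it. *)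
Definition loss eps i (n b : nat) l : R := et * n%:R
  - et * (i%:R / k%:R ^+ 2 * (l%:R * (k%:R - l%:R)) + (k%:R - l%:R) / k%:R) * b%:R
  + (i%:R * k%:R + l%:R) * (eps * n%:R).

(** Under the Hölder step the profile l(k-l) and the linear gain (k-l)/k reproduce themselves
    exactly; the two sides differ only by l eps n/(m+1). *)
Lemma loss_rec eps i n b l m c : 0 <= eps -> (k = l.+1 + m)%N -> (l.+1 * c = m.+1 * b)%N ->
  (1 - m.+1%:R^-1) * (loss eps i n b l + eps * n%:R) + m.+1%:R^-1 *
   (et * n%:R - et * i%:R / k%:R ^+ 2 * (m%:R * (k%:R - m%:R)) * c%:R
           + i%:R * k%:R * (eps * n%:R) + eps * n%:R) <= loss eps i n b l.+1.
Proof.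
move=> e0 kE cE; rewrite -subr_ge0.
have cR : (l%:R + 1) * c%:R = (m%:R + 1) * b%:R :> R.
  by have := congr1 (fun m => m%:R : R) cE; rewrite /= !natrM -!natr1.
rewrite /loss kE natrD -[l.+1%:R]natr1 -[m.+1%:R]natr1.
have : 0 <= (l%:R : R) by []. have : 0 <= (m%:R : R) by [].
have : 0 <= eps * n%:R by rewrite mulr_ge0.
move: (eps * n%:R) cR => E.
move: (l%:R : R) (m%:R : R) (i%:R : R) (n%:R : R) (b%:R : R) (c%:R : R).
move=> x y T N b' c' cR E0 y0 x0.
have x1 : x + 1 != 0 by apply: lt0r_neq0; lra.
have y1 : y + 1 != 0 by apply: lt0r_neq0; lra.
have xy1 : x + 1 + y != 0 by apply: lt0r_neq0; lra.
have -> : c' = (y + 1) * b' / (x + 1) by rewrite -cR mulrAC divff// mul1r.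
rewrite (_ : _ - _ = x * E / (y + 1)); first by rewrite divr_ge0 ?mulr_ge0//; lra.
by field; rewrite x1 y1 xy1.
Qed.

(** Induction on the degree within the round. Hölder produces a factor of degree one less, treated
    by this induction, and one with the blocks exchanged, treated by round [i]; [Ysum_push] first
    moves each to the scale at which its bound is stated. At the end (k-l)/k >= l(k-l)/k^2 converts
    the extra gain into one more unit of the profile. *)
Lemma bilinear_bound_step eps C1 i Ci : 0 < eps -> 1 <= C1 -> 1 <= Ci ->
  uniform_lower_dec p k eps C1 -> bilinear_bound et eps i Ci ->
  bilinear_bound et eps i.+1 (C0 * (C1 ^+ 2 * Ci) ^+ k).
Proof.
move=> eps0 C11 Ci1 hld hi n M Q z a b l c xi eta knM b0 kb kbn lk lc cn xc eb ne.
have C10 : 0 <= C1 by rewrite (le_trans ler01).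
have X0 c' xi' := @Xsum_ge0 R p p_pr k n M Q z a c' xi'.
have k0 : (0 < k)%N by apply: ltnW.
have kR0 : 0 < (k%:R : R) by rewrite ltr0n.
pose A := C1 ^+ 2 * Ci; have A1 : 1 <= A by rewrite mulr_ege1// exprn_ege1.
have epsn : 0 <= eps * n%:R by rewrite mulr_ge0// ltW.
have kib : (k * (k * b) < n)%N.
  apply: leq_ltn_trans kbn; rewrite mulnA leq_mul2r mulnn; apply/orP; right.
  by rewrite leq_pexp2l.
have kbn' : (k * b < n)%N by apply: leq_ltn_trans kib; rewrite leq_pmull.
have bn : (b < n)%N by apply: leq_ltn_trans kbn'; rewrite leq_pmull.
have rbM j : (j <= k)%N -> (j * b <= M)%N.
  move=> jk; apply: leq_trans knM; apply: leq_trans (_ : k * b <= _)%N.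
    by rewrite leq_mul2r jk orbT.
  by rewrite leq_mul2l (ltnW bn) orbT.
have pwe c' : (c' <= n)%N -> pw (eps * c'%:R) <= pw (eps * n%:R).
  by move=> c'n; rewrite ler_pw// ler_pM2l// ler_nat.
have main : forall l, (l < k)%N -> forall c xi eta, ((0 < l)%N -> (l * c = (k - l).+1 * b)%N) ->
    (0 < c < n)%N -> (xi < p ^ c)%N -> (eta < p ^ b)%N -> xi != eta %[mod p] ->
    Ysum p k M z a l c xi b eta <= C0 * A ^+ l * pw (loss eps i n b l) *
     (Xsum p k n M z a c xi `^ th R k l * Xsum p k n M z a b eta `^ (1 - th R k l)).
  clear l lk c xi eta lc cn xc eb ne.
  elim=> [|l IH] lk c xi eta lc /andP[c0 cn] xc eb ne.
    apply: (le_trans (Ysum0_le z a c xi knM bn eb)).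
    rewrite expr0 mulr1 ler_wpM2r ?mulr_ge0 ?powR_ge0// ler_wpM2l ?(le_trans ler01)//.
    rewrite ler_pw// /loss.
    have -> : et * (n%:R - b%:R) = et * n%:R - et * (i%:R / k%:R ^+ 2 * (0%:R * (k%:R - 0%:R)) +
       (k%:R - 0%:R) / k%:R) * b%:R by field; rewrite gt_eqF.
    by rewrite lerDl mulr_ge0// addr_ge0// mulr_ge0// ltW.
  have lk' : (l < k)%N := ltnW lk.
  have {}lc := lc isT.
  set m := (k - l.+1)%N; have kE : (k = l.+1 + m)%N by rewrite subnKC// ltnW.
  have m0 : (0 < m)%N by rewrite subn_gt0.
  have mk : (m < k)%N by rewrite kE addSn ltnS leq_addl.
  have klE : (k - l = m.+1)%N by rewrite kE addSnnS addKn.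
  have kmE : (k - m = l.+1)%N by rewrite kE addnK.
  rewrite -/m in lc.
  have B0 : 0 <= C0 * A ^+ l * pw (loss eps i n b l).
    by rewrite !mulr_ge0 ?pw_ge0 ?exprn_ge0// (le_trans ler01).
  have hA : Ysum p k M z a l c xi b eta <= (C1 * (C0 * A ^+ l)) * pw (loss eps i n b l + eps * n%:R) *
     (Xsum p k n M z a c xi `^ th R k l * Xsum p k n M z a b eta `^ (1 - th R k l)).
    have infl : 1 <= C1 * pw (eps * n%:R) by rewrite mulr_ege1// pw_ge1.
    have cfE : C1 * (C0 * A ^+ l) * pw (loss eps i n b l + eps * n%:R) =
      C0 * A ^+ l * pw (loss eps i n b l) * (C1 * pw (eps * n%:R)) by rewrite pwD//; ring.
    rewrite cfE.
    have [l0|l0] := posnP l.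
      have h0 : Ysum p k M z a l c xi b eta <= C0 * A ^+ l * pw (loss eps i n b l) *
       (Xsum p k n M z a c xi `^ th R k l * Xsum p k n M z a b eta `^ (1 - th R k l)).
        by apply: IH => //; [rewrite l0|rewrite c0].
      by apply: (le_trans h0); rewrite ler_wpM2r ?mulr_ge0 ?powR_ge0// ler_peMr.
    have lb : (l %| b)%N.
      apply: dvdn_trans kb; rewrite expnS dvdn_mulr// dvdn_fact// l0/=.
      exact: ltnW.
    pose c1 := (m.+2 * b %/ l)%N; have c1E : (l * c1 = m.+2 * b)%N.
      by rewrite /c1 mulnC divnK// dvdn_mull.
    have cc1 : (c <= c1)%N.
      rewrite -(leq_pmul2l l0) c1E; apply: (@leq_trans (l.+1 * c)%N).
        by rewrite leq_mul2r leqnSn orbT.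
      by rewrite lc leq_mul2r leqnSn orbT.
    have m2k : (m.+2 <= k)%N by rewrite kE -addn2 addnC leq_add2r ltnS.
    have c1n : (c1 < n)%N.
      apply: leq_ltn_trans kbn'; apply: (@leq_trans (l * c1)%N); first by rewrite leq_pmull.
      by rewrite c1E leq_mul2r m2k orbT.
    have lk2 : (0 < l < k)%N by rewrite l0.
    have lc1 : (l * c1 <= (k - l).+1 * b)%N by rewrite klE c1E.
    have hM : ((k - l).+1 * b <= M)%N by rewrite klE; apply: rbM.
    have hcc : (0 < c <= c1)%N by rewrite c0.
    have hJ J : (J < p ^ (c1 - c))%N -> Ysum p k M z a l c1 (xi + p ^ c * J)%N b eta <=
        C0 * A ^+ l * pw (loss eps i n b l) * (Xsum p k n M z a c1 (xi + p ^ c * J)%N `^ th R k l *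
           Xsum p k n M z a b eta `^ (1 - th R k l)).
      move=> Jl; apply: IH => //.
      - by rewrite c1E klE.
      - by rewrite (leq_trans c0 cc1).
      - by rewrite -[in X in (_ < X)%N](subnKC cc1) child_lt.
      - by rewrite -(prednK c0) expnS -mulnA [(p * _)%N]mulnC addnC modnMDl.
    apply: (le_trans (Ysum_push p_pr k1 kp knM hld C10 B0 lk2 hcc (ltnW c1n) b0 xc ne lc1 hM hJ)).
    rewrite ler_wpM2r ?mulr_ge0 ?powR_ge0// [leLHS]mulrC ler_wpM2l// ler_wpM2l//.
    by rewrite pwe// ltnW.
  have lcb : (l.+1 * c <= k * b)%N by rewrite lc leq_mul2r; apply/orP; right.
  have cb : (c <= k * b)%N by apply: leq_trans lcb; rewrite leq_pmull.
  have kc : (k`! ^ i.+1 %| c)%N.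
    have /dvdnP [q bE] := kb.
    have /dvdnP [w wE] : (l.+1 %| k`!)%N by rewrite dvdn_fact// ltnW.
    have -> : c = (m.+1 * q * w * k`! ^ i.+1)%N.
      apply/eqP; rewrite -(@eqn_pmul2l l.+1)// lc bE expnS {1}wE; apply/eqP; ring.
    by rewrite dvdn_mull.
  have mc : (m %| c)%N.
    by apply: dvdn_trans kc; rewrite expnS dvdn_mulr// dvdn_fact// m0 ltnW.
  pose c2 := (l.+2 * c %/ m)%N; have c2E : (m * c2 = l.+2 * c)%N.
    by rewrite /c2 mulnC divnK// dvdn_mull.
  have bc2 : (b <= c2)%N.
    rewrite -(leq_pmul2l m0) c2E; apply: (@leq_trans (m.+1 * b)%N).
      by rewrite leq_mul2r leqnSn orbT.
    by rewrite -lc leq_mul2r leqnSn orbT.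
  have l2c : (l.+2 * c < n)%N.
    apply: leq_ltn_trans kib; apply: (@leq_trans (k * c)%N).
      by rewrite leq_mul2r lk orbT.
    by rewrite leq_mul2l cb orbT.
  have c2n : (c2 < n)%N by apply: leq_ltn_trans l2c; rewrite -c2E leq_pmull.
  have nM : (n <= M)%N by apply: leq_trans knM; rewrite leq_pmull.
  have hB : Ysum p k M z a m b eta c xi <= (C1 * Ci) * pw (et * n%:R -
      et * i%:R / k%:R ^+ 2 * (m%:R * (k%:R - m%:R)) * c%:R
           + i%:R * k%:R * (eps * n%:R) + eps * n%:R) *
     (Xsum p k n M z a b eta `^ th R k m * Xsum p k n M z a c xi `^ (1 - th R k m)).
    set E := (et * n%:R - _ + _).
    have hJ J : (J < p ^ (c2 - b))%N -> Ysum p k M z a m c2 (eta + p ^ b * J)%N c xi <=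
        Ci * pw E * (Xsum p k n M z a c2 (eta + p ^ b * J)%N `^ th R k m *
           Xsum p k n M z a c xi `^ (1 - th R k m)).
      move=> Jl; apply: hi => //.
      - rewrite expnS -mulnA; apply: leq_ltn_trans kbn; rewrite !expnS -!mulnA.
        rewrite leq_mul2l [X in (_ <= X)%N]mulnCA leq_mul2l cb !orbT.
        by [].
      - by rewrite c2E kmE.
      - by rewrite (leq_trans b0 bc2).
      - by rewrite -[in X in (_ < X)%N](subnKC bc2) child_lt.
      - by rewrite eq_sym -(prednK b0) expnS -mulnA [(p * _)%N]mulnC addnC modnMDl.
    have Ci0 : 0 <= Ci by rewrite (le_trans ler01).
    have B0' : 0 <= Ci * pw E by rewrite mulr_ge0// pw_ge0.
    have mk2 : (0 < m < k)%N by rewrite m0.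
    have hbc : (0 < b <= c2)%N by rewrite b0.
    have hlc : (m * c2 <= (k - m).+1 * c)%N by rewrite c2E kmE.
    have hM : ((k - m).+1 * c <= M)%N by rewrite kmE (leq_trans (ltnW l2c)).
    have ne' : eta != xi %[mod p] by rewrite eq_sym.
    apply: (le_trans (Ysum_push p_pr k1 kp knM hld C10 B0' mk2 hbc (ltnW c2n) c0 eb ne' hlc hM hJ)).
    rewrite ler_wpM2r ?mulr_ge0 ?powR_ge0// (pwD p_pr E).
    have -> : C1 * Ci * (pw E * pw (eps * n%:R)) = C1 * pw (eps * n%:R) * (Ci * pw E) by ring.
    by rewrite ler_wpM2r// ler_wpM2l// pwe// ltnW.
  have mu01 : 0 < (m.+1%:R^-1 : R) < 1.
    by rewrite invr_gt0 ltr0n /= invf_lt1 ?ltr0n// ltr1n ltnS.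
  have l1k : (0 < l.+1 < k)%N by [].
  have hY := Ysum_hoelder p_pr z a k1 kp knM c xi b eta l1k.
  have D1 : 1 <= C1 * (C0 * A ^+ l) by rewrite !mulr_ege1// exprn_ege1.
  have D2 : 1 <= C1 * Ci by rewrite mulr_ege1.
  have t01 : 0 < th R k l.+1 < 1.
    by rewrite (th_gt0 R p_pr k1 kp knM) //= (th_lt1 R p_pr k1 kp knM).
  have := powR_combine mu01 hY (Ysum_ge0 _ _ _ _ _ _ _ _ _ _) (Ysum_ge0 _ _ _ _ _ _ _ _ _ _) hA hB D1 D2
    (pw_ge0 _ _) (pw_ge0 _ _) (X0 _ _) (X0 _ _).
  rewrite -th_rec// => /(_ t01) /le_trans; apply.
  rewrite ler_wpM2r ?mulr_ge0 ?powR_ge0// !pwM -pwD//.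
  have -> : C1 * (C0 * A ^+ l) * (C1 * Ci) = C0 * A ^+ l.+1 by rewrite exprSr /A; ring.
  rewrite ler_wpM2l ?mulr_ge0 ?exprn_ge0 ?(le_trans ler01)// ler_pw//.
  by rewrite mulrC [X in _ + X]mulrC loss_rec// ltW.
apply: (le_trans (main l lk c xi eta lc cn xc eb ne)).
rewrite ler_wpM2r ?mulr_ge0 ?powR_ge0//.
rewrite ler_pM ?pw_ge0 ?mulr_ge0 ?exprn_ge0 ?(le_trans ler01 A1) ?(le_trans ler01 C01)//.
  by rewrite ler_wpM2l ?(le_trans ler01)// ler_weXn2l// ltnW.
rewrite ler_pw// /loss; apply: lerD; last first.
  by rewrite ler_wpM2r// -natr1 mulrDl mul1r lerD2l ler_nat ltnW.
rewrite lerD2l lerN2 ler_wpM2r// -!mulrA ler_wpM2l//.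
rewrite -[i.+1%:R]natr1 -subr_ge0.
have lR : l%:R <= k%:R :> R by rewrite ler_nat ltnW.
rewrite (_ : _ - _ = (k%:R - l%:R) ^+ 2 / k%:R ^+ 2); last by field; rewrite gt_eqF.
by rewrite divr_ge0 ?exprn_ge0// ?subr_ge0.
Qed.

End Iteration.

(** * Broad-narrow splitting and descent on the decoupling exponent *)

Section BroadNarrow.
Variable R : realType.

(* Either one term dominates the sum, or the two largest are comparable. *)
Lemma broad_narrow p (F : 'I_p -> R) S s : (1 < s)%N ->
  (forall J, 0 <= F J) -> 0 <= S -> S <= \sum_J F J ->
  S ^+ (2 * s) <= 2 ^+ (2 * s) * \sum_J F J ^+ (2 * s) +
    p%:R ^+ (2 * s + 2) * \sum_J \sum_(J' | J' != J) F J ^+ 2 * F J' ^+ (2 * s - 2).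
Proof.
move=> s1 F0 S0 hS.
have W0 : 0 <= \sum_J \sum_(J' | J' != J) F J ^+ 2 * F J' ^+ (2 * s - 2).
  by apply: sumr_ge0 => J _; apply: sumr_ge0 => J' _; rewrite mulr_ge0 ?exprn_ge0.
have N0 : 0 <= \sum_J F J ^+ (2 * s) by apply: sumr_ge0 => J _; rewrite exprn_ge0.
case: p F F0 hS W0 N0 => [|p] F F0 hS W0 N0.
  move: hS; rewrite big_ord0 => hS.
  have -> : S = 0 by apply/eqP; rewrite eq_le hS.
  rewrite expr0n muln_eq0 /= gtn_eqF ?(ltnW s1)//= addr_ge0// mulr_ge0//; exact: exprn_ge0.
have [J0 _ hJ0] := @arg_maxP _ _ _ (ord0 : 'I_p.+1) xpredT F isT.
have hmax J : F J <= F J0 by apply: hJ0.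
have [le|lt] := lerP (\sum_(J | J != J0) F J) (F J0).
  have S2 : S <= 2 * F J0.
    by apply: (le_trans hS); rewrite (bigD1 J0)//= mulr_natl mulr2n lerD2l.
  have /= := lerXn2r (2 * s) S0 (mulr_ge0 _ (F0 J0)) S2; rewrite ler0n => /(_ isT) /le_trans; apply.
  rewrite exprMn; apply: (@le_trans _ _ (2 ^+ (2 * s) * \sum_J F J ^+ (2 * s))).
    rewrite ler_wpM2l ?exprn_ge0// (bigD1 J0)//= lerDl sumr_ge0// => J _; exact: exprn_ge0.
  by rewrite lerDl mulr_ge0 ?exprn_ge0.
have [J1 J10 hJ1] : exists2 J1, J1 != J0 & F J0 <= p.+1%:R * F J1.
  apply: contrapT => hno.
  have hlt J : J != J0 -> F J <= F J0 / p.+1%:R.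
    move=> JJ0; rewrite ler_pdivlMr// mulrC ltW// ltNge; apply/negP => le.
    by apply: hno; exists J.
  have : \sum_(J | J != J0) F J <= \sum_(J | J != J0) F J0 / p.+1%:R by apply: ler_sum.
  rewrite sumr_const cardC1 card_ord /= -[_ *+ p]mulr_natr mulrAC -mulrA => h.
  have : F J0 * (p%:R / p.+1%:R) <= F J0.
    by rewrite ler_piMr// ler_pdivrMr// mul1r ler_nat.
  by move=> h2; have := le_trans h h2; rewrite leNgt lt.
have Sp : S <= p.+1%:R * F J0.
  apply: (le_trans hS); apply: (@le_trans _ _ (\sum_(J < p.+1) F J0)); first exact: ler_sum.
  by rewrite sumr_const card_ord mulr_natl.
apply: (le_trans (lerXn2r (2 * s) S0 (mulr_ge0 (ler0n _ _) (F0 J0)) Sp)).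
apply: (@le_trans _ _ (p.+1%:R ^+ (2 * s + 2) * (F J1 ^+ 2 * F J0 ^+ (2 * s - 2)))).
  rewrite exprMn exprD -mulrA ler_wpM2l ?exprn_ge0// mulrA -exprMn.
  have -> : (2 * s = 2 + (2 * s - 2))%N by rewrite subnKC// mulnC leq_pmull// ltnW.
  rewrite exprD addKn ler_wpM2r ?exprn_ge0// lerXn2r// nnegrE ?mulr_ge0//.
apply: (@le_trans _ _ (p.+1%:R ^+ (2 * s + 2) * \sum_J \sum_(J' | J' != J) F J ^+ 2 * F J' ^+ (2 * s - 2))).
  rewrite ler_wpM2l ?exprn_ge0// (bigD1 J1)//= (bigD1 J0) 1?eq_sym//= -addrA lerDl addr_ge0//.
    by apply: sumr_ge0 => J _; rewrite mulr_ge0 ?exprn_ge0.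
  by apply: sumr_ge0 => J _; apply: sumr_ge0 => J' _; rewrite mulr_ge0 ?exprn_ge0.
by rewrite lerDr mulr_ge0 ?exprn_ge0.
Qed.

End BroadNarrow.

Section Descent.
Variable R : realType.
Variable p : nat.
Hypothesis p_pr : prime p.
Variable k : nat.
Hypothesis k1 : (1 < k)%N.
Hypothesis kp : (k < p)%N.

Let p0 : (0 < p)%N := prime_gt0 p_pr.
Let pX0 c : (0 < p ^ c)%N.
Proof. by rewrite expn_gt0 p0. Qed.
Let pR0 : 0 < p%:R :> R.
Proof. by rewrite ltr0n. Qed.
Let pR1 : 1 <= p%:R :> R.
Proof. by rewrite ler1n. Qed.

Local Notation pw := (@pw R p).

Lemma dec_le j n (D D' : R) : D <= D' -> dec p j n D -> dec p j n D'.
Proof.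
move=> DD h M M0 jn Q z a; apply: (le_trans (h M M0 jn Q z a)).
rewrite ler_wpM2r ?ler_wpM2r ?exprn_ge0//.
by apply: sumr_ge0 => J _; apply: sumr_ge0 => al _; rewrite exprn_ge0// cmod_ge0.
Qed.

Lemma expsum_blk0 N Q (z : 'I_Q -> nat) (a : 'I_Q -> R[i]) (P : {poly 'Z_N}) :
  cmod (expsum z a P) = bsum p z a 0 0 P.
Proof.
rewrite /bsum; congr cmod; apply: eq_bigr => x _.
by rewrite /restr /blk expn0 modn1.
Qed.

Lemma dec_trivial j n : (0 < j)%N -> dec p j n (p%:R ^+ (n * tri j) : R).
Proof.
move=> j0 M M0 jn Q z a; rewrite -exprD exchange_big/= mulr_sumr; apply: ler_sum => al _.
rewrite expsum_blk0; have tj := tri_gt0 j0.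
have t2 : (0 < 2 * tri j)%N by rewrite muln_gt0.
have := @bsumX_split R p p_pr (p ^ M) Q z a 0 n 0 (rVpoly al) (2 * tri j) (pX0 0) t2.
rewrite -mulnDr (_ : (2 * tri j).-1 = tri j + (tri j).-1)%N; last first.
  by rewrite mul2n -addnn -{2}(prednK tj) addnS.
by move=> /le_trans; apply; rewrite ler_wpM2l ?exprn_ge0//; apply: ler_sum => J _; rewrite expn0 mul1n.
Qed.

Lemma tri_ge3 : (3 <= tri k)%N.
Proof.
have : (2 * 3 <= k * k.+1)%N by apply: leq_mul.
by rewrite -(tri2 k) leq_pmul2l.
Qed.

(** Two classes that differ modulo p are split trivially to the scales kb and b, where the bilinear
    bound with l = 1 is available. The loss is a fixed power of p^b, to be outweighed by the gain of
    many rounds. *)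
Lemma Ysum1_le n M Q (z : 'I_Q -> nat) (a : 'I_Q -> R[i]) b J J' B :
  (k * n <= M)%N -> (0 < b)%N -> (k * b <= n)%N -> (J < p)%N -> (J' < p)%N -> 0 <= B ->
  J != J' ->
  (forall xi eta, (xi < p ^ (k * b))%N -> (eta < p ^ b)%N -> xi != eta %[mod p] ->
     Ysum p k M z a 1 (k * b) xi b eta <= B * (Xsum p k n M z a (k * b) xi `^ th R k 1 *
       Xsum p k n M z a b eta `^ (1 - th R k 1))) ->
  Ysum p k M z a 1 1 J 1 J' <= p%:R ^+ ((2 * k + 2 * tri k + 1) * b) * B * Xsum p k n M z a 0 0.
Proof.
move=> knM b0 kbn Jp J'p B0 ne hB.
have t3 := tri_ge3; have t1 : tri 1 = 1%N by [].
set s := tri k in t3 *.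
have kb0 : (0 < k * b)%N by rewrite muln_gt0 b0 (ltnW k1).
set u := (k * b).-1; set v := b.-1.
have uE : (1 + u = k * b)%N by rewrite add1n prednK.
have vE : (1 + v = b)%N by rewrite add1n prednK.
have e2 : (2 * tri 1 = 2)%N by rewrite t1.
have m0 : (0 < 2 * (s - tri 1))%N by rewrite t1 muln_gt0 subn_gt0 (ltn_trans _ t3).
set m := (2 * (s - tri 1))%N in m0 *.
have ms : (m <= 2 * s)%N by rewrite /m leq_mul2l leq_subr.
have step : Ysum p k M z a 1 1 J 1 J' <= p%:R ^+ (k * b + 2 * s * b) *
   \sum_(i < p ^ u) \sum_(i' < p ^ v) Ysum p k M z a 1 (k * b) (J + p ^ 1 * i)%N b (J' + p ^ 1 * i')%N.
  under eq_bigr do rewrite exchange_big/=.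
  rewrite exchange_big/= mulr_sumr; apply: ler_sum => al _.
  rewrite -/m e2.
  have J1 : (J < p ^ 1)%N by rewrite expn1.
  have J'1 : (J' < p ^ 1)%N by rewrite expn1.
  have h1 := @bsumX_split R p p_pr (p ^ M) Q z a 1 u J (rVpoly al) 2 J1 isT.
  have h2 := @bsumX_split R p p_pr (p ^ M) Q z a 1 v J' (rVpoly al) m J'1 m0.
  apply: (le_trans (ler_pM _ _ h1 h2)); rewrite ?exprn_ge0 ?bsum_ge0//.
  rewrite uE vE mulrACA -exprD; apply: ler_pM.
  - exact: exprn_ge0.
  - by rewrite mulr_ge0// sumr_ge0// => i _; rewrite exprn_ge0 ?bsum_ge0.
  - rewrite ler_weXn2l// leq_add//; first by rewrite muln1 leq_pred.
    by rewrite mulnC leq_mul ?leq_pred// (leq_trans (leq_pred _)).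
  - by rewrite mulr_suml; apply: ler_sum => i _; rewrite mulr_sumr.
apply: (le_trans step).
have X00 := @Xsum_ge0 R p p_pr k n M Q z a 0 0.
have kb1 : (b <= n)%N by apply: leq_trans kbn; rewrite leq_pmull// ltnW.
have XX c xi : (c <= n)%N -> (xi < p ^ c)%N -> Xsum p k n M z a c xi <= Xsum p k n M z a 0 0.
  move=> cn xc; have := @Xsum_le R p p_pr k n M Q z a k1 kp knM 0 c 0 xi.
  by rewrite subn0 expn0 mul1n; apply.
have th1 : 0 < th R k 1 by apply: (th_gt0 R p_pr k1 kp knM).
have th2 : 0 < 1 - th R k 1 by rewrite subr_gt0 (th_lt1 R p_pr k1 kp knM).
have each i i' : (i < p ^ u)%N -> (i' < p ^ v)%N ->
    Ysum p k M z a 1 (k * b) (J + p ^ 1 * i)%N b (J' + p ^ 1 * i')%N <= B * Xsum p k n M z a 0 0.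
  move=> iu iv.
  have l1 : (J + p ^ 1 * i < p ^ (k * b))%N by rewrite -uE child_lt ?expn1.
  have l2 : (J' + p ^ 1 * i' < p ^ b)%N by rewrite -[X in (_ < _ ^ X)%N]vE child_lt ?expn1.
  have ne' : J + p ^ 1 * i != J' + p ^ 1 * i' %[mod p].
    by rewrite expn1 ![(_ + p * _)%N]addnC ![(p * _)%N]mulnC !modnMDl !modn_small.
  apply: (le_trans (hB _ _ l1 l2 ne')); rewrite ler_wpM2l//.
  have -> : Xsum p k n M z a 0 0 = Xsum p k n M z a 0 0 `^ th R k 1 * Xsum p k n M z a 0 0 `^ (1 - th R k 1).
    by rewrite -powRD addrC subrK ?powRr1// oner_eq0.
  by rewrite ler_pM ?powR_ge0// ge0_ler_powR ?nnegrE ?Xsum_ge0 ?XX// ltW.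
apply: (@le_trans _ _ (p%:R ^+ (k * b + 2 * s * b) * \sum_(i < p ^ u) \sum_(i' < p ^ v) B * Xsum p k n M z a 0 0)).
  rewrite ler_wpM2l ?exprn_ge0//; apply: ler_sum => i _; apply: ler_sum => i' _.
  exact: each.
rewrite !sumr_const !card_ord -!mulrnA -[_ *+ (_ * _)%N]mulr_natr natrM !natrX.
have -> : p%:R ^+ (k * b + 2 * s * b) * (B * Xsum p k n M z a 0 0 * (p%:R ^+ v * p%:R ^+ u)) =
   p%:R ^+ (k * b + 2 * s * b + (v + u)) * B * Xsum p k n M z a 0 0 by rewrite !exprD; ring.
rewrite ler_wpM2r// ler_wpM2r// ler_weXn2l//.
have -> : ((2 * k + 2 * s + 1) * b = k * b + 2 * s * b + (b + k * b))%N by ring.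
by rewrite leq_add2l leq_add ?leq_pred.
Qed.

(** With s = [tri k], the narrow part is rescaled to length [n], and its factor 2^(2s) is beaten by
    the p^(s-1) in the normalisation: 2^(2s+1) <= 16^(s-1) since s >= 3. The broad part has at most
    p^2 terms, which accounts for the exponent 2s+4. *)
Lemma dec_step n (D G : R) : 0 <= D -> 0 <= G -> (0 < n)%N -> (16 <= p)%N ->
  dec p k n D ->
  (forall M Q (z : 'I_Q -> nat) (a : 'I_Q -> R[i]) J J', (k * n.+1 <= M)%N ->
    (J < p)%N -> (J' < p)%N -> J != J' ->
    Ysum p k M z a 1 1 J 1 J' <= G * Xsum p k n.+1 M z a 0 0) ->
  dec p k n.+1 (2^-1 * D + p%:R ^+ (2 * tri k + 4) * G).
Proof.
move=> D0 G0 n0 p16 hD hG M M0 knM Q z a.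
have t3 := tri_ge3; have t1 : tri 1 = 1%N by [].
set s := tri k in t3 *.
have XE : p%:R ^+ (n.+1 * s.-1) * \sum_(J < p ^ n.+1) \sum_(al : 'rV['Z_(p ^ M)]_k.+1)
    cmod (expsum z (restr (fun x => (z x %% p ^ n.+1 == J)%N) a) (rVpoly al)) ^+ (2 * s)
    = Xsum p k n.+1 M z a 0 0.
  by rewrite /Xsum subn0; congr (_ * _); apply: eq_bigr => J _; rewrite expn0 mul1n.
rewrite -[leRHS]mulrA XE {XE}.
under eq_bigr do rewrite expsum_blk0.
have X1 : Xsum p k n.+1 M z a 0 0 = p%:R ^+ s.-1 * \sum_(J < p) Xsum p k n.+1 M z a 1 J.
  rewrite (Xsum_split p_pr z a k1 kp knM 0 (c1 := 1)) ?subn0// mul1n expn1.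
  by congr (_ * _); apply: eq_bigr => J _; rewrite expn0 mul1n.
apply: (@le_trans _ _ (2 ^+ (2 * s) * \sum_(J < p) \sum_(al : 'rV['Z_(p ^ M)]_k.+1)
      bsum p z a 1 J (rVpoly al) ^+ (2 * s) +
    p%:R ^+ (2 * s + 2) * \sum_(J < p) \sum_(J' < p | J' != J) Ysum p k M z a 1 1 J 1 J')).
  rewrite exchange_big/= mulr_sumr.
  under [X in _ + _ * X]eq_bigr do rewrite exchange_big/=.
  rewrite [X in _ + _ * X]exchange_big/= [X in _ + X]mulr_sumr -big_split/=.
  apply: ler_sum => al _.
  have hs : bsum p z a 0 0 (rVpoly al) <= \sum_(J < p) bsum p z a 1 J (rVpoly al).
    have := @bsum_split R p p_pr (p ^ M) Q z a 0 1 0 (rVpoly al) (pX0 0).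
    move=> /le_trans; apply; rewrite expn1 expn0.
    by apply: ler_sum => J _; rewrite mul1n.
  have := @broad_narrow R p (fun J => bsum p z a 1 J (rVpoly al)) _ s (ltnW t3)
    (fun J => bsum_ge0 _ _ _ _ _ _) (bsum_ge0 _ _ _ _ _ _) hs.
  by rewrite mulnBr muln1 => /le_trans; apply.
rewrite mulrDl; apply: lerD.
  have hJ J : (J < p)%N -> \sum_(al : 'rV['Z_(p ^ M)]_k.+1) bsum p z a 1 J (rVpoly al) ^+ (2 * s) <=
      D * Xsum p k n.+1 M z a 1 J.
    move=> Jp; have J1 : (J < p ^ 1)%N by rewrite expn1.
    have hM : (k * (1 + n) <= M)%N by rewrite add1n.
    have := @dec_rescale R p p_pr k n D M 1 J Q z a (ltnW k1) n0 hD hM J1.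
    by rewrite /Xsum subn1 mulrA add1n.
  apply: (@le_trans _ _ (2 ^+ (2 * s) * (D * \sum_(J < p) Xsum p k n.+1 M z a 1 J))).
    rewrite ler_wpM2l ?exprn_ge0// mulr_sumr; apply: ler_sum => J _; exact: hJ.
  have S0 : 0 <= \sum_(J < p) Xsum p k n.+1 M z a 1 J.
    by apply: sumr_ge0 => J _; exact: Xsum_ge0.
  rewrite X1 !mulrA ler_wpM2r// [leRHS]mulrAC ler_wpM2r//.
  rewrite ler_pdivlMl// -exprS.
  apply: (@le_trans _ _ ((2 ^+ 4) ^+ s.-1)).
    rewrite -exprM ler_weXn2l// ?ler1n//.
    by case: (s) t3 => [//|[//|[//|s' _]]] /=; rewrite mulnS; lia.
  by rewrite lerXn2r// ?nnegrE ?exprn_ge0// -natrX ler_nat.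
apply: (@le_trans _ _ (p%:R ^+ (2 * s + 2) * (\sum_(J < p) \sum_(J' < p) G * Xsum p k n.+1 M z a 0 0))).
  rewrite ler_wpM2l ?exprn_ge0//; apply: ler_sum => J _.
  rewrite [leRHS](bigID (fun J' => J' != J))/= -[leLHS]addr0; apply: lerD.
    by apply: ler_sum => J' JJ'; apply: hG => //; rewrite eq_sym.
  by apply: sumr_ge0 => J' _; rewrite mulr_ge0// Xsum_ge0.
rewrite !sumr_const !card_ord -!mulrnA -[_ *+ (_ * _)%N]mulr_natr natrM.
rewrite le_eqVlt; apply/orP; left; apply/eqP.
have -> : (2 * s + 4 = (2 * s + 2) + 2)%N by rewrite -addnA.
by rewrite (exprD _ (2 * s + 2)); ring.
Qed.

End Descent.

(** * Orthogonality of characters and decoupling in degree one *)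

Section Orthogonality.
Variable R : realType.

Lemma chi_eq1 N (z : 'Z_N) : (1 < N)%N -> chi R z = 1 -> z = 0.
Proof.
move=> N1 h; apply/eqP/negPn/negP => z0.
have z0' : (0 < nat_of_ord z)%N by rewrite lt0n.
have zN : (nat_of_ord z < N)%N.
  by rewrite -[X in (_ < X)%N](Zp_cast N1) ltn_ord.
have N0 : 0 < (N%:R : R) by rewrite ltr0n (ltn_trans _ N1).
pose y : R := pi * (nat_of_ord z)%:R / N%:R.
have y0 : 0 < y by rewrite divr_gt0// mulr_gt0 ?pi_gt0 ?ltr0n.
have ypi : y < pi by rewrite /y -mulrA gtr_pMr ?pi_gt0// ltr_pdivrMr// mul1r ltr_nat.
have s0 : 0 < sin y by rewrite sin_gt0_pi// y0.
have : complex.Re (chi R z) = 1 by rewrite h.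
rewrite /chi /= (_ : 2 * pi * _ / _ = y + y); last by rewrite /y; field; rewrite gt_eqF.
rewrite cosD => e; have := cos2Dsin2 y; rewrite !expr2 => e2.
have : 0 < sin y * sin y by rewrite mulr_gt0.
by clear -e e2; move: e e2; move: (cos y * cos y) (sin y * sin y) => u v; lra.
Qed.

(** Translation by X^j multiplies the sum by a character value different from 1. *)
Lemma sum_chi_eq0 N k (L : {poly 'Z_N} -> 'Z_N) j : (1 < N)%N -> (j < k.+1)%N ->
  {morph L : P Q / P + Q} -> L 'X^j != 0 ->
  \sum_(al : 'rV['Z_N]_k.+1) chi R (L (rVpoly al)) = 0.
Proof.
move=> N1 jk LD L0; set T := (X in X = 0).
have : T = T * chi R (L 'X^j).
  rewrite {1}/T -(sum_translate (fun P => chi R (L P)) (P := 'X^j)) ?size_polyXn//.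
  by rewrite mulr_suml; apply: eq_bigr => al _; rewrite LD chiD.
move=> /eqP; rewrite -subr_eq0 -{1}[T]mulr1 -mulrBr mulf_eq0 => /orP[/eqP//|].
by rewrite subr_eq0 => /eqP /esym /(chi_eq1 N1) e; rewrite e eqxx in L0.
Qed.

End Orthogonality.

Section Plancherel.
Variable R : realType.
Variable p : nat.
Hypothesis p_pr : prime p.

Lemma sum_conj_expsum_eq0 M n Q (z : 'I_Q -> nat) (a b : 'I_Q -> R[i]) :
  (0 < M)%N -> (n <= M)%N ->
  (forall x y, a x != 0 -> b y != 0 -> z x != z y %[mod p ^ n]) ->
  \sum_(al : 'rV['Z_(p ^ M)]_2) expsum z a (rVpoly al) * (expsum z b (rVpoly al))^*%C = 0.
Proof.
move=> M0 nM ab; have pM1 := pM_gt1 p_pr M0.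
transitivity (\sum_(x < Q) \sum_(y < Q) a x * (b y)^*%C *
   \sum_(al : 'rV['Z_(p ^ M)]_2) chi R ((rVpoly al).[(z x)%:R] - (rVpoly al).[(z y)%:R])).
  under [RHS]eq_bigr do under eq_bigr do rewrite mulr_sumr.
  under [RHS]eq_bigr do rewrite exchange_big/=.
  rewrite [RHS]exchange_big/=; apply: eq_bigr => al _.
  rewrite /expsum rmorph_sum/= mulr_suml; apply: eq_bigr => x _.
  rewrite mulr_sumr; apply: eq_bigr => y _.
  rewrite rmorphM/= mulrACA; congr (_ * _); rewrite chiD//; congr (_ * _).
  have : chi R (rVpoly al).[(z y)%:R] * chi R (- (rVpoly al).[(z y)%:R]) = 1.
    by rewrite -chiD// subrr chi0.
  have : chi R (rVpoly al).[(z y)%:R] * (chi R (rVpoly al).[(z y)%:R])^*%C = 1.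
    by rewrite mulJ_cmod cmod_chi expr1n.
  move=> <- /mulfI e; apply/esym/e; apply/eqP => c0.
  by have := cmod_chi R (rVpoly al).[(z y)%:R]; rewrite c0 cmod0 => /esym/eqP; rewrite oner_eq0.
apply: big1 => x _; apply: big1 => y _.
have [->|ax] := eqVneq (a x) 0; first by rewrite !mul0r.
have [->|bY] := eqVneq (b y) 0; first by rewrite conjc0 mulr0 mul0r.
rewrite (@sum_chi_eq0 R (p ^ M) 1 (fun P => P.[(z x)%:R] - P.[(z y)%:R]) 1) ?mulr0//.
  by move=> P P'; rewrite !hornerD opprD addrACA.
rewrite hornerXn hornerXn !expr1 subr_eq0; apply/negP => /eqP e.
have /negP := ab x y ax bY; apply; apply/eqP.
have := congr1 (fun u : 'Z_(p ^ M) => nat_of_ord u) e; rewrite /= !val_Zp_nat//.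
move=> /(congr1 (modn^~ (p ^ n)%N)) /=; rewrite !modn_dvdm// dvdn_exp2l//.
Qed.

(** In degree one the critical exponent is 2, and blocks in different classes modulo p^n are
    orthogonal. *)
Lemma dec1 n : dec p 1 n (1 : R).
Proof.
move=> M M0; rewrite mul1n => nM Q z a; rewrite (_ : tri 1 = 1%N)// muln0 expr0 !mul1r muln1.
have p0 := prime_gt0 p_pr.
pose S J := expsum z (restr (fun x => (z x %% p ^ n == J)%N) a) : {poly 'Z_(p ^ M)} -> R[i].
have sE P : expsum z a P = \sum_(J < p ^ n) S J P.
  rewrite /S /expsum exchange_big/=; apply: eq_bigr => x _; rewrite -mulr_suml; congr (_ * _).
  have rl : (z x %% p ^ n < p ^ n)%N by rewrite ltn_mod expn_gt0 p0.
  by rewrite /restr -big_mkcond (big_pred1 (Ordinal rl)).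
have C2 (w : R[i]) : (cmod w ^+ 2)%:C = w * w^*%C by rewrite mulJ_cmod.
suff : (\sum_(al : 'rV['Z_(p ^ M)]_2) cmod (expsum z a (rVpoly al)) ^+ 2)%:C =
   (\sum_(J < p ^ n) \sum_(al : 'rV['Z_(p ^ M)]_2) cmod (S J (rVpoly al)) ^+ 2)%:C :> R[i].
  by move=> /complexI ->.
rewrite !rmorph_sum/=; under eq_bigr do rewrite C2 sE rmorph_sum/= mulr_suml.
rewrite exchange_big/=; apply: eq_bigr => J _; rewrite rmorph_sum/=.
under eq_bigr do rewrite mulr_sumr.
rewrite exchange_big/= (bigD1 J)//= [X in _ + X]big1 ?addr0.
  by apply: eq_bigr => al _; rewrite C2.
move=> J' J'J; apply: (@sum_conj_expsum_eq0 M n) => // x y; rewrite /restr.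
case: ifP => [/eqP ex|_]; last by rewrite eqxx.
case: ifP => [/eqP ey|_]; last by rewrite eqxx.
by move=> _ _; rewrite ex ey eq_sym.
Qed.

End Plancherel.

(** * Descent to arbitrarily small exponents, by induction on the degree *)

Section Decoupling.
Variable R : realType.
Variable p : nat.
Hypothesis p_pr : prime p.
Hypothesis p16 : (16 <= p)%N.

Let p0 : (0 < p)%N := prime_gt0 p_pr.
Let pR0 : 0 < p%:R :> R.
Proof. by rewrite ltr0n. Qed.
Let pR1 : 1 <= p%:R :> R.
Proof. by rewrite ler1n. Qed.

Local Notation pw := (@pw R p).

Lemma exists_bilinear_bound k (et C0 eps C1 : R) i : (1 < k)%N -> (k < p)%N ->
  0 <= et -> 1 <= C0 -> 0 < eps -> 1 <= C1 ->
  (forall m, (0 < m)%N -> dec p k m (C0 * p%:R `^ (et * m%:R))) ->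
  uniform_lower_dec p k eps C1 ->
  exists2 C, 1 <= C & bilinear_bound p k et eps i C.
Proof.
move=> k1 kp et0 C01 eps0 C11 hd hl; elim: i => [|i [C C1' IH]].
  by exists C0 => //; apply: bilinear_bound0.
exists (C0 * (C1 ^+ 2 * C) ^+ k); first by rewrite mulr_ege1// exprn_ege1// mulr_ege1// exprn_ege1.
exact: bilinear_bound_step.
Qed.

Definition decoupled k (et : R) :=
  exists2 C : R, 1 <= C & forall n, (0 < n)%N -> dec p k n (C * p%:R `^ (et * n%:R)).

(** The decrement [de] depends on [et0] but not on [et]; this uniformity lets finitely many descents
    reach any positive exponent. *)
Lemma dec_descent k (et0 : R) : (1 < k)%N -> (k < p)%N -> 0 < et0 ->
  (forall l, (0 < l < k)%N -> forall eps' : R, 0 < eps' ->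
     exists2 n, (0 < n)%N & dec p l n (p%:R `^ (eps' * n%:R))) ->
  exists2 de : R, 0 < de & forall et, et0 <= et -> decoupled k et -> decoupled k (et - de).
Proof.
move=> k1 kp et00 hlow.
have k0 : (0 < k)%N by apply: ltnW.
have kR : 1 < (k%:R : R) by rewrite ltr1n.
pose s := tri k; pose K := (2 * k + 2 * s + 1).+1.
(* Enough rounds [m] that the gain per unit of [b], taken at l = 1, exceeds the loss 2k+2s+1 of
   [Ysum1_le] by at least 1. *)
have [m m0 hm] : exists2 m, (0 < m)%N & K%:R <= et0 * m%:R / k%:R ^+ 2 * (k%:R - 1).
  pose q := K%:R * k%:R ^+ 2 / (k%:R - 1) / et0.
  have q0 : 0 <= q by rewrite !divr_ge0 ?mulr_ge0 ?exprn_ge0 ?subr_ge0// ltW.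
  exists (Num.bound q).+1 => //.
  have : q <= (Num.bound q).+1%:R.
    by rewrite (le_trans (ltW (archi_boundP q0)))// ler_nat.
  rewrite /q ler_pdivrMr// ler_pdivrMr ?subr_gt0//.
  rewrite -ler_pdivlMr ?exprn_gt0 ?(lt_trans ltr01)// => /le_trans; apply.
  by rewrite le_eqVlt; apply/orP; left; apply/eqP; field; rewrite gt_eqF// (lt_trans ltr01).
pose V := (k ^ m.+1 * k`! ^ m.+1)%N.
have V0 : (0 < V)%N by rewrite muln_gt0 !expn_gt0 k0 fact_gt0.
pose d0 : R := (k ^ m.+1)%N%:R^-1.
have kmR : 1 <= (k ^ m.+1)%N%:R :> R by rewrite ler1n expn_gt0 k0.
have d00 : 0 < d0 by rewrite invr_gt0 (lt_le_trans ltr01).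
have d01 : d0 <= 1 by rewrite invf_le1// (lt_le_trans ltr01).
have mR : 0 < (m%:R : R) by rewrite ltr0n.
(* The accumulated losses m k eps n then amount to d0 n/2, half of the net gain b, which is about d0
   n. *)
pose eps := d0 / (2 * m%:R * k%:R).
have eps0 : 0 < eps by rewrite divr_gt0// !mulr_gt0// (lt_trans ltr01).
have [C1 C11 hld] := exists_uniform_lower_dec p_pr kp eps0 hlow.
(* The minimum with [et0] keeps [et - de] nonnegative. *)
pose de := Num.min (d0 / 2) et0.
exists de; first by rewrite lt_min divr_gt0//.
move=> et et0et [C0 C01 hC0].
have etp : 0 < et by apply: lt_le_trans et0et.
have [Cm Cm1 hbil] := exists_bilinear_bound m k1 kp (ltW etp) C01 eps0 C11 hC0 hld.
have de1 : de <= d0 / 2 by rewrite ge_min lexx.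
have de2 : 0 <= et - de by rewrite subr_ge0 ge_min et0et orbT.
pose E := p%:R ^+ (2 * s + 4) * (Cm * pw V%:R).
have E0 : 0 <= E by rewrite !mulr_ge0 ?exprn_ge0 ?pw_ge0// (le_trans ler01).
(* The first summand covers lengths up to [V] by the trivial bound; the second gives Cf/2 + E <= Cf,
   which closes the induction on the length through [dec_step]. *)
pose Cf := pw (V * s)%N%:R + 2 * E.
have Cf1 : 1 <= Cf by rewrite (le_trans (pw_ge1 p_pr (ler0n _ (V * s)%N)))// lerDl mulr_ge0.
exists Cf => //; elim=> // n IH _.
have [nV|Vn] := leqP n.+1 V.
  apply: (dec_le _ (@dec_trivial R p p_pr k n.+1 k0)).
  rewrite pwX//; apply: (@le_trans _ _ (Cf * 1)); last first.
    by rewrite ler_wpM2l ?(le_trans ler01)// pw_ge1// mulr_ge0.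
  rewrite mulr1; apply: (@le_trans _ _ (pw (V * s)%N%:R)); last by rewrite lerDl mulr_ge0.
  by rewrite ler_pw// ler_nat leq_mul2r nV orbT.
have n0 : (0 < n)%N by apply: (leq_trans V0); rewrite -ltnS.
have hD := IH n0.
(* The largest multiple of k!^(m+1) with k^(m+1) b <= n. *)
pose b := (k`! ^ m.+1 * (n %/ V))%N.
have b0 : (0 < b)%N by rewrite muln_gt0 expn_gt0 fact_gt0/= divn_gt0.
have kbE : (k ^ m.+1 * b = V * (n %/ V))%N by rewrite /b mulnA.
have kbn : (k ^ m.+1 * b < n.+1)%N by rewrite kbE ltnS mulnC leq_divM.
have kb1 : (k * b < n.+1)%N.
  by apply: leq_ltn_trans kbn; rewrite leq_mul2r -{1}[k]expn1 leq_pexp2l ?orbT.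
have bR : d0 * (n.+1%:R - V%:R) <= b%:R.
  rewrite mulrC ler_pdivrMr ?(lt_le_trans ltr01)// -natrM mulnC kbE lerBlDr -natrD ler_nat.
  rewrite {1}(divn_eq n V) mulnC -addnS leq_add2l ltn_mod//.
pose B := Cm * pw (et * n.+1%:R - et * m%:R / k%:R ^+ 2 * (1 * (k%:R - 1)) * b%:R
           + m%:R * k%:R * (eps * n.+1%:R)).
have B0 : 0 <= B by rewrite mulr_ge0 ?pw_ge0// (le_trans ler01).
pose G := p%:R ^+ ((2 * k + 2 * s + 1) * b) * B.
have G0 : 0 <= G by rewrite mulr_ge0// exprn_ge0.
have hG M Q (z : 'I_Q -> nat) (a : 'I_Q -> R[i]) J J' : (k * n.+1 <= M)%N ->
    (J < p)%N -> (J' < p)%N -> J != J' ->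
    Ysum p k M z a 1 1 J 1 J' <= G * Xsum p k n.+1 M z a 0 0.
  move=> knM Jp J'p ne.
  apply: (Ysum1_le p_pr k1 kp knM b0 (ltnW kb1) Jp J'p B0 ne).
  move=> xi eta xl el ne'; apply: hbil => //.
  - by rewrite /b dvdn_mulr.
  - by rewrite mul1n subn1 prednK.
  - by rewrite muln_gt0 k0 b0.
have := dec_step p_pr k1 kp (mulr_ge0 (le_trans ler01 Cf1) (pw_ge0 _ _)) G0 n0 p16 hD hG.
apply: dec_le.
have hGle : p%:R ^+ (2 * s + 4) * G <= E * pw ((et - de) * n.+1%:R).
  rewrite /E -[leRHS]mulrA ler_wpM2l ?exprn_ge0// /G /B mulrCA -[leRHS]mulrA.
  rewrite ler_wpM2l ?(le_trans ler01)//.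
  rewrite (pwX R p) -!pwD//; apply: ler_pw => //.
  have e1 : m%:R * k%:R * (eps * n.+1%:R) = d0 / 2 * n.+1%:R.
    by rewrite /eps; field; rewrite !gt_eqF// (lt_trans ltr01).
  rewrite e1 natrM.
  have e2 : K%:R * b%:R <= et * m%:R / k%:R ^+ 2 * (1 * (k%:R - 1)) * b%:R.
    rewrite ler_wpM2r// mul1r (le_trans hm)// ler_wpM2r ?subr_ge0 ?(ltW kR)//.
    by rewrite ler_wpM2r ?invr_ge0 ?exprn_ge0// ler_wpM2r.
  have e3 : de * n.+1%:R <= d0 / 2 * n.+1%:R by rewrite ler_wpM2r.
  have e4 : d0 * V%:R <= V%:R by rewrite ler_piMl.
  have KE : K%:R = (2 * k + 2 * s + 1)%N%:R + 1 :> R by rewrite natr1.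
  move: e2 e3 e4 bR; rewrite KE; clear.
  move: (et * m%:R / k%:R ^+ 2 * (1 * (k%:R - 1))) => X.
  move: ((2 * k + 2 * s + 1)%N%:R : R) (b%:R : R) (n.+1%:R : R) (V%:R : R) => kk b' n' v.
  nra.
rewrite -/E in hGle *.
set P := pw ((et - de) * n.+1%:R) in hGle *.
have hP : pw ((et - de) * n%:R) <= P by rewrite ler_pw// ler_wpM2l// ler_nat.
have P0 : 0 <= P by apply: pw_ge0.
have Cf0 : 0 <= Cf by apply: le_trans ler01 Cf1.
have h1 : Cf * pw ((et - de) * n%:R) <= Cf * P by rewrite ler_wpM2l.
have h2 : 2 * E * P <= Cf * P by rewrite ler_wpM2r// lerDr pw_ge0.
apply: (@le_trans _ _ (2^-1 * (Cf * P) + E * P)).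
  by apply: lerD; [rewrite ler_wpM2l// invr_ge0|exact: hGle].
rewrite -/P -mulrA in h2 *; change (2^-1 * (Cf * P) + E * P <= Cf * P).
move: h2; move: (Cf * P) (E * P) => u v; lra.
Qed.

Lemma decoupled_le k et et' : et <= et' -> decoupled k et -> decoupled k et'.
Proof.
move=> le [C C1 hC]; exists C => // n n0; apply: (dec_le _ (hC n n0)).
by rewrite ler_wpM2l ?(le_trans ler01)// ler_powR// ler_wpM2r.
Qed.

(** For large [n] half of the exponent absorbs the constant; lower degree decoupling iterates such a
    constant-free inequality. *)
Lemma decoupled_small k (eps : R) : 0 < eps -> decoupled k (eps / 2) ->
  exists2 n, (0 < n)%N & dec p k n (p%:R `^ (eps * n%:R)).
Proof.
move=> e0 [C C1 hC].
have e20 : 0 < eps / 2 by rewrite divr_gt0.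
pose N := (Num.bound (eps / 2)^-1).+1; pose j := (Num.bound C).+1.
have hN : 1 <= eps / 2 * N%:R.
  have q0 : 0 <= (eps / 2)^-1 by rewrite invr_ge0 ltW.
  rewrite mulrC -ler_pdivrMr// mul1r (le_trans (ltW (archi_boundP q0)))//.
  by rewrite ler_nat.
have C0 : 0 <= C by apply: le_trans ler01 C1.
exists (N * j)%N => //; apply: (dec_le _ (hC _ _)) => //.
have -> : eps * (N * j)%N%:R = eps / 2 * (N * j)%N%:R + eps / 2 * (N * j)%N%:R by field.
rewrite -/(pw _) -/(pw _) pwD// ler_wpM2r ?pw_ge0//.
apply: (@le_trans _ _ (pw j%:R)); last first.
  by rewrite ler_pw// natrM mulrA ler_peMl.
rewrite -pwX -natrX; apply: (@le_trans _ _ j%:R).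
  by rewrite (le_trans (ltW (archi_boundP C0)))// ler_nat.
by rewrite ler_nat ltnW// ltn_expl// prime_gt1.
Qed.

(* A p-adic l^p form of the theorem of Wooley and of Bourgain, Demeter and Guth. *)
Theorem moment_curve_decoupling k (eps : R) : (0 < k)%N -> (k < p)%N -> 0 < eps ->
  decoupled k eps.
Proof.
elim/ltn_ind: k eps => k IH eps k0 kp e0.
have [k1|k1] := leqP k 1.
  have -> : k = 1%N by apply/eqP; rewrite eqn_leq k1.
  exists 1 => // n n0; apply: (dec_le _ (@dec1 R p p_pr n)).
  by rewrite mul1r pw_ge1// mulr_ge0// ltW.
have hlow l : (0 < l < k)%N -> forall eps' : R, 0 < eps' ->
     exists2 n, (0 < n)%N & dec p l n (p%:R `^ (eps' * n%:R)).
  move=> /andP[l0 lk] e' e'0; apply: decoupled_small => //.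
  by apply: IH => //; [exact: ltn_trans kp|rewrite divr_gt0].
have [de de0 hde] := dec_descent k1 kp e0 hlow.
have start : decoupled k (Num.max eps (tri k)%:R).
  apply: (@decoupled_le k (tri k)%:R); first by rewrite le_max lexx orbT.
  exists 1 => // n n0; apply: (dec_le _ (@dec_trivial R p p_pr k n k0)).
  by rewrite mul1r pwX// /pw -natrM mulnC.
(* Start from the trivial exponent [tri k], lower it by [de] each time, and stop at [eps]. *)
have iter j : decoupled k (Num.max eps ((tri k)%:R - j%:R * de)).
  elim: j => [|j hj]; first by rewrite mul0r subr0.
  have := hde _ _ hj; rewrite le_max lexx => /(_ isT).
  apply: decoupled_le; rewrite lerBlDr ge_max; apply/andP; split.
    by rewrite -[leLHS]addr0 lerD ?(ltW de0)// le_max lexx.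
  rewrite -[leLHS](subrK de) lerD2r le_max; apply/orP; right.
  by rewrite -natr1 mulrDl mul1r opprD addrA.
have := iter (Num.bound ((tri k)%:R / de)).
rewrite (_ : Num.max _ _ = eps)//; apply/max_idPl.
rewrite (@le_trans _ _ 0)//; last exact: ltW.
by rewrite subr_le0 -ler_pdivrMr//; apply/ltW/archi_boundP; rewrite divr_ge0// ltW.
Qed.

End Decoupling.

(** * Vinogradov's mean value theorem *)

Section MeanValue.
Variable R : realType.

(* The index range is 0..X-1 and the exponents in [vinogradov] are 1..k. *)
Definition psum s X (f : {ffun 'I_s -> 'I_X}) j : nat := \sum_(i < s) f i ^ j.

Definition vinogradov k s X : {set {ffun 'I_s -> 'I_X} * {ffun 'I_s -> 'I_X}} :=
  [set u | [forall j : 'I_k, psum u.1 j.+1 == psum u.2 j.+1]].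

(** Expanding the power gives one term for each pair of tuples; it equals the number of polynomials
    if the power sums agree modulo p^M and is 0 otherwise. Integral solutions are among the
    former. *)
Lemma card_vinogradov_le p k s M X : prime p -> (0 < M)%N ->
  (#|vinogradov k s X| * #|'rV['Z_(p ^ M)]_k.+1|)%:R <=
  \sum_(al : 'rV['Z_(p ^ M)]_k.+1)
     cmod (expsum (fun x : 'I_X => nat_of_ord x) (fun=> 1 : R[i]) (rVpoly al)) ^+ (2 * s).
Proof.
move=> p_pr M0; have N1 := pM_gt1 p_pr M0.
set N := (p ^ M)%N in N1 *; set V := 'rV['Z_N]_k.+1.
pose T (f : {ffun 'I_s -> 'I_X}) (P : {poly 'Z_N}) := \sum_(i < s) P.[(f i)%:R].
pose L (u : {ffun 'I_s -> 'I_X} * {ffun 'I_s -> 'I_X}) (P : {poly 'Z_N}) := T u.1 P - T u.2 P.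
have LD u : {morph L u : P Q / P + Q}.
  move=> P Q; rewrite /L /T.
  under eq_bigr do rewrite hornerD. under [X in _ - X]eq_bigr do rewrite hornerD.
  by rewrite !big_split/= opprD addrACA.
have chi_prod (f : {ffun 'I_s -> 'I_X}) P : \prod_(i < s) chi R (P.[(f i)%:R]) = chi R (T f P).
  apply/esym; apply: (big_morph (chi R (N:=N))); last exact: chi0.
  by move=> x y; rewrite chiD.
have chi_conj (x y : 'Z_N) : chi R x * (chi R y)^*%C = chi R (x - y).
  rewrite chiD//; congr (_ * _).
  have y1 : chi R y * (chi R y)^*%C = 1 by rewrite mulJ_cmod cmod_chi expr1n.
  have y2 : chi R y * chi R (- y) = 1 by rewrite -chiD// subrr chi0.
  rewrite -[LHS]mulr1 -y2 mulrA [_^*%C * _]mulrC y1 mul1r //.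
pose good u := [forall j : 'I_k.+1, L u 'X^j == 0].
have sum_good u : \sum_(al : V) chi R (L u (rVpoly al)) = (if good u then #|V| else 0)%:R.
  case: ifPn => [/forallP hu|]; last first.
    by rewrite negb_forall => /existsP [j hj]; rewrite (@sum_chi_eq0 R N k (L u) j N1 (ltn_ord j) (LD u) hj).
  rewrite -sumr_const; apply: eq_bigr => al _.
  suff -> : L u (rVpoly al) = 0 by rewrite chi0.
  have sal : (size (rVpoly al) <= k.+1)%N by apply: size_poly.
  rewrite -(take_poly_id sal) /take_poly poly_def.
  have L0 : L u 0 = 0.
    by rewrite /L /T big1 ?sub0r ?big1 ?oppr0// => i _; rewrite horner0.
  rewrite (big_morph (L u) (LD u) L0) big1// => j _.
  rewrite /L /T; under eq_bigr do rewrite hornerZ.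
  under [X in _ - X]eq_bigr do rewrite hornerZ.
  by rewrite -!mulr_sumr -mulrBr -/(T _ _) -/(L u _) (eqP (hu j)) mulr0.
have expand (al : V) : (cmod (expsum (fun x : 'I_X => nat_of_ord x) (fun=> 1 : R[i]) (rVpoly al)) ^+ (2 * s))%:C
    = \sum_u chi R (L u (rVpoly al)).
  set F := expsum _ _ _.
  have Fs : F ^+ s = \sum_(f : {ffun 'I_s -> 'I_X}) chi R (T f (rVpoly al)).
    have -> : F ^+ s = \prod_(i < s) F by rewrite prodr_const card_ord.
    rewrite /F /expsum bigA_distr_bigA/=; apply: eq_bigr => f _.
    by rewrite -chi_prod; apply: eq_bigr => i _; rewrite mul1r.
  rewrite mulnC exprM -cmodX -mulJ_cmod Fs rmorph_sum/= mulr_suml.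
  rewrite -(pair_bigA _ (fun f g => chi R (L (f, g) (rVpoly al))))/=.
  apply: eq_bigr => f _; rewrite mulr_sumr; apply: eq_bigr => g _.
  by rewrite chi_conj.
rewrite -lecR rmorph_sum/=; under eq_bigr do rewrite expand.
rewrite exchange_big/=; under eq_bigr do rewrite sum_good.
rewrite -natr_sum rmorph_nat ler_nat -sum_nat_const big_mkcond/=.
apply: leq_sum => u _; rewrite inE; case: ifP => // /forallP hu.
rewrite ifT//; apply/forallP => -[[|j] jk]; rewrite /L /T/=.
  under eq_bigr do rewrite expr0 hornerC. under [X in _ - X]eq_bigr do rewrite expr0 hornerC.
  by rewrite subrr.
have jk' : (j < k)%N by [].
have /eqP := hu (Ordinal jk'); rewrite /psum /= => e.
under eq_bigr do rewrite hornerXn -natrX. under [X in _ - X]eq_bigr do rewrite hornerXn -natrX.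
by rewrite -!natr_sum e subrr.
Qed.

Theorem vinogradov_mean_value k (eps : R) : (0 < k)%N -> 0 < eps ->
  exists2 C : R, 0 < C & forall X, (0 < X)%N ->
    (#|vinogradov k (tri k) X|)%:R <= C * X%:R `^ ((tri k)%:R + eps).
Proof.
move=> k0 e0.
(* The prime depends only on [k], so it may enter the constant. *)
have [p pk p_pr] := prime_above (k + 16).
have p16 : (16 <= p)%N by apply: ltnW; apply: leq_ltn_trans pk; rewrite leq_addl.
have kp : (k < p)%N by apply: leq_ltn_trans pk; rewrite leq_addr.
have p0 := prime_gt0 p_pr; have p1 := prime_gt1 p_pr.
have [C C1 hC] := moment_curve_decoupling p_pr p16 k0 kp e0.
have pR : 0 < (p%:R : R) by rewrite ltr0n.
have t0 := tri_gt0 k0.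
exists (C * p%:R `^ ((tri k)%:R + eps)).
  by rewrite mulr_gt0 ?powR_gt0// (lt_le_trans ltr01).
move=> X X0; set s := tri k in t0 *.
(* The first power of p above [X]: each class modulo p^n then holds at most one point, so a block
   sum has modulus at most 1, while p^n <= pX. *)
pose n := (trunc_log p X).+1.
have /andP[pnX Xpn] := trunc_log_bounds p1 X0.
have M0 : (0 < k * n)%N by rewrite muln_gt0 k0.
have := card_vinogradov_le k s X p_pr M0.
have := hC n isT (k * n)%N M0 (leqnn _) X (fun x => nat_of_ord x) (fun=> 1).
set V := 'rV_k.+1 => hdec hcount.
have V0 : 0 < (#|V : finType|)%:R :> R by rewrite ltr0n; apply/card_gt0P; exists 0.
have := le_trans hcount hdec; rewrite natrM.
have small J (al : V) : (J < p ^ n)%N ->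
   cmod (expsum (fun x : 'I_X => nat_of_ord x)
        (restr (fun x => (x %% p ^ n == J)%N) (fun=> 1 : R[i])) (rVpoly al)) ^+ (2 * s) <= 1.
  move=> Jp; rewrite exprn_ile1 ?cmod_ge0// (le_trans (ler_cmod_sum _ _ _))//.
  have [JX|XJ] := ltnP J X; last first.
    rewrite big1// => x _; rewrite /restr ifF ?mul0r ?cmod0//.
    by rewrite modn_small ?(ltn_trans (ltn_ord x))// ltn_eqF// (leq_trans (ltn_ord x)).
  rewrite (bigD1 (Ordinal JX))//= big1 ?addr0.
    by rewrite /restr /= modn_small ?(ltn_trans JX)// eqxx mul1r cmod_chi.
  move=> x xJ; rewrite /restr ifF ?mul0r ?cmod0//.
  rewrite modn_small ?(ltn_trans (ltn_ord x))//.
  by apply/negbTE; apply: contra xJ => /eqP e; rewrite -val_eqE /= e.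
set D := C * _ * _ => hle.
have C0 : 0 <= C by apply: le_trans ler01 C1.
have D0 : 0 <= D by rewrite /D !mulr_ge0 ?powR_ge0 ?exprn_ge0.
have hle2 : (#|vinogradov k s X|)%:R * (#|V : finType|)%:R <= D * (p ^ n)%N%:R * (#|V : finType|)%:R :> R.
  apply: (le_trans hle); rewrite -mulrA ler_wpM2l//.
  apply: (@le_trans _ _ (\sum_(J < p ^ n) \sum_(al : V) 1)).
    by apply: ler_sum => J _; apply: ler_sum => al _; apply: small.
  by rewrite !sumr_const card_ord -mulrnA mulnC natrM.
rewrite ler_pM2r// in hle2; apply: (le_trans hle2).
have pnR : (p ^ n)%N%:R <= p%:R * X%:R :> R.
  by rewrite -natrM ler_nat /n expnS leq_mul2l pnX orbT.
have -> : D * (p ^ n)%N%:R = C * (p ^ n)%N%:R `^ (s%:R + eps).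
  rewrite natrX -[in RHS]powR_mulrn ?(ltW pR)// -powRrM mulrDr powRD ?(gt_eqF pR) ?implybT//.
  rewrite -natrM powR_mulrn ?(ltW pR)// -[in X in _ = X](prednK t0) mulnS exprD /D [n%:R * eps]mulrC.
  by ring.
rewrite -mulrA ler_wpM2l ?(le_trans ler01)// -powRM ?(ltW pR)//.
by rewrite ge0_ler_powR ?nnegrE ?mulr_ge0 ?addr_ge0// ltW.
Qed.

End MeanValue.

(** * The large sieve for two frequencies *)

Section CircleNorm.
Variable R : realType.
Implicit Types (x y : R).

(* Comparable to the distance from [x] to 2 pi Z. *)
Definition nrm x : R := cmod (expi x - 1).

Lemma nrm_ge0 x : 0 <= nrm x.
Proof. exact: cmod_ge0. Qed.

Lemma expi2piz (z : int) : expi (z%:~R * (2 * pi) : R) = 1.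
Proof.
case: z => n; first exact: expi2pin.
by rewrite NegzE mulrNz mulNr expiN expi2pin conjc1.
Qed.

Lemma nrm_period x (z : int) : nrm (x + z%:~R * (2 * pi)) = nrm x.
Proof. by rewrite /nrm expiD expi2piz mulr1. Qed.

Lemma nrmN x : nrm (- x) = nrm x.
Proof.
have -> : nrm (- x) = cmod (expi x - 1)^*%C by rewrite /nrm expiN rmorphB rmorph1.
exact: cmodJ.
Qed.

Lemma nrmE x : nrm x = 2 * `|sin (x / 2)|.
Proof.
have -> : 2 * `|sin (x / 2)| = `|2 * sin (x / 2)| by rewrite normrM ger0_norm.
rewrite -sqrtr_sqr /nrm /cmod /expi /=; congr Num.sqrt.
rewrite -{1 2}[x](@divfK _ 2)// mulr_natr cos_mulr2n sin_mulr2n.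
have := cos2Dsin2 (x / 2); move: (cos _) (sin _) => c s h.
have c2 : c ^+ 2 = 1 - s ^+ 2 by rewrite -h addrK.
have -> : (c * s *+ 2 - 0) ^+ 2 = 4 * c ^+ 2 * s ^+ 2 by ring.
by rewrite c2; ring.
Qed.

Lemma sin_mvt x : 0 <= x -> exists2 c, 0 <= c <= x & sin x = x * cos c.
Proof.
move=> x0.
have [c + e] : exists2 c, c \in `[0, x]%R & sin x - sin 0 = cos c * (x - 0).
  apply: MVT_segment => //; last first.
    by apply: continuous_subspaceT => y; exact: continuous_sin.
rewrite in_itv/= => h; exists c => //.
by move: e; rewrite sin0 !subr0 mulrC.
Qed.

Lemma sin_ge_half x : 0 <= x <= pi / 2 -> x / 2 <= sin x.
Proof.
move=> /andP[x0 xpi]; set y := x / 2.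
have pi0 := pi_gt0 R.
have y0 : 0 <= y by rewrite divr_ge0.
have ypi : y <= pi / 2 by apply: le_trans xpi; rewrite /y ler_pdivrMr// ler_peMr// ler1n.
have xE : x = y *+ 2 by rewrite /y -mulr_natr divfK.
have cx : 0 <= cos x by apply: cos_ge0_pihalf; rewrite xpi andbT (le_trans _ x0)// oppr_le0 divr_ge0// ltW.
have cy : 0 <= cos y by apply: cos_ge0_pihalf; rewrite ypi andbT (le_trans _ y0)// oppr_le0 divr_ge0// ltW.
have c2 : 1 <= 2 * (cos y * cos y).
  by move: cx; rewrite xE cos_mulr2n expr2 -mulr_natl; lra.
have [c /andP[c0 cley] sE] := sin_mvt y0.
have cc : cos y <= cos c.
  rewrite leNgt ltr_cos ?in_itv/= -?leNgt ?c0 ?y0//=; first by move: cley ypi pi0; lra.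
  by move: ypi pi0; lra.
rewrite xE sin_mulr2n -mulr_natl sE.
have : y * (cos y * cos y) <= y * (cos c * cos y) by rewrite ler_wpM2l// ler_wpM2r.
have : y <= y * (2 * (cos y * cos y)) by rewrite ler_peMr.
move: (cos y) (cos c) => u v; lra.
Qed.

Lemma nrm_le x : nrm x <= `|x|.
Proof.
wlog x0 : x / 0 <= x.
  move=> h; have [x0|x0] := lerP 0 x; first exact: h.
  by rewrite -nrmN -normrN; apply: h; rewrite oppr_ge0 ltW.
rewrite nrmE [leRHS]ger0_norm//.
have x20 : 0 <= x / 2 by rewrite divr_ge0.
have [c _ ->] := sin_mvt x20; rewrite normrM (ger0_norm x20) mulrA [2 * _]mulrC divfK//.
by rewrite ler_piMr// cos_max.
Qed.

Lemma nrm_ge x : `|x| <= pi -> `|x| / 2 <= nrm x.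
Proof.
wlog x0 : x / 0 <= x.
  move=> h; have [x0|x0] := lerP 0 x; first exact: h.
  by rewrite -nrmN -normrN; apply: h; rewrite oppr_ge0 ltW.
rewrite ger0_norm// nrmE => xpi.
have h : x / 2 / 2 <= sin (x / 2).
  by apply: sin_ge_half; rewrite divr_ge0//= ler_wpM2r ?invr_ge0.
have := ler_norm (sin (x / 2)); move: h; lra.
Qed.

Lemma nrmD x y : nrm (x + y) <= nrm x + nrm y.
Proof.
rewrite /nrm expiD.
have -> : expi x * expi y - 1 = expi x * (expi y - 1) + (expi x - 1) by ring.
by rewrite (le_trans (ler_cmodD _ _))// cmodM cmod_expi mul1r addrC.
Qed.

Lemma round_2pi x : exists z : int, - pi <= x - z%:~R * (2 * pi) < pi.
Proof.
have pi0 := pi_gt0 R; have pi20 : 0 < 2 * pi :> R by rewrite mulr_gt0.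
pose z := Num.floor ((x + pi) / (2 * pi)); exists z.
have h1 : z%:~R <= (x + pi) / (2 * pi) by apply: ge_floor.
have h2 : (x + pi) / (2 * pi) < z%:~R + 1.
  by have := floorD1_gt ((x + pi) / (2 * pi)); rewrite intrD.
rewrite ler_pdivlMr// in h1; rewrite ltr_pdivrMr// in h2.
by apply/andP; split; move: h1 h2; rewrite mulrDl; lra.
Qed.

End CircleNorm.

#[local] Arguments conjc : simpl never.

(** * Dirichlet kernels, a stable majorant and the dual form *)

Section LargeSieve.
Variable R : realType.

Definition dirk L (th : R) : R := cmod (\sum_(l < L) expi (l%:R * th)).

Lemma dirk_ge0 L th : 0 <= dirk L th.
Proof. exact: cmod_ge0. Qed.

Lemma dirk_le L th : dirk L th <= L%:R.
Proof.
rewrite (le_trans (ler_cmod_sum _ _ _))//.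
by under eq_bigr do rewrite cmod_expi; rewrite sumr_const card_ord.
Qed.

Lemma dirk_nrm L th : dirk L th * nrm th <= 2.
Proof.
rewrite /dirk /nrm -cmodM; under eq_bigr do rewrite expiMn.
rewrite mulrC -subrX1 (le_trans (ler_cmodD _ _))// cmodN cmod1 cmodX cmod_expi expr1n.
by rewrite -mulr2n.
Qed.

(** A majorant, up to a factor 8, of the squared Dirichlet kernel of length 2L. Unlike that kernel
    it changes only by a bounded factor when the argument moves by O(1/L). *)
Definition fej L (th : R) : R := L%:R ^+ 2 / (1 + L%:R ^+ 2 * nrm th ^+ 2).

Lemma fej_den_gt0 L th : 0 < 1 + L%:R ^+ 2 * nrm th ^+ 2 :> R.
Proof. by rewrite ltr_pwDl// mulr_ge0 ?exprn_ge0// nrm_ge0. Qed.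

Lemma fej_ge0 L th : 0 <= fej L th.
Proof. by rewrite divr_ge0 ?exprn_ge0// ltW// fej_den_gt0. Qed.

Lemma fejN L th : fej L (- th) = fej L th.
Proof. by rewrite /fej nrmN. Qed.

Lemma dirk_fej L th : dirk (2 * L) th ^+ 2 <= 8 * fej L th.
Proof.
rewrite mulrA ler_pdivlMr ?fej_den_gt0// mulrDr mulr1 mulrCA -exprMn.
have h1 : dirk (2 * L) th ^+ 2 <= (2 * L%:R) ^+ 2.
  by rewrite lerXn2r ?nnegrE ?dirk_ge0 ?mulr_ge0// (le_trans (dirk_le _ _))// natrM.
have h2 : (dirk (2 * L) th * nrm th) ^+ 2 <= 2 ^+ 2.
  by rewrite lerXn2r ?nnegrE ?mulr_ge0 ?dirk_ge0 ?nrm_ge0// dirk_nrm.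
have h3 : L%:R ^+ 2 * (dirk (2 * L) th * nrm th) ^+ 2 <= L%:R ^+ 2 * 2 ^+ 2.
  by rewrite ler_wpM2l ?exprn_ge0.
move: h1 h3; rewrite exprMn; lra.
Qed.

Lemma fej_perturb L (c th de : R) : L%:R * `|de| <= c -> 0 <= c ->
  fej L (th + de) <= 2 * (1 + c ^+ 2) * fej L th.
Proof.
move=> hde c0; rewrite /fej ler_pdivrMr ?fej_den_gt0//.
have -> (x y z w : R) : x * (y / z) * w = x * y * w / z by ring.
rewrite ler_pdivlMr ?fej_den_gt0//.
have h1 : nrm th <= nrm (th + de) + `|de|.
  have := nrmD (th + de) (- de); rewrite addrK nrmN => /le_trans; apply.
  by rewrite lerD2l nrm_le.
have h2 : L%:R * nrm th <= L%:R * nrm (th + de) + c.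
  by apply: (le_trans (ler_wpM2l (ler0n _ _) h1)); rewrite mulrDr lerD2l.
have L0 : 0 <= (L%:R : R) by [].
have n0 := nrm_ge0 th; have n1 := nrm_ge0 (th + de).
have h3 : (L%:R * nrm th) ^+ 2 <= 2 * (L%:R * nrm (th + de)) ^+ 2 + 2 * c ^+ 2.
  apply: (@le_trans _ _ ((L%:R * nrm (th + de) + c) ^+ 2)).
    by rewrite lerXn2r ?nnegrE ?addr_ge0 ?mulr_ge0.
  have : 0 <= (L%:R * nrm (th + de) - c) ^+ 2 by exact: sqr_ge0.
  move: (L%:R * nrm (th + de)) => u; rewrite !expr2; nra.
rewrite -!exprMn [leRHS]mulrAC [leLHS]mulrC ler_wpM2r ?exprn_ge0//.
have c2 : 0 <= c ^+ 2 by exact: sqr_ge0.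
have : 0 <= (L%:R * nrm (th + de)) ^+ 2 by exact: sqr_ge0.
move: h3; move: ((L%:R * nrm th) ^+ 2) ((L%:R * nrm (th + de)) ^+ 2) (c ^+ 2) c2 => u v w; nra.
Qed.

Lemma sum_shift_le (f : nat -> R) a n m : (forall i, 0 <= f i) -> (a + n <= m)%N ->
  \sum_(v < n) f (a + v)%N <= \sum_(l < m) f l.
Proof.
move=> f0 le; have -> : m = (a + (n + (m - (a + n))))%N by rewrite addnA subnKC.
rewrite big_split_ord big_split_ord/= addrCA lerDl addr_ge0// sumr_ge0//.
Qed.

(** Every v < L is a difference l - l' with l, l' < 2L in at least L ways. Summing over such pairs
    is what makes the kernel in [large_sieve2] a square. *)
Lemma box_sum_le L (G : nat -> nat -> R) (F : nat -> R) :
  (forall l l', 0 <= G l l') -> (forall l v, G (l + v)%N l = F v) ->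
  L%:R * \sum_(v < L) F v <= \sum_(l < 2 * L) \sum_(l' < 2 * L) G l l'.
Proof.
move=> G0 GF; rewrite exchange_big/=.
apply: (@le_trans _ _ (\sum_(l' < L) \sum_(l < 2 * L) G l l')).
  have -> : L%:R * \sum_(v < L) F v = \sum_(l' < L) \sum_(v < L) G (l' + v)%N l'.
    under [RHS]eq_bigr do under eq_bigr do rewrite GF.
    by rewrite sumr_const card_ord mulr_natl.
  apply: ler_sum => l' _; apply: (@sum_shift_le (fun l => G l l')) => //.
  by rewrite mul2n -addnn leq_add2r ltnW.
apply: (@sum_shift_le (fun l' => \sum_(l < 2 * L) G l l') 0) => [i|]; first exact: sumr_ge0.
by rewrite add0n leq_pmull.
Qed.

(** After passing to differences of frequencies, the coefficient of [eta m] times the conjugate of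
    [eta n] is a product of two squared moduli, so the unknown [eta] can be bounded away. *)
Lemma large_sieve2 (I : finType) (A B : I -> R) (eta : I -> R[i]) L1 L2 :
  (forall n, cmod (eta n) <= 1) ->
  L1%:R * L2%:R * \sum_(v1 < L1) \sum_(v2 < L2)
    cmod (\sum_n eta n * expi (v1%:R * A n + v2%:R * B n)) ^+ 2 <=
  \sum_m \sum_n dirk (2 * L1) (A m - A n) ^+ 2 * dirk (2 * L2) (B m - B n) ^+ 2.
Proof.
move=> eta1.
pose g (u v : R) : R := cmod (\sum_n eta n * expi (u * A n + v * B n)) ^+ 2.
have g0 u v : 0 <= g u v by apply: sqr_ge0.
have s1 (v2 : R) : L1%:R * \sum_(v1 < L1) g v1%:R v2 <=
    \sum_(l < 2 * L1) \sum_(l' < 2 * L1) g (l%:R - l'%:R) v2.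
  apply: (@box_sum_le L1 (fun l l' => g (l%:R - l'%:R) v2) (fun v => g v%:R v2)) => //.
  by move=> l v; rewrite natrD addrC addKr.
have s2 (u : R) : L2%:R * \sum_(v2 < L2) g u v2%:R <=
    \sum_(k < 2 * L2) \sum_(k' < 2 * L2) g u (k%:R - k'%:R).
  apply: (@box_sum_le L2 (fun l l' => g u (l%:R - l'%:R)) (fun v => g u v%:R)) => //.
  by move=> l v; rewrite natrD addrC addKr.
apply: (@le_trans _ _ (\sum_(l < 2 * L1) \sum_(l' < 2 * L1) \sum_(k < 2 * L2) \sum_(k' < 2 * L2)
    g (l%:R - l'%:R) (k%:R - k'%:R))).
  apply: (@le_trans _ _ (L2%:R * \sum_(v2 < L2) (L1%:R * \sum_(v1 < L1) g v1%:R v2%:R))).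
    rewrite exchange_big/= -mulr_sumr le_eqVlt; apply/orP; left; apply/eqP; rewrite /g; ring.
  apply: (@le_trans _ _ (L2%:R * \sum_(v2 < L2) \sum_(l < 2 * L1) \sum_(l' < 2 * L1) g (l%:R - l'%:R) v2%:R)).
    by rewrite ler_wpM2l//; apply: ler_sum => v2 _; exact: s1.
  rewrite exchange_big/=; under eq_bigr do rewrite exchange_big/=.
  rewrite mulr_sumr; apply: ler_sum => l _; rewrite mulr_sumr; apply: ler_sum => l' _.
  exact: s2.
set T := (X in X <= _).
have T0 : 0 <= T by do 4![apply: sumr_ge0 => ? _]; exact: g0.
have -> : T = cmod (T%:C) by rewrite cmodC ger0_norm.
have gE u v : (g u v)%:C = \sum_m \sum_n (eta m * (eta n)^*%C) *
    (expi (u * (A m - A n)) * expi (v * (B m - B n))).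
  rewrite /g -mulJ_cmod rmorph_sum/= mulr_suml; apply: eq_bigr => m _.
  rewrite mulr_sumr; apply: eq_bigr => n _; rewrite rmorphM/= mulrACA; congr (_ * _).
  rewrite -expiN -!expiD; congr expi; ring.
pose S L th : R[i] := \sum_(l < L) expi (l%:R * th).
have SS L th : S L th * (S L th)^*%C = \sum_(l < L) \sum_(l' < L) expi ((l%:R - l'%:R) * th).
  rewrite /S rmorph_sum/= mulr_suml; apply: eq_bigr => l _.
  rewrite mulr_sumr; apply: eq_bigr => l' _.
  by rewrite -expiN -expiD mulrBl.
pose c (u : I * I) := eta u.1 * (eta u.2)^*%C.
pose E1 (u : I * I) (l l' : nat) : R[i] := expi ((l%:R - l'%:R) * (A u.1 - A u.2)).
pose E2 (u : I * I) (l l' : nat) : R[i] := expi ((l%:R - l'%:R) * (B u.1 - B u.2)).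
have -> : T%:C = \sum_m \sum_n (eta m * (eta n)^*%C) *
  ((S (2 * L1)%N (A m - A n) * (S (2 * L1)%N (A m - A n))^*%C) *
   (S (2 * L2)%N (B m - B n) * (S (2 * L2)%N (B m - B n))^*%C)).
  rewrite pair_big/=.
  transitivity (\sum_(l < 2 * L1) \sum_(l' < 2 * L1) \sum_(k < 2 * L2) \sum_(k' < 2 * L2)
    \sum_u c u * (E1 u l l' * E2 u k k')).
    rewrite /T rmorph_sum; apply: eq_bigr => l _; rewrite rmorph_sum; apply: eq_bigr => l' _.
    rewrite rmorph_sum; apply: eq_bigr => k _; rewrite rmorph_sum; apply: eq_bigr => k' _.
    by rewrite [LHS]gE pair_big/=.
  transitivity (\sum_(l < 2 * L1) \sum_(l' < 2 * L1)
    \sum_u c u * (E1 u l l' * \sum_(k < 2 * L2) \sum_(k' < 2 * L2) E2 u k k')).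
    apply: eq_bigr => l _; apply: eq_bigr => l' _.
    under eq_bigr do rewrite exchange_big/=. rewrite exchange_big/=; apply: eq_bigr => u _.
    rewrite !mulr_sumr; apply: eq_bigr => k _; rewrite !mulr_sumr; apply: eq_bigr => k' _.
    by [].
  under [LHS]eq_bigr do rewrite exchange_big/=. rewrite [LHS]exchange_big/=; apply: eq_bigr => u _.
  rewrite !SS mulr_suml mulr_sumr; apply: eq_bigr => l _.
  by rewrite mulr_suml mulr_sumr.
rewrite (le_trans (ler_cmod_sum _ _ _))//; apply: ler_sum => m _.
rewrite (le_trans (ler_cmod_sum _ _ _))//; apply: ler_sum => n _.
rewrite !cmodM !cmodJ -!/(dirk _ _) -!expr2.
have e1 : cmod (eta m) * cmod (eta n) <= 1 by rewrite mulr_ile1 ?cmod_ge0.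
by apply: ler_piMl => //; rewrite mulr_ge0 ?sqr_ge0.
Qed.

End LargeSieve.

(** * Counting spaced points on the circle *)

Section Counting.
Variable R : realType.

Lemma card_fibers_le (I : finType) (P : pred I) (v : I -> nat) (Q : nat) (M : R) : 0 <= M ->
  (forall i, P i -> (v i < Q)%N) ->
  (forall q, (#|[pred i | P i && (v i == q)]|)%:R <= M) ->
  (#|P|)%:R <= Q%:R * M.
Proof.
move=> M0 vQ hM.
have -> : (#|P|)%:R = \sum_(q < Q) (#|[pred i | P i && (v i == q)]|)%:R :> R.
  rewrite -natr_sum; congr (_%:R); rewrite -sum1_card.
  under [RHS]eq_bigr do rewrite -sum1_card big_mkcond/=.
  rewrite exchange_big/= big_mkcond/=; apply: eq_bigr => i _.
  rewrite unfold_in; case: ifP => Pi; last first.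
    by rewrite big1// => q _; rewrite !inE Pi.
  rewrite (bigD1 (Ordinal (vQ i Pi)))//= big1 ?addn0.
    by rewrite !inE Pi eqxx.
  by move=> q; rewrite -val_eqE /= !inE Pi /= eq_sym => /negbTE ->.
apply: (@le_trans _ _ (\sum_(q < Q) M)); first by apply: ler_sum => q _; exact: hM.
by rewrite sumr_const card_ord mulr_natl.
Qed.

Lemma card_window_le P (A : pred 'I_P) D :
  (forall i j : 'I_P, A i -> A j -> (i <= j)%N -> (j - i <= D)%N) -> (#|A| <= D.+1)%N.
Proof.
move=> hA; have [->//|/card_gt0P [i0 Ai0]] := posnP #|A|.
have [i Ai imin] := @arg_minnP _ i0 A (fun i => nat_of_ord i) Ai0.
pose f (j : 'I_P) : 'I_D.+1 := inord (j - i).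
have fin : {in A &, injective f}.
  move=> j j' Aj Aj' /(congr1 (fun u => nat_of_ord u)); rewrite /f.
  have ij := imin j Aj; have ij' := imin j' Aj'.
  rewrite !inordK ?ltnS ?hA//  => e; apply: val_inj => /=.
  by rewrite -(subnK ij) -(subnK ij') e.
rewrite -(card_in_imset fin) (leq_trans (max_card _))// card_ord//.
Qed.

(** The points are sorted by the multiple of 2 pi nearest to [x i - psi]: at most Rg + 2 multiples
    occur, and for each of them the points counted lie in an interval of length 4r. *)
Lemma spaced_count P (x : nat -> R) (g Rg r psi : R) :
  0 < g -> 0 <= Rg -> 0 <= r ->
  (forall i j, (i <= j)%N -> (j < P)%N -> (j - i)%N%:R * g <= x j - x i) ->
  (forall i, (i < P)%N -> x i - x 0 <= Rg) ->
  (#|[pred i : 'I_P | nrm (x i - psi) <= r]|)%:R <= (Rg + 2) * (4 * r / g + 1).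
Proof.
move=> g0 Rg0 r0 sp rg.
have pi0 := pi_gt0 R; have pi2 := pi_ge2 R.
have /boolp.choice [z hz] : forall i : nat, exists z : int, - pi <= x i - psi - z%:~R * (2 * pi) < pi.
  by move=> i; exact: round_2pi.
pose y i : R := x i - psi - (z i)%:~R * (2 * pi).
have yb i : - pi <= y i < pi := hz i.
have ny i : nrm (x i - psi) = nrm (y i).
  by rewrite /y -mulNr -mulrNz nrm_period.
have yr i : nrm (x i - psi) <= r -> `|y i| <= 2 * r.
  rewrite ny => h; have /andP[h1 h2] := yb i.
  have : `|y i| <= pi by rewrite ler_norml h1 ltW.
  by move=> /nrm_ge; move: h; lra.
have q0 : 0 <= Rg / (2 * pi) + 1 by rewrite addr_ge0// divr_ge0// mulr_ge0// ltW.
pose W := Num.truncn (Rg / (2 * pi) + 1).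
pose v (i : 'I_P) := `|z i - z 0%N|%N.
have zE (i : nat) : (z i - z 0%N)%:~R * (2 * pi) = x i - x 0 - (y i - y 0).
  by rewrite /y intrB; ring.
have zpos (i : nat) : (i < P)%N -> 0 <= z i - z 0%N.
  move=> iP; rewrite -[0]/(0%:Z) -ltzD1 -(ltr_int R) intrD.
  have := sp 0 i (leq0n i) iP; rewrite subn0 => h.
  have h0 : 0 <= x i - x 0 by apply: le_trans h; rewrite mulr_ge0// ltW.
  have /andP[a1 a2] := yb i; have /andP[b1 b2] := yb 0%N; have := zE i.
  move: h0 a1 a2 b1 b2; set u := (z i - z 0%N)%:~R => h0 a1 a2 b1 b2 e.
  rewrite -(ltr_pM2r (_ : 0 < 2 * pi)) ?mulr_gt0//; move: e; lra.
have vW (i : 'I_P) : (v i < W.+1)%N.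
  rewrite ltnS /v /W truncn_ge_nat//.
  have -> : (`|z i - z 0%N|%N)%:R = (z i - z 0%N)%:~R :> R.
    by rewrite -[in RHS](gez0_abs (zpos i (ltn_ord i))).
  have /andP[a1 a2] := yb i; have /andP[b1 b2] := yb 0%N; have := zE i.
  have := rg i (ltn_ord i).
  have p20 : 0 < 2 * pi :> R by rewrite mulr_gt0.
  have e3 : (Rg / (2 * pi) + 1) * (2 * pi) = Rg + 2 * pi by rewrite mulrDl mul1r divfK// gt_eqF.
  by move=> g1 g2; rewrite -(ler_pM2r p20) e3; move: g1 g2; lra.
have D0 : 0 <= 4 * r / g by rewrite divr_ge0 ?mulr_ge0// ltW.
pose D := Num.truncn (4 * r / g).
have M0 : 0 <= 4 * r / g + 1 by rewrite addr_ge0.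
apply: (@le_trans _ _ (W.+1%:R * (4 * r / g + 1))); last first.
  rewrite ler_wpM2r// -natr1.
  have : W%:R <= Rg / (2 * pi) + 1 by rewrite truncn_le.
  have : Rg / (2 * pi) <= Rg by rewrite ler_pdivrMr ?mulr_gt0// ler_peMr//; lra.
  lra.
apply: (card_fibers_le (v := v)) => // q.
apply: (@le_trans _ _ D.+1%:R); last by rewrite -natr1 lerD2r truncn_le.
rewrite ler_nat; apply: card_window_le => i j /andP[Pi /eqP vi] /andP[Pj /eqP vj] ij.
rewrite truncn_ge_nat// ler_pdivlMr//.
apply: (le_trans (sp _ _ ij (ltn_ord j))).
have zz : z i = z j.
  apply: (addIr (- z 0%N)); rewrite -(gez0_abs (zpos i (ltn_ord i))) -(gez0_abs (zpos j (ltn_ord j))).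
  by rewrite -/(v i) -/(v j) vi vj.
have -> : x j - x i = y j - y i by rewrite /y zz; ring.
have := yr _ Pi; have := yr _ Pj; rewrite !ler_norml => /andP[_ h1] /andP[h2 _].
lra.
Qed.

(* Points at distance about [q / L] from [phi] number at most [2 M], and the kernel
   there is at most [16 L^2 / ((q+1)(q+2))]. *)
Lemma fej_sum (I : finType) (th : I -> R) phi L (M : R) : (0 < L)%N ->
  (forall psi, (#|[pred i | nrm (th i - psi) <= L%:R^-1]|)%:R <= M) ->
  \sum_i fej L (th i - phi) <= 32 * M * L%:R ^+ 2.
Proof.
move=> L0 hM.
have M0 : 0 <= M by apply: le_trans (hM 0).
have LR : 0 < (L%:R : R) by rewrite ltr0n.
have pi0 := pi_gt0 R.
have /boolp.choice [z hz] : forall i : I, exists z : int,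
    - pi <= th i - phi - z%:~R * (2 * pi) < pi.
  by move=> i; exact: round_2pi.
pose y i : R := th i - phi - (z i)%:~R * (2 * pi).
have ny i : nrm (th i - phi) = nrm (y i).
  by rewrite /y -mulNr -mulrNz nrm_period.
have yge i : `|y i| / 2 <= nrm (th i - phi).
  rewrite ny; have /andP[h1 h2] := hz i; apply: nrm_ge.
  by rewrite ler_norml h1 ltW.
have Ly0 i : 0 <= L%:R * `|y i| by rewrite mulr_ge0// ltW.
pose q i := Num.truncn (L%:R * `|y i|).
pose Q := (\max_i q i).+1.
have qQ i : (q i < Q)%N by rewrite ltnS leq_bigmax.
(* Written as a difference so that the sum over distances telescopes. *)
pose w (n : nat) : R := 16 * L%:R ^+ 2 * (n.+1%:R^-1 - n.+2%:R^-1).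
have w0 n : 0 <= w n.
  by rewrite mulr_ge0 ?mulr_ge0 ?exprn_ge0// subr_ge0 lef_pV2 ?posrE ?ltr0n// ler_nat.
have fw i : fej L (th i - phi) <= w (q i).
  have qle : (q i)%:R <= L%:R * `|y i| by rewrite truncn_le.
  have h1 : (q i)%:R / 2 <= L%:R * nrm (th i - phi).
    have := ler_wpM2l (ltW LR) (yge i); move: qle; lra.
  have h2 : ((q i)%:R / 2) ^+ 2 <= (L%:R * nrm (th i - phi)) ^+ 2.
    by rewrite lerXn2r ?nnegrE ?mulr_ge0 ?nrm_ge0// ltW.
  have -> : w (q i) = L%:R ^+ 2 * (16 * ((q i).+1%:R^-1 - (q i).+2%:R^-1)) by rewrite /w; ring.
  rewrite /fej -exprMn ler_wpM2l ?exprn_ge0 ?(ltW LR)//.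
  move: h2; move: ((_ * nrm _) ^+ 2) => X h2.
  have X0 : 0 <= X by apply: le_trans h2; exact: sqr_ge0.
  rewrite -[(q i).+2%:R]natr1 -[(q i).+1%:R]natr1.
  have n0 : 0 <= ((q i)%:R : R) by [].
  move: ((q i)%:R : R) n0 h2 => n n0 h2.
  have -> : 16 * ((n + 1)^-1 - (n + 1 + 1)^-1) = 16 / ((n + 1) * (n + 1 + 1)).
    by field; apply/andP; split; apply: lt0r_neq0; lra.
  rewrite ler_pdivlMr; last by nra.
  rewrite mulrC ler_pdivrMr; last by lra.
  nra.
apply: (@le_trans _ _ (\sum_i w (q i))); first by apply: ler_sum => i _; exact: fw.
have -> : \sum_i w (q i) = \sum_(n < Q) (#|[pred i | q i == n]|)%:R * w n.
  transitivity (\sum_(n < Q) \sum_(i | q i == n) w (q i)).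
    rewrite (exchange_big_dep predT)//=; apply: eq_bigr => i _.
    by rewrite (big_pred1 (Ordinal (qQ i)))//= => n; rewrite -val_eqE/= eq_sym.
  apply: eq_bigr => n _; rewrite (eq_bigr (fun=> w n)); last by move=> i /eqP ->.
  by rewrite sumr_const mulr_natl.
have fib n : (#|[pred i | q i == n]|)%:R <= 2 * M.
  pose ps (s : R) := phi + s * (n%:R / L%:R).
  have sub : [pred i | q i == n] \subset
      [predU [pred i | nrm (th i - ps 1) <= L%:R^-1] & [pred i | nrm (th i - ps (-1)) <= L%:R^-1]].
    apply/fintype.subsetP => i; rewrite !inE => /eqP qi.
    have tn : (n%:R <= L%:R * `|y i| < n.+1%:R)%R by rewrite -qi; exact: truncn_itv.
    have /andP[t1 t2] := tn; rewrite -natr1 in t2.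
    have key (s : R) : y i = s * `|y i| -> `|s| = 1 -> nrm (th i - ps s) <= L%:R^-1.
      move=> ys s1; have -> : th i - ps s = (y i - s * (n%:R / L%:R)) + (z i)%:~R * (2 * pi).
        by rewrite /ps /y; ring.
      rewrite nrm_period (le_trans (nrm_le _))// {1}ys -mulrBr normrM s1 mul1r.
      rewrite -(ler_pM2l LR) divff ?gt_eqF// -{1}[L%:R](ger0_norm (ltW LR)) -normrM mulrBr.
      rewrite [X in _ - X]mulrC divfK ?gt_eqF// ler_norml; lra.
    apply/orP; have [y0|y0] := lerP 0 (y i).
      by left; apply: key; rewrite ?normr1// ger0_norm// mul1r.
    by right; apply: key; rewrite ?normrN1// ltr0_norm// mulrNN mul1r.
  apply: (@le_trans _ _ (#|[pred i | (nrm (th i - ps 1) <= L%:R^-1)%R]| +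
       #|[pred i | (nrm (th i - ps (-1)) <= L%:R^-1)%R]|)%N%:R).
    rewrite ler_nat (leq_trans (subset_leq_card sub))//.
    by rewrite -cardUI leq_addr.
  by rewrite natrD mulr2n mulrDl !mul1r lerD.
apply: (@le_trans _ _ (\sum_(n < Q) 2 * M * w n)).
  by apply: ler_sum => n _; rewrite ler_wpM2r.
rewrite -mulr_sumr /w -mulr_sumr.
have -> : \sum_(n < Q) ((n.+1%:R)^-1 - (n.+2%:R)^-1) = 1 - Q.+1%:R^-1 :> R.
  elim: (Q) => [|m IH]; first by rewrite big_ord0 invr1 subrr.
  by rewrite big_ord_recr/= IH; ring.
have Q0 : 0 <= (Q.+1%:R^-1 : R) by rewrite invr_ge0.
have ML : 0 <= M * L%:R ^+ 2 by rewrite mulr_ge0 ?exprn_ge0.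
have -> : 2 * M * (16 * L%:R ^+ 2 * (1 - Q.+1%:R^-1)) = 32 * M * L%:R ^+ 2 - 32 * (M * L%:R ^+ 2 * Q.+1%:R^-1).
  by ring.
by rewrite gerBl !mulr_ge0.
Qed.

End Counting.

(** * Taylor expansion of real powers *)

Section BinomialSeries.
Variable R : realType.
Implicit Types (al : R).

Definition gbinom al j : R := (\prod_(i < j) (al - i%:R)) / j`!%:R.

Lemma gbinom0 al : gbinom al 0 = 1.
Proof. by rewrite /gbinom big_ord0 divr1. Qed.

Lemma gbinomS al j : gbinom al j.+1 = gbinom al j * (al - j%:R) / j.+1%:R.
Proof.
rewrite /gbinom big_ord_recr/= factS natrM; field.
by rewrite nat1r !pnatr_eq0 -!lt0n ?fact_gt0.
Qed.

Lemma gbinom_pred al j : j.+1%:R * gbinom al j.+1 = al * gbinom (al - 1) j.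
Proof.
rewrite /gbinom big_ord_recl/= subr0 factS natrM.
have -> : \prod_(i < j) (al - (bump 0 i)%:R) = \prod_(i < j) (al - 1 - i%:R).
  by apply: eq_bigr => i _; rewrite /bump/= add1n -natr1; ring.
field; by rewrite nat1r !pnatr_eq0 -!lt0n ?fact_gt0.
Qed.

Lemma gbinom_neq0 al j : (forall i, (i < j)%N -> al != i%:R) -> gbinom al j != 0.
Proof.
move=> h; rewrite mulf_neq0 ?invr_eq0 ?pnatr_eq0 -?lt0n ?fact_gt0//.
by apply/prodf_neq0 => i _; rewrite subr_eq0 h.
Qed.

Definition taylor_poly al k : {poly R} := \poly_(j < k) gbinom al j.

Definition taylor_rem al k (u : R) : R := (1 + u) `^ al - (taylor_poly al k).[u].

Lemma deriv_taylor_poly al k : (taylor_poly al k.+1)^`() = al *: taylor_poly (al - 1) k.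
Proof.
apply/polyP => j; rewrite coef_deriv coefZ !coef_poly ltnS.
case: ifP => _; last by rewrite mul0rn mulr0.
by rewrite -mulr_natl gbinom_pred.
Qed.

Lemma is_derive_taylor_rem al k (u : R) : 0 <= u ->
  is_derive u 1 (taylor_rem al k.+1) (al * taylor_rem (al - 1) k u).
Proof.
move=> u0; have u1 : 0 < 1 + u by rewrite ltr_pwDl.
have d1 : is_derive u 1 (fun u : R => 1 + u) 1.
  have := is_deriveD (is_derive_cst (1 : R) u 1) (is_derive_id u (1 : R)).
  by rewrite add0r.
have d2 := is_derive1_powR al u1.
have d3 := @is_derive1_comp R _ _ u _ _ d2 d1.
have d4 := is_derive_poly (taylor_poly al k.+1) u.
have := is_deriveB d3 d4; rewrite deriv_taylor_poly hornerZ mulr1 -mulrBr.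
by [].
Qed.

Lemma taylor_rem0 al k : taylor_rem al k.+1 0 = 0.
Proof. by rewrite /taylor_rem addr0 powR1 horner_coef0 coef_poly/= gbinom0 subrr. Qed.

Lemma taylor_rem_mvt al k (u v : R) : 0 <= u <= v ->
  exists2 c, u <= c <= v & taylor_rem al k.+1 v - taylor_rem al k.+1 u =
    al * taylor_rem (al - 1) k c * (v - u).
Proof.
move=> /andP[u0 uv].
have [c cin e] : exists2 c, c \in `[u, v]%R & taylor_rem al k.+1 v - taylor_rem al k.+1 u =
    al * taylor_rem (al - 1) k c * (v - u).
  apply: MVT_segment => //.
    move=> x; rewrite in_itv/= => /andP[ux _]; apply: is_derive_taylor_rem.
    by rewrite (le_trans u0)// ltW.
  apply: derivable_within_continuous => x; rewrite in_itv/= => /andP[ux _].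
  have [] := @is_derive_taylor_rem al k x (le_trans u0 ux); by [].
by exists c => //; move: cin; rewrite in_itv.
Qed.

(** The derivative of the remainder of order k+1 for [al] is [al] times the remainder of order k for
    [al - 1], so the mean value theorem gives an induction on the order. *)
Lemma taylor_rem_bound al k : exists2 C : R, 0 <= C &
  forall u, 0 <= u <= 1 -> `|taylor_rem al k u| <= C * u ^+ k.
Proof.
elim: k al => [|k IH] al.
  exists (2 `^ `|al|); first exact: powR_ge0.
  move=> u /andP[u0 u1]; rewrite expr0 mulr1 /taylor_rem.
  have -> : taylor_poly al 0 = 0 by apply/polyP => j; rewrite coef_poly coef0.
  rewrite horner0 subr0 ger0_norm ?powR_ge0//.
  have h1 : 1 <= 1 + u by rewrite lerDl.
  apply: (le_trans (ler_powR h1 (ler_norm al))).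
  by rewrite ge0_ler_powR ?nnegrE//; lra.
have [C C0 hC] := IH (al - 1); exists (`|al| * C); first by rewrite mulr_ge0.
move=> u /andP[u0 u1].
have [|c /andP[c0 cu]] := @taylor_rem_mvt al k 0 u; first by rewrite lexx.
rewrite taylor_rem0 !subr0 => ->; rewrite !normrM (ger0_norm u0) exprSr !mulrA.
rewrite ler_wpM2r// -mulrA ler_wpM2l// (le_trans (hC c _))//; first by rewrite c0 (le_trans cu).
by rewrite ler_wpM2l// lerXn2r// nnegrE.
Qed.

(** Removing the remainder by Abel summation requires its increments, not only its size. *)
Lemma taylor_rem_lip al k : exists2 C : R, 0 <= C &
  forall u v, 0 <= u <= v -> v <= 1 ->
    `|taylor_rem al k.+1 v - taylor_rem al k.+1 u| <= C * v ^+ k * (v - u).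
Proof.
have [C C0 hC] := taylor_rem_bound (al - 1) k.
exists (`|al| * C); first by rewrite mulr_ge0.
move=> u v uv v1; have [c /andP[uc cv] ->] := taylor_rem_mvt al k uv.
have /andP[u0 u'v] := uv; have c0 : 0 <= c by apply: le_trans uc.
rewrite !normrM (ger0_norm (_ : 0 <= v - u)) ?subr_ge0//.
rewrite ler_wpM2r ?subr_ge0// -mulrA ler_wpM2l// (le_trans (hC c _))//.
  by rewrite c0 (le_trans cv).
by rewrite ler_wpM2l// lerXn2r// nnegrE (le_trans c0).
Qed.

Lemma powR_mvt (be a b : R) : 0 < a <= b ->
  exists2 c, a <= c <= b & b `^ be - a `^ be = be * c `^ (be - 1) * (b - a).
Proof.
move=> /andP[a0 ab].
have [c cin e] : exists2 c, c \in `[a, b]%R & b `^ be - a `^ be = be * c `^ (be - 1) * (b - a).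
  apply: (@MVT_segment R (fun x => x `^ be) (fun x => be * x `^ (be - 1))) => //.
    move=> x; rewrite in_itv/= => /andP[ax _]; apply: is_derive1_powR.
    exact: lt_trans ax.
  apply: derivable_within_continuous => x; rewrite in_itv/= => /andP[ax _].
  by have [] := @is_derive1_powR R be x (lt_le_trans a0 ax).
by exists c => //; move: cin; rewrite in_itv.
Qed.

End BinomialSeries.

#[local] Arguments conjc : simpl never.

(** * Moments of short exponential sums *)

Section MomentBound.
Variable R : realType.

Lemma psum_le s H (f : {ffun 'I_s -> 'I_H}) j : (psum f j <= s * H ^ j)%N.
Proof.
apply: (@leq_trans (\sum_(i < s) H ^ j)%N); last by rewrite sum_nat_const card_ord.
apply: leq_sum => i _; case: j => // j; rewrite leq_exp2r//; exact: ltnW.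
Qed.

Lemma exists_unimodular (w : R[i]) : exists2 eta : R[i], cmod eta <= 1 & (cmod w)%:C = eta * w.
Proof.
have [->|w0] := eqVneq w 0.
  by exists 0; rewrite ?cmod0 ?mulr0//.
have c0 : cmod w != 0.
  by apply: contra w0 => /eqP e; apply/eqP/ComplexField.Normc.eq0_normc.
exists ((cmod w)^-1%:C * w^*%C).
  by rewrite cmodM cmodJ cmodC ger0_norm ?invr_ge0 ?cmod_ge0// mulVf.
rewrite -mulrA [_^*%C * _]mulrC mulJ_cmod -rmorphM/= expr2 mulrA mulVf// mul1r//.
Qed.

(** The s-th powers are expanded over tuples, grouped by their vectors of power sums. After
    Cauchy-Schwarz over these vectors the squared multiplicities count solutions of the system. In
    the other factor the [m] lower coordinates are summed trivially over their box: their phases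
    have modulus 1 and join [eta], which is why [hW] is required for all bounded [eta]. *)
Lemma moment_bound (I : finType) m s H (a : I -> nat -> R) (W : R) :
  (forall eta : I -> R[i], (forall n, cmod (eta n) <= 1) ->
    \sum_(v1 < (s * H ^ m.+2).+1) \sum_(v2 < (s * H ^ m.+1).+1)
       cmod (\sum_n eta n * expi (v1%:R * a n m.+1 + v2%:R * a n m)) ^+ 2 <= W) ->
  \sum_n cmod (\sum_(h < H) expi (\sum_(j < m.+2) a n j * (h ^ j.+1)%N%:R)) ^+ s <=
  Num.sqrt (#|vinogradov m.+2 s H|)%:R *
  Num.sqrt ((\prod_(j < m) (s * H ^ j.+1).+1)%N%:R * W).
Proof.
move=> hW.
set Z := fun n => \sum_(h < H) expi (\sum_(j < m.+2) a n j * (h ^ j.+1)%N%:R).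
have /boolp.choice [eta heta] : forall n, exists eta : R[i], cmod eta <= 1 /\
    (cmod (Z n ^+ s))%:C = eta * Z n ^+ s.
  by move=> n; have [e e1 e2] := exists_unimodular (Z n ^+ s); exists e.
(* A common bound for all the power sums, so that the lower coordinates have one type; the true box
   is the predicate [bx]. *)
pose B := (s * H ^ m.+2)%N.
pose T := ({ffun 'I_m -> 'I_B.+1} * ('I_(s * H ^ m.+2).+1 * 'I_(s * H ^ m.+1).+1))%type.
pose ev (f : {ffun 'I_s -> 'I_H}) : T :=
  ([ffun j : 'I_m => inord (psum f j.+1)], (inord (psum f m.+2), inord (psum f m.+1))).
pose G (v : T) : R[i] := \sum_n eta n * (expi (\sum_(j < m) a n j * (nat_of_ord (v.1 j))%:R) *
   expi ((nat_of_ord v.2.1)%:R * a n m.+1 + (nat_of_ord v.2.2)%:R * a n m)).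
pose bx (v : T) := [forall j : 'I_m, (v.1 j < (s * H ^ j.+1).+1)%N].
have psB (f : {ffun 'I_s -> 'I_H}) j : (j <= m.+2)%N -> (0 < j)%N -> (psum f j < B.+1)%N.
  move=> jm j0; rewrite ltnS (leq_trans (psum_le f j))// /B leq_mul2l; apply/orP; right.
  case: (posnP H) => [->|H0]; first by rewrite exp0n.
  by rewrite leq_pexp2l.
have jm2 (j : 'I_m) : (j.+1 <= m.+2)%N by rewrite (leq_trans (ltn_ord j))// ltnW.
have evbx f : bx (ev f).
  by apply/forallP => j; rewrite ffunE inordK ?psB// ltnS psum_le.
have ZE n : Z n ^+ s = \sum_(f : {ffun 'I_s -> 'I_H}) expi (\sum_(j < m.+2) a n j * (psum f j.+1)%:R).
  have -> : Z n ^+ s = \prod_(i < s) Z n by rewrite prodr_const card_ord.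
  rewrite /Z bigA_distr_bigA/=; apply: eq_bigr => f _.
  rewrite -expi_sum exchange_big/=; congr expi; apply: eq_bigr => j _.
  by rewrite -mulr_sumr -natr_sum.
have sumE : (\sum_n cmod (Z n) ^+ s)%:C = \sum_(f : {ffun 'I_s -> 'I_H}) G (ev f).
  rewrite rmorph_sum/=; under eq_bigr do rewrite -cmodX (heta _).2 ZE mulr_sumr.
  rewrite exchange_big/=; apply: eq_bigr => f _; apply: eq_bigr => n _.
  congr (_ * _); rewrite -expiD !big_ord_recr/= -addrA; congr expi; congr (_ + _).
    by apply: eq_bigr => j _; rewrite ffunE inordK// psB.
  by rewrite !inordK ?ltnS ?psum_le// addrC [a n m * _]mulrC [a n m.+1 * _]mulrC.
have S0 : 0 <= \sum_n cmod (Z n) ^+ s.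
  by apply: sumr_ge0 => n _; rewrite exprn_ge0// cmod_ge0.
rewrite -(ger0_norm S0) -cmodC sumE (le_trans (ler_cmod_sum _ _ _))//.
pose N (v : T) : R := (#|[pred f | ev f == v]|)%:R.
have -> : \sum_(f : {ffun 'I_s -> 'I_H}) cmod (G (ev f)) = \sum_(v | bx v) N v * cmod (G v).
  rewrite (partition_big ev bx)//=; apply: eq_bigr => v _.
  rewrite (eq_bigr (fun=> cmod (G v))); last by move=> f /eqP ->.
  by rewrite sumr_const mulr_natl.
apply: (le_trans (cauchy_schwarz_sum _ (fun v => ler0n _ _) (fun v => cmod_ge0 _))).
have W0 : 0 <= W.
  apply: le_trans (hW (fun=> 0) _); last by move=> n; rewrite cmod0.
  by apply: sumr_ge0 => v1 _; apply: sumr_ge0 => v2 _; exact: sqr_ge0.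
apply: ler_pM; rewrite ?sqrtr_ge0// ler_sqrt//; last by rewrite mulr_ge0.
  have -> : \sum_(v | bx v) N v ^+ 2 =
    (\sum_(v | bx v) \sum_(u : {ffun 'I_s -> 'I_H} * {ffun 'I_s -> 'I_H} | (ev u.1 == v) && (ev u.2 == v)) 1)%N%:R.
    rewrite natr_sum; apply: eq_bigr => v _; rewrite sum1_card expr2 -natrM; congr (_%:R).
    by rewrite -cardX; apply: eq_card => u; rewrite !inE.
  rewrite ler_nat (exchange_big_dep predT)//= -sum1_card [leqRHS]big_mkcond/=.
  apply: leq_sum => u _; rewrite sum1_card.
  have [uv|uv] := boolP (u \in vinogradov m.+2 s H).
    rewrite -(card1 (ev u.1)) subset_leq_card//; apply/fintype.subsetP => v.
    by rewrite !inE => /and3P[_ /eqP -> _].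
  rewrite leqn0; apply/eqP/eq_card0 => v; rewrite !inE; apply/negP => /and3P[_ /eqP e1 /eqP e2].
  move/negP: uv; apply; rewrite inE; apply/forallP => j.
  have e : ev u.1 = ev u.2 by rewrite e1 e2.
  have [jm|mj] := ltnP j m.
    have := congr1 (fun v : T => nat_of_ord (v.1 (Ordinal jm))) e; rewrite /ev /= !ffunE /=.
    by rewrite !inordK ?psB// => ->.
  have [/eqP jE|jn] := boolP (nat_of_ord j == m).
    have := congr1 (fun v : T => nat_of_ord v.2.2) e; rewrite /= !inordK ?ltnS ?psum_le// jE.
    by move=> ->.
  have jE : nat_of_ord j = m.+1.
    by apply/eqP; rewrite eqn_leq -ltnS ltn_ord /= ltn_neqAle eq_sym jn.
  have := congr1 (fun v : T => nat_of_ord v.2.1) e; rewrite /= !inordK ?ltnS ?psum_le// jE.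
  by move=> ->.
pose P1 (v1 : {ffun 'I_m -> 'I_B.+1}) := [forall j : 'I_m, (v1 j < (s * H ^ j.+1).+1)%N].
have -> : \sum_(v | bx v) cmod (G v) ^+ 2 = \sum_(v1 | P1 v1) \sum_v2 cmod (G (v1, v2)) ^+ 2.
  rewrite pair_big/=; apply: eq_big => [v|v _]; first by rewrite andbT.
  by rewrite -surjective_pairing.
apply: (@le_trans _ _ (\sum_(v1 | P1 v1) W)).
  apply: ler_sum => v1 _.
  pose e1 n := eta n * expi (\sum_(j < m) a n j * (nat_of_ord (v1 j))%:R).
  have e1le n : cmod (e1 n) <= 1 by rewrite /e1 cmodM cmod_expi mulr1 (heta n).1.
  have := hW e1 e1le; rewrite pair_bigA/= => h; apply: (le_trans _ h).
  rewrite le_eqVlt; apply/orP; left; apply/eqP; apply: eq_bigr => v2 _.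
  by congr (cmod _ ^+ 2); apply: eq_bigr => n _; rewrite /= mulrA.
rewrite sumr_const -[W *+ _]mulr_natl ler_wpM2r// ler_nat.
have -> : #|P1| = #|family (fun (j : 'I_m) (y : 'I_B.+1) => (y < (s * H ^ j.+1).+1)%N)|.
  by apply: eq_card => f; rewrite [LHS]unfold_in; apply/forallP/familyP => h j; exact: h.
rewrite card_family foldrE big_map big_enum/=.
apply: leq_prod => j _.
have [le|lt] := leqP (s * H ^ j.+1).+1 B.+1; last first.
  by rewrite (leq_trans (max_card _))// card_ord ltnW.
rewrite -[leqRHS]card_ord.
pose wd (y : 'I_B.+1) : 'I_(s * H ^ j.+1).+1 := inord y.
have winj : {in (fun y : 'I_B.+1 => (y < (s * H ^ j.+1).+1)%N) &, injective wd}.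
  move=> y y' hy hy' /(congr1 (fun u => nat_of_ord u)); rewrite /wd !inordK//.
  exact: val_inj.
by rewrite -(card_in_imset winj) max_card.
Qed.

End MomentBound.

(** * Spacing of the two top Taylor coefficients *)

Section PowerSequence.
Variable R : realType.
Variables (al t x0 : R) (m : nat).
Hypothesis al_lt : al < m.+3%:R.

(* The coefficients of h^(m+2) and h^(m+1) in the expansion of t (y + h)^al; the
   linear frequency enters through [x0], which is nonzero only for m = 0. *)
Definition Acoef (y : R) : R := t * gbinom al m.+2 * y `^ (al - m.+2%:R).
Definition Bcoef (y : R) : R := t * gbinom al m.+1 * y `^ (al - m.+1%:R) + x0.
(** Up to the factor [slopeA], the size of the derivative of [Acoef] at N. *)
Definition lam (N : nat) : R := N%:R `^ (al - m.+3%:R).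

Let c0 : R := t * gbinom al m.+2 * (al - m.+2%:R).
Definition slopeA : R := `|c0|.
Hypothesis c0_neq0 : c0 != 0.

(** The ratio of the slopes of [Acoef] at 3N and at N; the points used lie between N and 3N. *)
Definition g3 : R := 3 `^ (al - m.+3%:R).

Lemma slopeA_gt0 : 0 < slopeA.
Proof. by rewrite normr_gt0. Qed.

Lemma lam_gt0 N : (0 < N)%N -> 0 < lam N.
Proof. by move=> N0; rewrite powR_gt0// ltr0n. Qed.

Lemma g3_gt0 : 0 < g3.
Proof. by rewrite powR_gt0. Qed.

(** The sign factor makes [Acoef] increasing, and al < m+3 makes its slope decrease, so the slopes
    at 3N and N are the extremes. *)
Lemma Acoef_mvt N (y y' : R) : (0 < N)%N -> N%:R <= y <= y' -> y' <= 3 * N%:R ->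
  slopeA * g3 * lam N * (y' - y) <= Num.sg c0 * (Acoef y' - Acoef y) <= slopeA * lam N * (y' - y).
Proof.
move=> N0 /andP[Ny yy'] y3.
have NR : 0 < (N%:R : R) by rewrite ltr0n.
have y0 : 0 < y by apply: lt_le_trans Ny.
have yy : 0 < y <= y' by rewrite y0.
have [c /andP[yc cy'] e] := powR_mvt (al - m.+2%:R) yy.
have e1 : al - m.+2%:R - 1 = al - m.+3%:R by rewrite -[m.+3%:R]natr1; ring.
have d0 : 0 <= y' - y by rewrite subr_ge0.
have -> : Num.sg c0 * (Acoef y' - Acoef y) = slopeA * c `^ (al - m.+3%:R) * (y' - y).
  rewrite /Acoef -mulrBr e e1 /slopeA [`|c0|]normrEsg /c0; ring.
have cpos : 0 < c by apply: lt_le_trans yc.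
have neg : al - m.+3%:R <= 0 by rewrite subr_le0 ltW.
have anti (u v : R) : 0 < u -> u <= v -> v `^ (al - m.+3%:R) <= u `^ (al - m.+3%:R).
  move=> u0 uv; rewrite -[al - _]opprK (powRN v) (powRN u) lef_pV2 ?posrE ?powR_gt0 ?(lt_le_trans u0)//.
  by rewrite ge0_ler_powR ?nnegrE ?oppr_ge0// ltW// (lt_le_trans u0).
apply/andP; split; rewrite ler_wpM2r// -?mulrA ler_wpM2l ?normr_ge0//.
  rewrite /g3 /lam -powRM//; apply: anti => //; exact: le_trans cy' y3.
by apply: anti => //; exact: le_trans Ny yc.
Qed.

Lemma Acoef_lip N (y y' : R) : (0 < N)%N -> N%:R <= y <= y' -> y' <= 3 * N%:R ->
  `|Acoef y' - Acoef y| <= slopeA * lam N * (y' - y).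
Proof.
move=> N0 yy y3; have /andP[h1 h2] := Acoef_mvt N0 yy y3.
have /andP[Ny yy'] := yy.
have s1 : `|Num.sg c0| = 1 by rewrite normr_sg c0_neq0.
have -> : `|Acoef y' - Acoef y| = `|Num.sg c0 * (Acoef y' - Acoef y)| by rewrite normrM s1 mul1r.
rewrite ger0_norm//; apply: le_trans h1.
by rewrite !mulr_ge0 ?normr_ge0 ?powR_ge0// subr_ge0.
Qed.

(** The derivative of [Bcoef] is exactly m+2 times [Acoef]; this relation ties the two frequencies
    together. *)
Lemma Bcoef_mvt (y y' : R) : 0 < y <= y' ->
  exists2 c, y <= c <= y' & Bcoef y' - Bcoef y = (y' - y) * (m.+2%:R * Acoef c).
Proof.
move=> yy; have [c hc e] := powR_mvt (al - m.+1%:R) yy; exists c => //.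
have e1 : al - m.+1%:R - 1 = al - m.+2%:R by rewrite -[m.+2%:R]natr1; ring.
rewrite /Bcoef opprD addrACA subrr addr0 -mulrBr e e1 /Acoef (gbinomS al m.+1).
have : (m.+2%:R : R) != 0 by rewrite pnatr_eq0.
by move: (m.+2%:R : R) => kk kk0; field.
Qed.

End PowerSequence.

(** * The large sieve for these two coefficients *)

Section PowerLargeSieve.
Variable R : realType.
Variables (al t : R) (m : nat).
Hypothesis al_lt : al < m.+3%:R.
Hypothesis c0_neq0 : t * gbinom al m.+2 * (al - m.+2%:R) != 0.

Local Notation A := (Acoef al t m).
Local Notation B x0 := (Bcoef al t x0 m).
Local Notation lam := (lam al m).
Local Notation sA := (slopeA al t m).
Local Notation g3 := (g3 al m).
Local Notation sg := (Num.sg (t * gbinom al m.+2 * (al - m.+2%:R))).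

Definition harm H : R := \sum_(w < H) w.+1%:R^-1.

Lemma nrm_sg (u : R) : nrm (sg * u) = nrm u.
Proof.
have [c|c|] := ltrgt0P (t * gbinom al m.+2 * (al - m.+2%:R)); last by move: c0_neq0 => /eqP.
  by rewrite gtr0_sg// mul1r.
by rewrite ltr0_sg// mulN1r nrmN.
Qed.

(** Used with w = h = 1 for all points, and with h = H and multiples of m+2 for the starting points
    of the windows. *)
Lemma count_A N (w h P : nat) (psi r : R) : (0 < N)%N -> (0 < w)%N -> (0 < h)%N ->
  0 <= r -> (h * P <= 2 * N)%N ->
  (#|[pred i : 'I_P | nrm (w%:R * A (N + h * i)%N%:R - psi) <= r]|)%:R <=
  (w%:R * (sA * lam N * (2 * N%:R)) + 2) *
  (4 * r / (w%:R * (sA * g3 * lam N * h%:R)) + 1).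
Proof.
move=> N0 w0 h0 r0 hP.
have wR : 0 < (w%:R : R) by rewrite ltr0n.
have hR : 0 < (h%:R : R) by rewrite ltr0n.
have sA0 := slopeA_gt0 c0_neq0; have l0 := lam_gt0 al m N0; have g30 := g3_gt0 al m.
pose X (i : nat) : R := w%:R * (sg * A (N + h * i)%N%:R).
have mono i j : (i <= j)%N -> (j < P)%N ->
   w%:R * (sA * g3 * lam N * h%:R) * (j - i)%N%:R <= X j - X i <=
   w%:R * (sA * lam N * h%:R) * (j - i)%N%:R.
  move=> ij jP; rewrite /X -mulrBr -mulrBr -!mulrA !(ler_pM2l wR).
  have yy : N%:R <= ((N + h * i)%N%:R : R) <= (N + h * j)%N%:R.
    by rewrite !ler_nat leq_addr leq_add2l leq_mul2l ij orbT.
  have y3 : ((N + h * j)%N%:R : R) <= 3 * N%:R.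
    rewrite -natrM ler_nat mulSn leq_add2l (leq_trans _ hP)// leq_mul2l ltnW// orbT//.
  have := Acoef_mvt t al_lt N0 yy y3.
  have -> : ((N + h * j)%N%:R : R) - (N + h * i)%N%:R = h%:R * (j - i)%N%:R.
    by rewrite -natrB ?leq_add2l ?leq_mul2l ?ij ?orbT// subnDl -mulnBr natrM.
  by rewrite !mulrA.
have := @spaced_count R P X (w%:R * (sA * g3 * lam N * h%:R)) (w%:R * (sA * lam N * (2 * N%:R))) r (sg * psi).
have -> : #|[pred i : 'I_P | nrm (X i - sg * psi) <= r]| =
   #|[pred i : 'I_P | nrm (w%:R * A (N + h * i)%N%:R - psi) <= r]|.
  by apply: eq_card => i; rewrite !inE -[in RHS]nrm_sg [sg * (_ - _)]mulrBr /X [sg * (w%:R * _)]mulrCA.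
move=> hc; apply: hc => //.
- by rewrite !mulr_gt0.
- by rewrite !mulr_ge0// ltW.
- by move=> i j ij jP; have /andP[h1 _] := mono i j ij jP; rewrite mulrC.
- move=> i iP; have /andP[_ h1] := mono 0 i (leq0n _) iP; apply: (le_trans h1).
  rewrite subn0 -!mulrA ler_pM2l// ler_pM2l// ler_pM2l// -!natrM ler_nat.
  by rewrite (leq_trans _ hP)// leq_mul2l ltnW// orbT.
Qed.


Variables (N H Qb s : nat).
Hypothesis N_gt0 : (0 < N)%N.
Hypothesis H_gt0 : (0 < H)%N.
Hypothesis s_gt0 : (0 < s)%N.
Hypothesis H2N : (H ^ 2 <= N)%N.
Hypothesis HQ : (H * Qb <= 2 * N)%N.
Hypothesis Hlam_le : H%:R ^+ m.+3 * lam N <= 1.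
Hypothesis Hlam_ge : 1 <= 2 ^+ m.+3 * (H%:R ^+ m.+3 * lam N).

Local Notation L1 := (s * H ^ m.+2).+1.
Local Notation L2 := (s * H ^ m.+1).+1.
Local Notation kA := (2 ^+ m.+3 : R).

Let HR : 1 <= (H%:R : R). Proof. by rewrite ler1n. Qed.
Let l0 : 0 < lam N. Proof. exact: lam_gt0. Qed.
Let sA0 : 0 < sA. Proof. exact: slopeA_gt0. Qed.
Let g30 : 0 < g3. Proof. exact: g3_gt0. Qed.

Lemma succ_le_pow j : ((s * H ^ j).+1)%:R <= s.+1%:R * H%:R ^+ j :> R.
Proof. by rewrite -natrX -natrM ler_nat mulSn addnC -addn1 leq_add2l expn_gt0 H_gt0. Qed.

Lemma pow_le_succ j : H%:R ^+ j <= ((s * H ^ j).+1)%:R :> R.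
Proof. by rewrite -natrX ler_nat leqW// leq_pmull. Qed.

(** Over a window of length H the top coefficient moves by O(1/L1), hence is constant at the
    resolution of the sieve. *)
Lemma L1_lam : L1%:R * (lam N * H%:R) <= s.+1%:R :> R.
Proof.
apply: (@le_trans _ _ (s.+1%:R * H%:R ^+ m.+2 * (lam N * H%:R))).
  by rewrite ler_wpM2r ?succ_le_pow// mulr_ge0// ltW.
have -> : s.+1%:R * H%:R ^+ m.+2 * (lam N * H%:R) = s.+1%:R * (H%:R ^+ m.+3 * lam N) :> R.
  by rewrite [H%:R ^+ m.+3]exprSr; ring.
by rewrite ler_piMr.
Qed.

Lemma L2_lam : L2%:R * (lam N * H%:R ^+ 2) <= s.+1%:R :> R.
Proof.
apply: (@le_trans _ _ (s.+1%:R * H%:R ^+ m.+1 * (lam N * H%:R ^+ 2))).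
  by rewrite ler_wpM2r ?succ_le_pow// mulr_ge0 ?exprn_ge0// ltW.
have -> : s.+1%:R * H%:R ^+ m.+1 * (lam N * H%:R ^+ 2) = s.+1%:R * (H%:R ^+ m.+3 * lam N) :> R.
  by rewrite [H%:R ^+ m.+3]exprSr [H%:R ^+ m.+2]exprSr; ring.
by rewrite ler_piMr.
Qed.

Lemma inv_L1_lam : (L1%:R * lam N)^-1 <= kA * H%:R.
Proof.
have p : 0 < H%:R ^+ m.+2 * lam N by rewrite mulr_gt0// exprn_gt0// ltr0n.
apply: (@le_trans _ _ (H%:R ^+ m.+2 * lam N)^-1).
  have p' : 0 < L1%:R * lam N by rewrite mulr_gt0 ?ltr0n.
  by rewrite lef_pV2// ler_pM2r// pow_le_succ.
rewrite -[leLHS]mul1r ler_pdivrMr//; apply: le_trans Hlam_ge _.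
by rewrite [H%:R ^+ m.+3]exprS !mulrA.
Qed.

Lemma inv_L2_lam : (L2%:R * lam N * H%:R)^-1 <= kA * H%:R.
Proof.
have p : 0 < H%:R ^+ m.+2 * lam N by rewrite mulr_gt0// exprn_gt0// ltr0n.
apply: (@le_trans _ _ (H%:R ^+ m.+2 * lam N)^-1).
  have p' : 0 < L2%:R * lam N * H%:R by rewrite !mulr_gt0 ?ltr0n.
  rewrite lef_pV2// [leRHS]mulrAC ler_pM2r// [H%:R ^+ m.+2]exprSr.
  by rewrite ler_pM2r ?ltr0n// pow_le_succ.
rewrite -[leLHS]mul1r ler_pdivrMr//; apply: le_trans Hlam_ge _.
by rewrite [H%:R ^+ m.+3]exprS !mulrA.
Qed.

Definition K1 : R := (2 * sA + 2) * (4 * kA / (sA * g3) + 1).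

(** At distance 1/L1 about H consecutive points are indistinguishable, by the lower bound on H^(m+3)
    [lam N]; the factor 1 + N [lam N] counts the turns of [Acoef] around the circle. *)
Lemma count_A_inv_L1 psi :
  (#|[pred i : 'I_(H * Qb) | nrm (A (N + i)%N%:R - psi) <= L1%:R^-1]|)%:R <=
  K1 * (1 + N%:R * lam N) * H%:R.
Proof.
have r0 : 0 <= (L1%:R^-1 : R) by rewrite invr_ge0.
have := @count_A N 1 1 (H * Qb) psi L1%:R^-1 N_gt0 isT isT r0; rewrite mul1n => /(_ HQ).
have -> : #|[pred i : 'I_(H * Qb) | nrm (1%:R * A (N + 1 * i)%N%:R - psi) <= L1%:R^-1]| =
   #|[pred i : 'I_(H * Qb) | nrm (A (N + i)%N%:R - psi) <= L1%:R^-1]|.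
  by apply: eq_card => i; rewrite !inE mul1r mul1n.
move=> h; apply: (le_trans h).
rewrite !mul1r !mulr1.
have -> : 4 * L1%:R^-1 / (sA * g3 * lam N) = 4 / (sA * g3) * (L1%:R * lam N)^-1.
  by rewrite !invfM; ring.
have -> : K1 * (1 + N%:R * lam N) * H%:R =
   ((2 * sA + 2) * (1 + N%:R * lam N)) * (4 / (sA * g3) * (kA * H%:R) + H%:R) by rewrite /K1; ring.
have q0 : 0 <= N%:R * lam N by rewrite mulr_ge0// ltW.
apply: ler_pM.
- by rewrite addr_ge0// !mulr_ge0// ltW.
- by rewrite addr_ge0// !mulr_ge0 ?invr_ge0 ?mulr_ge0// ltW.
- rewrite -subr_ge0.
  have -> : (2 * sA + 2) * (1 + N%:R * lam N) - (sA * lam N * (2 * N%:R) + 2) =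
    2 * sA + 2 * (N%:R * lam N) by ring.
  by rewrite addr_ge0// mulr_ge0// ltW.
- rewrite lerD// ler_wpM2l ?inv_L1_lam// divr_ge0// mulr_ge0 ?ltW//.
Qed.

(** The 2 stands for two points within 1/L2 of a common centre, the rest for the variation of (m+2)A
    over a window, estimated by [L2_lam]. *)
Definition c2 : R := 2 + m.+2%:R * sA * s.+1%:R.

(** On window [q] the coefficient B is nearly linear with slope (m+2)A, so coincidences there depend
    only on the difference w of the points, and neither on the centre nor on [x0]. *)
Definition G (q : nat) : nat :=
  #|[pred w : 'I_H | nrm ((w * m.+2)%N%:R * A (N + H * q)%N%:R - 0) <= c2 / L2%:R]|.

Lemma count_B_inv_L2 x0 q psi : (q < Qb)%N ->
  (#|[pred u : 'I_H | (nrm (B x0 (N + (u + H * q))%N%:R - psi) <= L2%:R^-1)%R]| <= G q)%N.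
Proof.
move=> qQ; set P := [pred u : 'I_H | _].
have [->//|/card_gt0P [i0 Pi0]] := posnP #|P|.
(* Measured from its smallest element, the set injects into the differences counted by [G q]. *)
have [i Pi imin] := @arg_minnP _ i0 P (fun i => nat_of_ord i) Pi0.
pose f (j : 'I_H) : 'I_H := Ordinal (leq_ltn_trans (leq_subr i j) (ltn_ord j)).
have fin : {in P &, injective f}.
  move=> a b Pa Pb [] e; apply: val_inj => /=.
  by rewrite -(subnK (imin _ Pa)) -(subnK (imin _ Pb)) e.
rewrite -(card_in_imset fin); apply: subset_leq_card; apply/fintype.subsetP => _ /imsetP[j Pj ->].
rewrite inE /= subr0.
have ij := imin _ Pj.
have jH := ltn_ord j.
have yq (v : nat) : (v < H)%N -> (N + (v + H * q) <= 3 * N)%N.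
  move=> vH; rewrite mulSn leq_add2l (leq_trans _ HQ)//.
  have : (v + H * q <= H * q.+1)%N by rewrite mulnS leq_add2r ltnW.
  by move=> h; rewrite (leq_trans h)// leq_mul2l qQ orbT.
have yy : 0 < ((N + (i + H * q))%N%:R : R) <= (N + (j + H * q))%N%:R.
  by rewrite ltr0n addn_gt0 N_gt0 ler_nat leq_add2l leq_add2r.
have [c /andP[ic cj] e] := Bcoef_mvt al t x0 m yy.
have e1 : B x0 (N + (j + H * q))%N%:R - B x0 (N + (i + H * q))%N%:R = (j - i)%N%:R * (m.+2%:R * A c).
  by rewrite e -natrB ?leq_add2l ?leq_add2r// subnDl subnDr.
have cH : c <= (N + H * q)%N%:R + H%:R.
  by rewrite (le_trans cj)// -natrD ler_nat -addnA leq_add2l addnC leq_add2l ltnW.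
have h1 : `|A c - A (N + H * q)%N%:R| <= sA * lam N * H%:R.
  apply: le_trans (Acoef_lip al_lt c0_neq0 N_gt0 _ _) _.
  - rewrite ler_nat leq_addr (le_trans _ ic)// ler_nat leq_add2l leq_addl//.
  - by rewrite (le_trans cj)// -natrM ler_nat yq.
  by rewrite ler_wpM2l ?mulr_ge0 ?normr_ge0 ?powR_ge0// lerBlDl.
have -> : ((j - i) * m.+2)%N%:R * A (N + H * q)%N%:R =
  (B x0 (N + (j + H * q))%N%:R - psi) + (- (B x0 (N + (i + H * q))%N%:R - psi) +
   ((j - i) * m.+2)%N%:R * (A (N + H * q)%N%:R - A c)).
  have -> (x y z w : R) : (x - z) + (- (y - z) + w) = x - y + w by ring.
  by rewrite e1 natrM; ring.
apply: le_trans (nrmD _ _) _; apply: le_trans (lerD Pj (nrmD _ _)) _; rewrite nrmN.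
apply: le_trans (lerD (lexx _) (lerD Pi (nrm_le _))) _.
have L2p : 0 < (L2%:R : R) by rewrite ltr0n.
have h2 : `|((j - i) * m.+2)%N%:R * (A (N + H * q)%N%:R - A c)| <= m.+2%:R * sA * s.+1%:R / L2%:R.
  rewrite normrM distrC ger0_norm// natrM.
  apply: (@le_trans _ _ (H%:R * m.+2%:R * (sA * lam N * H%:R))).
    by rewrite ler_pM// ler_wpM2r// ler_nat (leq_trans (leq_subr _ _))// ltnW.
  rewrite ler_pdivlMr//.
  have -> : H%:R * m.+2%:R * (sA * lam N * H%:R) * L2%:R = m.+2%:R * sA * (L2%:R * (lam N * H%:R ^+ 2)) by ring.
  by rewrite ler_wpM2l ?L2_lam// mulr_ge0// ltW.
apply: le_trans (lerD (lexx _) (lerD (lexx _) h2)) _.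
by rewrite /c2 le_eqVlt; apply/orP; left; apply/eqP; ring.
Qed.


Definition K2 : R := 4 * c2 / (m.+2%:R * (sA * g3)) * kA.
Definition K3 : R := 4 + 2 * m.+2%:R * sA * (K2 + 1) + 4 * K2.

Let c20 : 0 <= c2. Proof. by rewrite addr_ge0// !mulr_ge0// ltW. Qed.
Let K20 : 0 <= K2.
Proof. by rewrite mulr_ge0 ?exprn_ge0// divr_ge0// !mulr_ge0// ltW. Qed.

Lemma harm_ge0 : 0 <= harm H.
Proof. by apply: sumr_ge0 => w _; rewrite invr_ge0. Qed.

Lemma count_multiples (w : nat) : (0 < w < H)%N ->
  (#|[pred q : 'I_Qb | nrm ((w * m.+2)%N%:R * A (N + H * q)%N%:R - 0) <= c2 / L2%:R]|)%:R <=
  2 * m.+2%:R * sA * (K2 + 1) * (lam N * N%:R * H%:R) + 4 * K2 * H%:R * w.+1%:R^-1 + 2 :> R.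
Proof.
move=> /andP[w0 wH].
have wR : 0 < (w%:R : R) by rewrite ltr0n.
have r0 : 0 <= c2 / L2%:R by rewrite divr_ge0.
have wm : (0 < w * m.+2)%N by rewrite muln_gt0 w0.
apply: le_trans (count_A 0 N_gt0 wm H_gt0 r0 HQ) _.
have -> : 4 * (c2 / L2%:R) / ((w * m.+2)%N%:R * (sA * g3 * lam N * H%:R)) =
   4 * c2 / (m.+2%:R * (sA * g3)) * (L2%:R * lam N * H%:R)^-1 / w%:R.
  by rewrite natrM !invfM; ring.
apply: (@le_trans _ _ ((w%:R * (2 * m.+2%:R * sA * (lam N * N%:R)) + 2) * (K2 * H%:R / w%:R + 1))).
  have e : (w * m.+2)%N%:R * (sA * lam N * (2 * N%:R)) = w%:R * (2 * m.+2%:R * sA * (lam N * N%:R)).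
    by rewrite natrM; ring.
  rewrite e ler_wpM2l//; first by rewrite addr_ge0// !mulr_ge0// ltW.
  rewrite lerD// ler_wpM2r ?invr_ge0// /K2 -[_ * kA * _]mulrA ler_wpM2l ?inv_L2_lam//.
  by rewrite divr_ge0// !mulr_ge0// ltW.
have q0 : 0 <= 2 * m.+2%:R * sA * (lam N * N%:R) by rewrite !mulr_ge0// ltW.
have -> : (w%:R * (2 * m.+2%:R * sA * (lam N * N%:R)) + 2) * (K2 * H%:R / w%:R + 1) =
  2 * m.+2%:R * sA * (lam N * N%:R) * (K2 * H%:R) + w%:R * (2 * m.+2%:R * sA * (lam N * N%:R)) +
  2 * (K2 * H%:R) * w%:R^-1 + 2.
  by field; rewrite gt_eqF.
have -> : 2 * m.+2%:R * sA * (K2 + 1) * (lam N * N%:R * H%:R) =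
  2 * m.+2%:R * sA * (lam N * N%:R) * (K2 * H%:R) + H%:R * (2 * m.+2%:R * sA * (lam N * N%:R)) by ring.
rewrite !lerD//; first by rewrite ler_wpM2r// ler_nat ltnW.
have -> : 4 * K2 * H%:R * w.+1%:R^-1 = 2 * (K2 * H%:R) * (2 / w.+1%:R) by ring.
rewrite ler_wpM2l//; first exact: mulr_ge0 (ler0n _ _) (mulr_ge0 K20 (ler0n _ _)).
rewrite ler_pdivlMr ?ltr0n// mulrC ler_pdivrMr// -natrM ler_nat.
by rewrite mul2n -addnn -addn1 leq_add2l.
Qed.

(** Exchange the sums. For fixed w > 0 the multiples of A at the window starts are spaced in q,
    which yields the terms H/w of the harmonic sum; w = 0 contributes all [Qb] windows. H^2 <= N and
    H^3 [lam N] <= 1 bring the remaining terms below N/H. *)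
Lemma sum_G : \sum_(q < Qb) (G q)%:R <= K3 * (N%:R / H%:R) * (1 + harm H).
Proof.
have Hp : 0 < (H%:R : R) by rewrite ltr0n.
have NH : (H%:R : R) <= N%:R / H%:R.
  by rewrite ler_pdivlMr// -natrM ler_nat mulnn.
have QN : (Qb%:R : R) <= 2 * (N%:R / H%:R).
  by rewrite mulrA ler_pdivlMr// -!natrM ler_nat mulnC.
have cm := count_multiples.
have D0 : 0 <= 2 * m.+2%:R * sA * (K2 + 1).
  exact: mulr_ge0 (mulr_ge0 (mulr_ge0 (ler0n _ _) (ler0n _ _)) (ltW sA0)) (addr_ge0 K20 ler01).
have E0 : 0 <= 4 * K2 by exact: mulr_ge0 (ler0n _ _) K20.
rewrite /K3; move: D0 E0 cm.
move: (2 * m.+2%:R * sA * (K2 + 1)) (4 * K2) => D E D0 E0 cm.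
pose T (w : nat) : R := (w == 0)%:R * Qb%:R + D * (lam N * N%:R * H%:R) +
  E * H%:R * w.+1%:R^-1 + 2.
apply: (@le_trans _ _ (\sum_(w < H) T w)).
  pose b (w q : nat) : bool := nrm ((w * m.+2)%N%:R * A (N + H * q)%N%:R - 0) <= c2 / L2%:R.
  have -> : \sum_(q < Qb) (G q)%:R = \sum_(w < H) (#|[pred q : 'I_Qb | b w q]|)%:R :> R.
    under eq_bigr => q _ do rewrite /G -sum1_card natr_sum big_mkcond.
    rewrite exchange_big/=; apply: eq_bigr => w _.
    by rewrite -sum1_card natr_sum [RHS]big_mkcond.
  apply: ler_sum => w _; have [w0|w0] := posnP w.
    rewrite /T w0 eqxx mul1r -!addrA.
    apply: (@le_trans _ _ Qb%:R).
      by rewrite ler_nat (leq_trans (max_card _))// card_ord.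
    by rewrite lerDl !addr_ge0// !mulr_ge0 ?invr_ge0// ltW.
  rewrite /T (gtn_eqF w0) mul0r add0r.
  by apply: cm; rewrite w0 ltn_ord.
rewrite /T !big_split/= -[\sum_(i < H) E * _ * _]mulr_sumr -/(harm H) !sumr_const card_ord.
have -> : \sum_(w < H) (w == 0 :> nat)%:R * Qb%:R = Qb%:R :> R.
  rewrite -mulr_suml (bigD1 (Ordinal H_gt0))//= big1 ?addr0 ?mul1r// => i.
  by rewrite -val_eqE/= => /negbTE->.
have lamN : lam N * N%:R * H%:R * H%:R <= N%:R / H%:R.
  rewrite ler_pdivlMr//.
  have -> : lam N * N%:R * H%:R * H%:R * H%:R = N%:R * (H%:R ^+ 3 * lam N) by ring.
  rewrite ler_piMr//; apply: le_trans Hlam_le; rewrite ler_wpM2r ?(ltW l0)//.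
  by rewrite ler_weXn2l.
have h0 := harm_ge0.
rewrite -[(D * _) *+ H]mulr_natr.
have -> : H%:R + H%:R = 2 * H%:R :> R by ring.
have -> : (4 + D + E) * (N%:R / H%:R) * (1 + harm H) = 2 * (N%:R / H%:R) +
   D * (N%:R / H%:R) + E * (N%:R / H%:R) * harm H + 2 * (N%:R / H%:R) +
   (E * (N%:R / H%:R) + (4 + D) * (N%:R / H%:R) * harm H).
  ring.
rewrite -[leLHS]addr0 lerD//; last first.
  have n0 : 0 <= N%:R / H%:R :> R by rewrite divr_ge0.
  by rewrite addr_ge0 ?mulr_ge0// addr_ge0.
rewrite !lerD//.
- by rewrite -mulrA ler_wpM2l.
- by rewrite ler_wpM2r// ler_wpM2l.
- by rewrite ler_wpM2l.
Qed.

(** 64 comes from two uses of [dirk_fej], the next factor from [fej_perturb], 32 * 32 from two uses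
    of [fej_sum], and [K1], [K3] from the counts of the two coefficients. *)
Definition K4 : R := 64 * (2 * (1 + (s.+1%:R * sA) ^+ 2)) * (32 * 32) * K1 * K3.

(** One of the two indices is grouped into windows. The kernel in A is constant along a window up to
    a factor, so summing inside the window involves only the kernel in B and gives [G q]; the other
    index is then summed against the kernel in A. *)
Lemma power_large_sieve x0 (eta : 'I_(H * Qb) -> R[i]) : (forall n, cmod (eta n) <= 1) ->
  \sum_(v1 < L1) \sum_(v2 < L2)
    cmod (\sum_n eta n * expi (v1%:R * A (N + n)%N%:R + v2%:R * B x0 (N + n)%N%:R)) ^+ 2 <=
  K4 * (L1%:R * L2%:R) * ((1 + N%:R * lam N) * N%:R * (1 + harm H)).
Proof.
move=> eta1.
have Hp : 0 < (H%:R : R) by rewrite ltr0n.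
have LL : 0 < L1%:R * L2%:R :> R by rewrite mulr_gt0 ?ltr0n.
rewrite -(ler_pM2l LL).
apply: le_trans (large_sieve2 (fun n : 'I_(H * Qb) => A (N + n)%N%:R) (fun n => B x0 (N + n)%N%:R) (@L1) (@L2) eta1) _.
pose f1 := fej L1 : R -> R; pose f2 := fej L2 : R -> R.
pose F (i : nat) : R := \sum_(i' < H * Qb) f1 (A (N + i')%N%:R - A (N + i)%N%:R) * f2 (B x0 (N + i')%N%:R - B x0 (N + i)%N%:R).
apply: (@le_trans _ _ (64 * \sum_(i < H * Qb) F i)).
  rewrite exchange_big/= mulr_sumr; apply: ler_sum => i _; rewrite /F mulr_sumr; apply: ler_sum => i' _.
  have -> (x y : R) : 64 * (x * y) = (8 * x) * (8 * y) by ring.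
  by rewrite ler_pM ?sqr_ge0// dirk_fej.
rewrite sum_mul_split exchange_big/=.
pose cc : R := 2 * (1 + (s.+1%:R * sA) ^+ 2).
have cc0 : 0 <= cc by rewrite mulr_ge0// addr_ge0// sqr_ge0.
have K10 : 0 <= K1.
  exact: mulr_ge0 (addr_ge0 (mulr_ge0 (ler0n _ _) (ltW sA0)) (ler0n _ _)) (addr_ge0 (divr_ge0
    (mulr_ge0 (ler0n _ _) (exprn_ge0 _ (ler0n _ _))) (ltW (mulr_gt0 sA0 g30))) ler01).
have Nl0 : 0 <= 1 + N%:R * lam N by rewrite addr_ge0// mulr_ge0// ltW.
have step (q : 'I_Qb) : \sum_(u < H) F (u + H * q)%N <=
   cc * (32 * (G q)%:R * L2%:R ^+ 2) * (32 * (K1 * (1 + N%:R * lam N) * H%:R) * L1%:R ^+ 2).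
  apply: (@le_trans _ _ (\sum_(i' < H * Qb) cc * f1 (A (N + i')%N%:R - A (N + H * q)%N%:R) *
     \sum_(u < H) f2 (B x0 (N + (u + H * q))%N%:R - B x0 (N + i')%N%:R))).
    rewrite /F exchange_big/=; apply: ler_sum => i' _; rewrite mulr_sumr; apply: ler_sum => u _.
    rewrite -[f2 (_ - B x0 (N + i')%N%:R)]fejN opprB ler_wpM2r ?fej_ge0//.
    have -> : A (N + i')%N%:R - A (N + (u + H * q))%N%:R =
      (A (N + i')%N%:R - A (N + H * q)%N%:R) + (A (N + H * q)%N%:R - A (N + (u + H * q))%N%:R) by ring.
    apply: fej_perturb; last by rewrite mulr_ge0// ltW.
    have uH := ltn_ord u.
    have h1 : `|A (N + (u + H * q))%N%:R - A (N + H * q)%N%:R| <= sA * lam N * H%:R.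
      apply: le_trans (Acoef_lip al_lt c0_neq0 N_gt0 _ _) _.
      - by rewrite !ler_nat leq_addr leq_add2l leq_addl.
      - rewrite -natrM ler_nat mulSn leq_add2l (leq_trans _ HQ)//.
        apply: (@leq_trans (H * q.+1)); first by rewrite mulnS leq_add2r ltnW.
        by rewrite leq_mul2l ltn_ord orbT.
      rewrite ler_wpM2l ?mulr_ge0 ?normr_ge0 ?powR_ge0// lerBlDl -natrD ler_nat -addnA leq_add2l addnC.
      by rewrite leq_add2l ltnW.
    rewrite distrC; apply: (@le_trans _ _ (L1%:R * (sA * lam N * H%:R))); first by rewrite ler_wpM2l.
    have -> : L1%:R * (sA * lam N * H%:R) = L1%:R * (lam N * H%:R) * sA by ring.
    by rewrite ler_wpM2r ?L1_lam// ltW.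
  apply: (@le_trans _ _ (\sum_(i' < H * Qb) cc * f1 (A (N + i')%N%:R - A (N + H * q)%N%:R) *
     (32 * (G q)%:R * L2%:R ^+ 2))).
    apply: ler_sum => i' _; apply: ler_wpM2l; first exact: mulr_ge0 cc0 (fej_ge0 _ _).
    apply: (fej_sum (th := fun u : 'I_H => B x0 (N + (u + H * q))%N%:R)) => // psi.
    by rewrite ler_nat count_B_inv_L2.
  have g0 : 0 <= cc * (32 * (G q)%:R * L2%:R ^+ 2).
    exact: mulr_ge0 cc0 (mulr_ge0 (mulr_ge0 (ler0n _ _) (ler0n _ _)) (exprn_ge0 _ (ler0n _ _))).
  rewrite -mulr_suml -mulr_sumr mulrAC; apply: ler_wpM2l => //.
  by apply: (fej_sum (th := fun i : 'I_(H * Qb) => A (N + i)%N%:R)) => // psi; exact: count_A_inv_L1.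
apply: (@le_trans _ _ (64 * \sum_(q < Qb) cc * (32 * (G q)%:R * L2%:R ^+ 2) * (32 * (K1 * (1 + N%:R * lam N) * H%:R) * L1%:R ^+ 2))).
  by rewrite ler_wpM2l//; apply: ler_sum => q _; exact: step.
have -> : 64 * (\sum_(q < Qb) cc * (32 * (G q)%:R * L2%:R ^+ 2) * (32 * (K1 * (1 + N%:R * lam N) * H%:R) * L1%:R ^+ 2)) =
  (64 * cc * (32 * 32) * K1 * (L1%:R * L2%:R * (L1%:R * L2%:R)) * (1 + N%:R * lam N) * H%:R) * \sum_(q < Qb) (G q)%:R.
  by rewrite mulr_sumr mulr_sumr; apply: eq_bigr => q _; ring.
apply: le_trans (ler_wpM2l _ sum_G) _.
  have cK : 0 <= 64 * cc * (32 * 32) * K1.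
    exact: mulr_ge0 (mulr_ge0 (mulr_ge0 (ler0n _ _) cc0) (mulr_ge0 (ler0n _ _) (ler0n _ _))) K10.
  exact: mulr_ge0 (mulr_ge0 (mulr_ge0 cK (mulr_ge0 (ltW LL) (ltW LL))) Nl0) (ler0n _ _).
rewrite /K4 -/cc le_eqVlt; apply/orP; left; apply/eqP.
by field; rewrite gt_eqF.
Qed.

End PowerLargeSieve.

(** * Moments of the window sums over all starting points *)

Section ShiftedMoments.
Variable R : realType.

Lemma ln_step (x : R) : 0 < x -> (x + 1)^-1 <= ln (x + 1) - ln x.
Proof.
move=> x0; have x1 : 0 < x + 1 by rewrite addr_gt0.
have h : ln (x / (x + 1)) <= x / (x + 1) - 1.
  have h : -1 < x / (x + 1) - 1 by rewrite ltrBrDr addNr divr_gt0.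
  by have := le_ln1Dx h; rewrite addrC subrK.
rewrite ln_div ?posrE// in h.
have e : x / (x + 1) - 1 = - (x + 1)^-1 by field; rewrite gt_eqF.
by rewrite -lerN2 opprB -e.
Qed.

Lemma harm_ln H : (0 < H)%N -> harm R H <= 1 + ln H%:R.
Proof.
case: H => // H _; elim: H => [|H IH]; first by rewrite /harm big_ord1 invr1 ln1 addr0.
rewrite /harm big_ord_recr/= -/(harm R _).
have := @ln_step H.+1%:R (ltr0Sn _ _); rewrite natr1 => h.
by rewrite -[leRHS](subrK (1 + ln H.+1%:R)) addrC lerD// opprD addrACA subrr add0r.
Qed.

Lemma harm_le (e : R) H : 0 < e -> (0 < H)%N -> 1 + harm R H <= (2 + e^-1) * H%:R `^ e.
Proof.
move=> e0 H0; have HR : 1 <= (H%:R : R) by rewrite ler1n.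
have p1 : 1 <= (H%:R : R) `^ e by have := ler_powR HR (ltW e0); rewrite powRr0.
have : ln (H%:R `^ e : R) <= H%:R `^ e.
  have h : -1 < (H%:R : R) `^ e - 1 by rewrite ltrBrDr addNr (lt_le_trans _ p1).
  by have := le_ln1Dx h; rewrite addrC subrK => h'; apply: (le_trans h'); rewrite lerBlDr lerDl.
rewrite ln_powR => h.
have : ln (H%:R : R) <= e^-1 * H%:R `^ e by rewrite mulrC ler_pdivlMr// mulrC.
by have := harm_ln H0; rewrite mulrDl; move: (e^-1 * _) => q ? ?; lra.
Qed.

Variables (al t : R) (m : nat).
Hypothesis al_lt : al < m.+3%:R.
Hypothesis c0_neq0 : t * gbinom al m.+2 * (al - m.+2%:R) != 0.

Local Notation s := (tri m.+2).

(** The last two conditions put H within a factor 2 below N^((m+3-al)/(m+3)). *)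
Definition admissible N H Qb :=
  [/\ (0 < N)%N, (0 < H)%N & (H ^ 2 <= N)%N] /\ [/\ (H * Qb <= 2 * N)%N,
      H%:R ^+ m.+3 * lam al m N <= 1 & 1 <= 2 ^+ m.+3 * (H%:R ^+ m.+3 * lam al m N)].

Definition coef_ok x0 N P (a : 'I_P -> nat -> R) := forall n : 'I_P,
  a n m.+1 = Acoef al t m (N + n)%N%:R /\ a n m = Bcoef al t x0 m (N + n)%N%:R.

Lemma prod_succ_le (r j H : nat) : (0 < H)%N ->
  (\prod_(i < j) (r * H ^ i.+1).+1 <= r.+1 ^ j * H ^ tri j)%N.
Proof.
move=> H0; elim: j => [|j IH]; first by rewrite big_ord0 expn0 mul1n expn_gt0 H0.
rewrite triS big_ord_recr [(r.+1 ^ _)%N]expnS expnD.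
have h : ((r * H ^ j.+1).+1 <= r.+1 * H ^ j.+1)%N.
  by rewrite mulSn -[leqLHS]add1n leq_add2r expn_gt0 H0.
apply: (leq_trans (leq_mul IH h)).
by rewrite leq_eqVlt; apply/orP; left; apply/eqP; ring.
Qed.

(** The bound is uniform in H' <= H because Abel summation inside a window uses all its partial
    sums. The resolution stays that of H: the sieve ranges for H' are enlarged to those for H. *)
Lemma shifted_moment (eps : R) : 0 < eps -> exists2 C : R, 0 <= C &
  forall x0 N H Qb (a : 'I_(H * Qb) -> nat -> R) H', admissible N H Qb -> coef_ok x0 N a -> (H' <= H)%N ->
  \sum_n cmod (\sum_(h < H') expi (\sum_(j < m.+2) a n j * (h ^ j.+1)%N%:R)) ^+ s <=
  C * (H%:R ^+ s * H%:R `^ eps) * Num.sqrt ((1 + N%:R * lam al m N) * N%:R).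
Proof.
move=> eps0.
have [C C0 hC] := @vinogradov_mean_value R m.+2 eps isT eps0.
pose K := C * s.+1%:R ^+ m.+2 * K4 al t m s * (2 + eps^-1).
have K40 : 0 <= K4 al t m s.
  have g0 := ltW (g3_gt0 al m); have s0 := normr_ge0 (t * gbinom al m.+2 * (al - m.+2%:R)).
  have p0 : 0 <= 2 ^+ m.+3 :> R by rewrite exprn_ge0.
  have n0 i : 0 <= i%:R :> R by rewrite ler0n.
  have k10 : 0 <= K1 al t m.
    exact: mulr_ge0 (addr_ge0 (mulr_ge0 (n0 2) s0) (n0 2)) (addr_ge0 (divr_ge0 (mulr_ge0 (n0 4) p0) (mulr_ge0 s0 g0)) ler01).
  have c20 : 0 <= c2 al t m s by exact: addr_ge0 (n0 2) (mulr_ge0 (mulr_ge0 (n0 _) s0) (n0 _)).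
  have k20 : 0 <= K2 al t m s.
    exact: mulr_ge0 (divr_ge0 (mulr_ge0 (n0 4) c20) (mulr_ge0 (n0 _) (mulr_ge0 s0 g0))) p0.
  have k30 : 0 <= K3 al t m s.
    exact: addr_ge0 (addr_ge0 (ler0n _ _) (mulr_ge0 (mulr_ge0 (mulr_ge0 (ler0n _ _) (ler0n _ _)) s0) (addr_ge0 k20 ler01))) (mulr_ge0 (ler0n _ _) k20).
  apply: mulr_ge0 k30; apply: mulr_ge0 k10.
  exact: mulr_ge0 (mulr_ge0 (n0 _) (mulr_ge0 (n0 2) (addr_ge0 ler01 (sqr_ge0 _)))) (mulr_ge0 (n0 _) (n0 _)).
have K0 : 0 <= K.
  apply: mulr_ge0 (addr_ge0 (ler0n _ _) _); last by rewrite invr_ge0 ltW.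
  exact: mulr_ge0 (mulr_ge0 (ltW C0) (exprn_ge0 _ (ler0n _ _))) K40.
exists (Num.sqrt K); first exact: sqrtr_ge0.
move=> x0 N H Qb a H' [[N0 H0 H2N] [HQ hle hge]] ha H'H.
have s0 : (0 < s)%N by rewrite tri_gt0.
have HR : 0 < (H%:R : R) by rewrite ltr0n.
have [->|H'0] := posnP H'.
  rewrite big1 ?mulr_ge0 ?sqrtr_ge0 ?exprn_ge0 ?powR_ge0//.
  by move=> i _; rewrite big_ord0 cmod0 expr0n gtn_eqF.
pose Y : R := (1 + N%:R * lam al m N) * N%:R.
have Y0 : 0 <= Y by rewrite !mulr_ge0 ?addr_ge0 ?mulr_ge0 ?powR_ge0.
pose W : R := K4 al t m s * ((s * H ^ m.+2).+1%:R * (s * H ^ m.+1).+1%:R) * (Y * (1 + harm R H)).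
have hh : 0 <= 1 + harm R H by rewrite addr_ge0// sumr_ge0// => i _; rewrite invr_ge0.
have W0 : 0 <= W by exact: mulr_ge0 (mulr_ge0 K40 (mulr_ge0 (ler0n _ _) (ler0n _ _))) (mulr_ge0 Y0 hh).
apply: (@le_trans _ _ (Num.sqrt (#|vinogradov m.+2 s H'|)%:R *
  Num.sqrt ((\prod_(j < m) (s * H' ^ j.+1).+1)%N%:R * W))).
  apply: moment_bound => eta eta1.
  apply: le_trans (power_large_sieve al_lt c0_neq0 N0 H0 s0 H2N HQ hle hge x0 eta1).
  pose f (v1 v2 : nat) : R := cmod (\sum_n eta n * expi (v1%:R * Acoef al t m (N + n)%N%:R + v2%:R * Bcoef al t x0 m (N + n)%N%:R)) ^+ 2.
  have f0 v1 v2 : 0 <= f v1 v2 by rewrite sqr_ge0.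
  apply: (@le_trans _ _ (\sum_(v1 < (s * H' ^ m.+2).+1) \sum_(v2 < (s * H' ^ m.+1).+1) f v1 v2)).
    rewrite le_eqVlt; apply/orP; left; apply/eqP; apply: eq_bigr => v1 _; apply: eq_bigr => v2 _.
    by congr (cmod _ ^+ 2); apply: eq_bigr => n _; have [-> ->] := ha n.
  have le j : ((s * H' ^ j).+1 <= (s * H ^ j).+1)%N.
    by rewrite ltnS leq_mul2l; case: j => [|j]; rewrite ?orbT// leq_exp2r// H'H orbT.
  apply: le_trans (sum_shift_le (a := 0) (f := fun v1 => \sum_(v2 < (s * H' ^ m.+1).+1) f v1 v2) _ (le m.+2)) _.
    by move=> i; apply: sumr_ge0.
  apply: ler_sum => v1 _; exact: (sum_shift_le (a := 0) (f := f v1) _ (le m.+1)).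
rewrite -sqrtrM//.
apply: (@le_trans _ _ (Num.sqrt (K * ((H%:R ^+ s * H%:R `^ eps) ^+ 2) * Y))); last first.
  have X0 : 0 <= H%:R ^+ s * H%:R `^ eps :> R by exact: mulr_ge0 (exprn_ge0 _ (ltW HR)) (powR_ge0 _ _).
  rewrite -/Y; move: X0; move: (_ * _ `^ eps) => X X0.
  by rewrite (sqrtrM Y (mulr_ge0 K0 (sqr_ge0 X))) (sqrtrM _ K0) sqrtr_sqr ger0_norm.
apply: ler_wsqrtr.
have v1 : (#|vinogradov m.+2 s H'|)%:R <= C * (H%:R ^+ s * H%:R `^ eps).
  apply: le_trans (hC _ H'0) _; rewrite ler_wpM2l ?(ltW C0)//.
  rewrite -powR_mulrn ?(ltW HR)// -powRD; last by rewrite (gt_eqF HR) implybT.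
  by rewrite ge0_ler_powR ?nnegrE ?addr_ge0 ?(ltW eps0)// ler_nat.
have v2 : (\prod_(j < m) (s * H' ^ j.+1).+1)%N%:R * ((s * H ^ m.+2).+1%:R * (s * H ^ m.+1).+1%:R) <=
   s.+1%:R ^+ m.+2 * H%:R ^+ s :> R.
  rewrite -!natrX -!natrM ler_nat.
  apply: leq_trans (prod_succ_le s m.+2 H0).
  rewrite !big_ord_recr/= -mulnA [X in (_ <= _ * X)%N]mulnC leq_mul//.
  apply: leq_prod => i _; rewrite ltnS leq_mul2l leq_exp2r// H'H orbT//.
have v3 := harm_le eps0 H0.
apply: (@le_trans _ _ ((C * (H%:R ^+ s * H%:R `^ eps)) * (K4 al t m s * (s.+1%:R ^+ m.+2 * H%:R ^+ s) * (Y * ((2 + eps^-1) * H%:R `^ eps))))).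
  apply: ler_pM => //.
    exact: mulr_ge0 (ler0n _ _) W0.
  have -> : (\prod_(j < m) (s * H' ^ j.+1).+1)%N%:R * W = K4 al t m s *
     ((\prod_(j < m) (s * H' ^ j.+1).+1)%N%:R * ((s * H ^ m.+2).+1%:R * (s * H ^ m.+1).+1%:R)) * (Y * (1 + harm R H)).
    by rewrite /W; ring.
  apply: ler_pM (ler_wpM2l K40 v2) (ler_wpM2l Y0 v3); last exact: mulr_ge0.
  by apply: mulr_ge0 K40 _; exact: mulr_ge0 (ler0n _ _) (mulr_ge0 (ler0n _ _) (ler0n _ _)).
by rewrite le_eqVlt; apply/orP; left; apply/eqP; rewrite /K; ring.
Qed.

End ShiftedMoments.

(** * Weyl sums with the phase t n^al + n x *)

Section SummationTools.
Variable R : realType.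
Implicit Types (z w F : nat -> R[i]).

Lemma abel_summation z w H : \sum_(h < H.+1) z h * w h =
  (\sum_(h < H.+1) z h) * w H + \sum_(h < H) (\sum_(i < h.+1) z i) * (w h - w h.+1).
Proof.
elim: H => [|H IH]; first by rewrite !big_ord1 big_ord0 addr0.
rewrite big_ord_recr/= IH [in RHS]big_ord_recr/= [X in _ = _ + X]big_ord_recr/=; ring.
Qed.

Lemma abel_le z w H (d : R) : 0 <= d -> (forall h, cmod (w h) <= 1) ->
  (forall h, (h.+1 < H)%N -> cmod (w h - w h.+1) <= d) ->
  cmod (\sum_(h < H) z h * w h) <=
  cmod (\sum_(h < H) z h) + d * \sum_(h < H) cmod (\sum_(i < h.+1) z i).
Proof.
move=> d0; case: H => [|H] w1 wd; first by rewrite !big_ord0 cmod0 mulr0 addr0.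
rewrite abel_summation (le_trans (ler_cmodD _ _))// lerD//.
  by rewrite cmodM ler_piMr ?cmod_ge0.
rewrite (le_trans (ler_cmod_sum _ _ _))//.
apply: (@le_trans _ _ (d * \sum_(h < H) cmod (\sum_(i < h.+1) z i))).
  rewrite mulr_sumr; apply: ler_sum => h _.
  by rewrite cmodM mulrC ler_wpM2r ?cmod_ge0// wd// ltnS ltn_ord.
by rewrite ler_wpM2l// [leRHS]big_ord_recr/= lerDl cmod_ge0.
Qed.

Lemma cmod_expiB (a b : R) : cmod (expi a - expi b) <= `|a - b|.
Proof.
have -> : expi a - expi b = expi b * (expi (a - b) - 1) by rewrite mulrBr mulr1 -expiD [b + _]addrC subrK.
by rewrite cmodM cmod_expi mul1r nrm_le.
Qed.

Lemma sum_shift_dist F P h : (forall n, cmod (F n) <= 1) ->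
  cmod (\sum_(n < P) F n - \sum_(n < P) F (n + h)%N) <= 2 * h%:R.
Proof.
move=> F1; elim: h => [|h IH].
  by under [X in _ - X]eq_bigr do rewrite addn0; rewrite subrr cmod0 mulr0.
have e : \sum_(n < P) F (n + h)%N - \sum_(n < P) F (n + h.+1)%N = F h - F (P + h)%N.
  elim: P {IH} => [|P IHP]; first by rewrite !big_ord0 add0n !subrr.
  by rewrite !big_ord_recr/= opprD addrACA IHP addnS addSn; ring.
rewrite -(subrK (\sum_(n < P) F (n + h)%N) (\sum_(n < P) F n)) -addrA e.
rewrite (le_trans (ler_cmodD _ _))// -[h.+1%:R]natr1 mulrDr mulr1 lerD//.
by rewrite (le_trans (ler_cmodD _ _))// cmodN (lerD (F1 _) (F1 _)).
Qed.

Lemma shift_average F P H : (forall n, cmod (F n) <= 1) ->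
  H%:R * cmod (\sum_(n < P) F n) <=
  \sum_(n < P) cmod (\sum_(h < H) F (n + h)%N) + 2 * H%:R ^+ 2.
Proof.
move=> F1.
apply: (@le_trans _ _ (cmod (\sum_(h < H) \sum_(n < P) F (n + h)%N) + \sum_(h < H) 2 * h%:R)).
  have -> : H%:R * cmod (\sum_(n < P) F n) = cmod (\sum_(h < H) \sum_(n < P) F n).
    by rewrite sumr_const card_ord -[(\sum_(n < P) F n) *+ H]mulr_natl cmodM -(rmorph_nat (@real_complex R)) cmodC normr_nat.
  have -> : \sum_(h < H) \sum_(n < P) F n = \sum_(h < H) \sum_(n < P) F (n + h)%N +
     \sum_(h < H) (\sum_(n < P) F n - \sum_(n < P) F (n + h)%N).
    by rewrite -big_split/=; apply: eq_bigr => h _; rewrite addrC subrK.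
  rewrite (le_trans (ler_cmodD _ _))// lerD// (le_trans (ler_cmod_sum _ _ _))//.
  by apply: ler_sum => h _; exact: sum_shift_dist.
rewrite lerD//; first by rewrite exchange_big/= ler_cmod_sum.
apply: (@le_trans _ _ (\sum_(h < H) 2 * H%:R)).
  by apply: ler_sum => h _; rewrite ler_wpM2l// ler_nat ltnW.
by rewrite sumr_const card_ord -[leLHS]mulr_natr expr2 mulrA.
Qed.

End SummationTools.

Section WeylSum.
Variable R : realType.
Variables (al t : R) (m : nat).
Hypothesis al_lt : al < m.+3%:R.
Hypothesis c0_neq0 : t * gbinom al m.+2 * (al - m.+2%:R) != 0.

Local Notation s := (tri m.+2).
Local Notation rho := ((2 * s%:R)^-1 : R).

(** The power mean inequality over at most 2N starting points; the s-th root turns the square root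
    saving into the exponent 1/(2s). *)
Lemma shifted_mean (eps : R) : 0 < eps -> exists2 C : R, 0 <= C &
  forall x0 N H Qb (a : 'I_(H * Qb) -> nat -> R) H', admissible al m N H Qb -> coef_ok al t m x0 N a -> (H' <= H)%N ->
  \sum_n cmod (\sum_(h < H') expi (\sum_(j < m.+2) a n j * (h ^ j.+1)%N%:R)) <=
  C * (H%:R * (N%:R * N%:R `^ eps)) * (((1 + N%:R * lam al m N) / N%:R) `^ rho).
Proof.
move=> eps0; have [C C0 hC] := shifted_moment al_lt c0_neq0 eps0.
exists (2 * (1 + C)); first by rewrite mulr_ge0// addr_ge0.
move=> x0 N H Qb a H' ad ca hH; have {}hC := hC _ _ _ _ _ _ ad ca hH.
have [[N0 H0 H2N] [HQ _ _]] := ad.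
have NR : 1 <= (N%:R : R) by rewrite ler1n.
have Np : 0 < (N%:R : R) by rewrite ltr0n.
have s0 : (0 < s)%N by rewrite tri_gt0.
set X := \sum_n _; set q := _ `^ rho.
set Y := 1 + N%:R * lam al m N in hC q *.
have Y0 : 0 <= Y by rewrite addr_ge0// mulr_ge0// powR_ge0.
have X0 : 0 <= X by apply: sumr_ge0 => i _; exact: cmod_ge0.
have q0 : 0 <= q by exact: powR_ge0.
have Ne : 1 <= (N%:R : R) `^ eps by have := ler_powR NR (ltW eps0); rewrite powRr0.
have C10 : 0 <= 1 + C by rewrite addr_ge0.
rewrite -(ler_pXn2r s0) ?nnegrE//; last first.
  by apply: mulr_ge0 q0; apply: mulr_ge0 (mulr_ge0 _ _); rewrite ?mulr_ge0 ?powR_ge0.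
have qs : q ^+ s = Num.sqrt (Y / N%:R).
  rewrite /q -powR_mulrn ?powR_ge0// -powRrM.
  have -> : rho * s%:R = 2^-1 by rewrite invfM -mulrA mulVf ?mulr1// pnatr_eq0 -lt0n.
  by rewrite powR12_sqrt// divr_ge0.
have sqY : Num.sqrt (Y * N%:R) = N%:R * q ^+ s.
  have -> : Y * N%:R = (Y / N%:R) * N%:R ^+ 2 by field; rewrite gt_eqF.
  by rewrite sqrtrM ?divr_ge0// sqrtr_sqr ger0_norm// qs mulrC.
rewrite sqY in hC.
have PN : ((H * Qb)%N%:R : R) <= 2 * N%:R by rewrite -natrM ler_nat.
apply: (@le_trans _ _ ((2 * N%:R) ^+ s.-1 * (C * (H%:R ^+ s * H%:R `^ eps) * (N%:R * q ^+ s)))).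
  have h := @exprn_sum_le R _ predT (fun n : 'I_(H * Qb) => cmod (\sum_(h < H') expi (\sum_(j < m.+2) a n j * (h ^ j.+1)%N%:R))) s.-1 (fun n => cmod_ge0 _).
  rewrite prednK// in h; apply: (le_trans h).
  apply: ler_pM => //; first by apply: sumr_ge0 => n _; rewrite exprn_ge0// cmod_ge0.
  rewrite lerXn2r ?nnegrE ?mulr_ge0// cardT size_enum_ord//.
have -> : (2 * (1 + C) * (H%:R * (N%:R * N%:R `^ eps)) * q) ^+ s =
  2 ^+ s * (1 + C) ^+ s * H%:R ^+ s * N%:R ^+ s * (N%:R `^ eps) ^+ s * q ^+ s by rewrite !exprMn; ring.
have -> : (2 * N%:R) ^+ s.-1 * (C * (H%:R ^+ s * H%:R `^ eps) * (N%:R * q ^+ s)) =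
  2 ^+ s.-1 * C * H%:R ^+ s * N%:R ^+ s * H%:R `^ eps * q ^+ s.
  by rewrite exprMn -[in N%:R ^+ s](prednK s0) exprSr; ring.
have Hs : 0 <= H%:R ^+ s :> R by rewrite exprn_ge0.
have Ns : 0 <= N%:R ^+ s :> R by rewrite exprn_ge0.
have h2 : 2 ^+ s.-1 <= 2 ^+ s :> R by rewrite ler_weXn2l ?ler1n// leq_pred.
have hC1 : C <= (1 + C) ^+ s.
  apply: (@le_trans _ _ (1 + C)); first by rewrite lerDr.
  by rewrite -{1}[1 + C]expr1 ler_weXn2l// lerDl.
have hE : H%:R `^ eps <= (N%:R `^ eps) ^+ s :> R.
  apply: (@le_trans _ _ (N%:R `^ eps)).
    by rewrite ge0_ler_powR ?nnegrE ?(ltW eps0)// ler_nat (leq_trans _ H2N)// -mulnn leq_pmull.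
  by rewrite -{1}[_ `^ eps]expr1 ler_weXn2l.
have p2 i : 0 <= 2 ^+ i :> R by rewrite exprn_ge0.
rewrite ler_wpM2r ?exprn_ge0//; apply: ler_pM hE; rewrite ?powR_ge0//.
  exact: mulr_ge0 (mulr_ge0 (mulr_ge0 (p2 _) C0) Hs) Ns.
rewrite ler_wpM2r// ler_wpM2r//; exact: ler_pM.
Qed.

End WeylSum.

(** * The bound for sums over a dyadic range *)

Section WeylBound.
Variable R : realType.
Variables (al t : R) (m : nat).
Hypothesis al_lt : al < m.+3%:R.
Hypothesis al_ge : m.+3%:R <= 2 * al.
Hypothesis c0_neq0 : t * gbinom al m.+2 * (al - m.+2%:R) != 0.

Local Notation s := (tri m.+2).
Local Notation rho := ((2 * s%:R)^-1 : R).

Lemma exists_admissible N : (0 < N)%N ->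
  exists H Qb, admissible al m N H Qb /\ (N <= H * Qb)%N.
Proof.
move=> N0; have NR : 1 <= (N%:R : R) by rewrite ler1n.
have Np : 0 < (N%:R : R) by rewrite ltr0n.
have k0 : 0 < m.+3%:R :> R by rewrite ltr0n.
(* The solution of x^(m+3) [lam N] = 1. Rounding it down at most halves it, hence the factor 2^(m+3)
   in [admissible]. *)
pose x : R := N%:R `^ ((m.+3%:R - al) / m.+3%:R).
have e0 : 0 <= (m.+3%:R - al) / m.+3%:R by rewrite divr_ge0 ?(ltW k0)// subr_ge0 ltW.
have x1 : 1 <= x by have := ler_powR NR e0; rewrite powRr0.
have xk : x ^+ m.+3 * lam al m N = 1.
  rewrite -powR_mulrn ?powR_ge0// -powRrM mulfVK ?gt_eqF// /lam -powRD.
    by rewrite addrC subrKA subrr powRr0.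
  by rewrite (gt_eqF Np) implybT.
have x0 : 0 <= x by apply: le_trans x1.
have /andP[Hx xH] := truncn_itv x0.
set H := Num.truncn x in Hx xH.
have H0 : (0 < H)%N.
  by rewrite lt0n; apply/negP => /eqP h; move: xH; rewrite h ltNge x1.
have l0 : 0 < lam al m N by exact: lam_gt0.
exists H, (N %/ H).+1; split; last by rewrite mulnC ltnW// ltn_ceil.
(* x^2 <= N is where m+3 <= 2 al enters. *)
have H2 : (H ^ 2 <= N)%N.
  rewrite -(ler_nat R) natrX; apply: (@le_trans _ _ (x ^+ 2)); first by rewrite lerXn2r ?nnegrE.
  rewrite -powR_mulrn ?powR_ge0// -powRrM -[leRHS]powRr1 ?(ltW Np)// ler_powR//.
  by rewrite mulrAC ler_pdivrMr// mul1r; have := al_ge; lra.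
split; split => //.
- rewrite mulnS mul2n -addnn addnC leq_add//; first by rewrite mulnC leq_trunc_div.
  by rewrite (leq_trans _ H2)// -mulnn leq_pmull.
- by rewrite -[leRHS]xk ler_wpM2r ?(ltW l0)// lerXn2r ?nnegrE.
- rewrite -[leLHS]xk mulrA -exprMn ler_wpM2r ?(ltW l0)// lerXn2r ?nnegrE ?mulr_ge0//.
  by rewrite (le_trans (ltW xH))// -natrM ler_nat mul2n -addnn -addn1 leq_add2l.
Qed.

Lemma phase_expansion x (y h : R) : 0 < y -> 0 <= h ->
  t * (y + h) `^ al + (y + h) * x =
  (t * y `^ al + y * x) +
  (\sum_(j < m.+2) (t * gbinom al j.+1 * y `^ (al - j.+1%:R) + (j == 0 :> nat)%:R * x) * h ^+ j.+1 +
   t * y `^ al * taylor_rem al m.+3 (h / y)).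
Proof.
move=> y0 h0.
have -> : (y + h) `^ al = y `^ al * (1 + h / y) `^ al.
  rewrite -powRM ?(ltW y0)//; first by congr (_ `^ al); field; rewrite gt_eqF.
  by rewrite addr_ge0// divr_ge0// ltW.
have -> : (1 + h / y) `^ al = taylor_rem al m.+3 (h / y) +
    (1 + \sum_(j < m.+2) gbinom al (bump 0 j) * (h / y) ^+ bump 0 j).
  by rewrite /taylor_rem /taylor_poly horner_poly [X in _ - X]big_ord_recl gbinom0 mul1r expr0 subrK.
have -> : \sum_(j < m.+2) (t * gbinom al j.+1 * y `^ (al - j.+1%:R) + (j == 0 :> nat)%:R * x) * h ^+ j.+1 =
  t * y `^ al * (\sum_(j < m.+2) gbinom al (bump 0 j) * (h / y) ^+ bump 0 j) + h * x.
  rewrite [in RHS]mulr_sumr -[h * x]addr0.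
  under eq_bigr do rewrite mulrDl.
  rewrite big_split/=; congr (_ + _).
    apply: eq_bigr => j _; rewrite /bump/= add1n powRB; last by rewrite (gt_eqF y0) implybT.
    by rewrite powR_mulrn ?(ltW y0)// expr_div_n; ring.
  rewrite big_ord_recl/= big1 ?addr0; first by rewrite mul1r expr1 mulrC.
  by move=> i _; rewrite !mul0r.
by ring.
Qed.

Variable th : R.
Hypothesis th_ge0 : 0 <= th.
Hypothesis th_ge : al - m.+2%:R <= th.

(** Here N [lam N] is N^(al-m-2); the two assumptions on [th] bound the summands 1 and N [lam N] by
    N^th. *)
Lemma mean_factor_le N : (0 < N)%N ->
  ((1 + N%:R * lam al m N) / N%:R) `^ rho <= 2 * N%:R `^ ((th - 1) * rho).
Proof.
move=> N0; have NR : 1 <= (N%:R : R) by rewrite ler1n.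
have Np : 0 < (N%:R : R) by rewrite ltr0n.
have s0 : 0 < s%:R :> R by rewrite ltr0n tri_gt0.
have rho0 : 0 <= rho by rewrite invr_ge0 mulr_ge0// ltW.
have rho1 : rho <= 1.
  by rewrite invf_le1 ?mulr_gt0// -natrM ler1n muln_gt0 tri_gt0.
have h : (1 + N%:R * lam al m N) / N%:R <= 2 * N%:R `^ (th - 1).
  have e1 (be : R) : N%:R * N%:R `^ be = N%:R `^ (1 + be).
    by rewrite powRD ?powRr1 ?(ltW Np)// (gt_eqF Np) implybT.
  have -> : 2 * N%:R `^ (th - 1) = 2 * N%:R `^ th / N%:R.
    by rewrite -[in N%:R `^ th](subrKC 1 th) -e1; field; rewrite gt_eqF.
  rewrite ler_pM2r ?invr_gt0// /lam e1.
  have -> (q : R) : 2 * q = q + q by ring.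
  rewrite lerD//; first by have := ler_powR NR th_ge0; rewrite powRr0.
  by rewrite ler_powR// (le_trans _ th_ge)// -[m.+3%:R]natr1; lra.
apply: (@le_trans _ _ ((2 * N%:R `^ (th - 1)) `^ rho)).
  rewrite ge0_ler_powR// nnegrE; last by rewrite mulr_ge0// powR_ge0.
  by rewrite divr_ge0// addr_ge0// mulr_ge0// powR_ge0.
rewrite powRM ?powR_ge0// powRrM ler_wpM2r ?powR_ge0//.
by rewrite -[leRHS]powRr1// ler_powR// ler1n.
Qed.

Lemma weyl_bound (eps : R) : 0 < eps -> exists2 C : R, 0 <= C &
  forall N N1 x, (0 < N)%N -> (N <= N1 <= 2 * N)%N ->
  cmod (\sum_(N <= n < N1) expi (t * n%:R `^ al + n%:R * x)) <=
  C * N%:R `^ (1 - (1 - th) / (m.+3%:R * m.+2%:R) + eps).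
Proof.
move=> eps0; have [C1 C10 hC1] := shifted_mean al_lt c0_neq0 eps0.
have [Cr Cr0 hCr] := taylor_rem_lip al m.+2.
pose D := `|t| * Cr; have D0 : 0 <= D by rewrite mulr_ge0.
exists (2 * (1 + D) * C1 + 2); first by rewrite addr_ge0 ?mulr_ge0 ?addr_ge0.
move=> N N1 x N0 /andP[NN1 N1N].
have [H [Qb [ad NQ]]] := exists_admissible N0.
have [[_ H0 H2N] [HQ Hlam _]] := ad.
have NR : 1 <= (N%:R : R) by rewrite ler1n.
have Np : 0 < (N%:R : R) by rewrite ltr0n.
have HR : 0 < (H%:R : R) by rewrite ltr0n.
have HN : (H <= N)%N by rewrite (leq_trans _ H2N)// -mulnn leq_pmull.
pose F (n : nat) : R[i] := expi (t * (N + n)%N%:R `^ al + (N + n)%N%:R * x).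
have F1 n : cmod (F n) <= 1 by rewrite cmod_expi.
have -> : \sum_(N <= n < N1) expi (t * n%:R `^ al + n%:R * x) = \sum_(n < N1 - N) F n.
  rewrite -{1}[N]add0n big_addn big_mkord; apply: eq_bigr => n _; by rewrite /F addnC.
pose a (n : 'I_(H * Qb)) (j : nat) : R := t * gbinom al j.+1 * (N + n)%N%:R `^ (al - j.+1%:R) + (j == 0 :> nat)%:R * x.
have ca : coef_ok al t m ((m == 0)%:R * x) N a.
  by move=> n; split; rewrite /a /Acoef /Bcoef ?mul0r ?addr0.
pose Z (n : 'I_(H * Qb)) (h : nat) : R[i] := expi (\sum_(j < m.+2) a n j * (h ^ j.+1)%N%:R).
pose M := C1 * (H%:R * (N%:R * N%:R `^ eps)) * (((1 + N%:R * lam al m N) / N%:R) `^ rho).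
have hM H' : (H' <= H)%N -> \sum_n cmod (\sum_(h < H') Z n h) <= M.
  by move=> hH; exact: (hC1 _ _ _ _ _ _ ad ca hH).
(* The remainder phase changes by at most D/H from h to h+1, because H^(m+3) [lam N] <= 1, so
   removing it costs an average over partial sums. *)
have inner (n : 'I_(H * Qb)) : cmod (\sum_(h < H) F (n + h)%N) <=
   cmod (\sum_(h < H) Z n h) + D / H%:R * \sum_(h < H) cmod (\sum_(i < h.+1) Z n i).
  pose y : R := (N + n)%N%:R.
  have y0 : 0 < y by rewrite ltr0n addn_gt0 N0.
  have Ny : N%:R <= y by rewrite ler_nat leq_addr.
  pose w (h : nat) : R[i] := expi (t * y `^ al * taylor_rem al m.+3 (h%:R / y)).
  have -> : \sum_(h < H) F (n + h)%N = expi (t * y `^ al + y * x) * \sum_(h < H) Z n h * w h.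
    rewrite mulr_sumr; apply: eq_bigr => h _; rewrite /F addnA natrD -/y phase_expansion//.
    rewrite expiD [expi (\sum_(j < _) _ + _)]expiD; congr (_ * (expi _ * _)); apply: eq_bigr => j _.
    by rewrite natrX.
  rewrite cmodM cmod_expi mul1r; apply: abel_le.
  - by rewrite divr_ge0// ltW.
  - by move=> h; rewrite cmod_expi.
  move=> h hH; rewrite (le_trans (cmod_expiB _ _))// -mulrBr normrM distrC.
  have hy (i : nat) : (i <= H)%N -> (i%:R : R) <= y.
    by move=> iH; rewrite (le_trans _ Ny)// ler_nat (leq_trans iH).
  have u1 : 0 <= h%:R / y <= h.+1%:R / y.
    by rewrite divr_ge0 ?(ltW y0)//= ler_pM2r ?invr_gt0// ler_nat.
  have u2 : h.+1%:R / y <= 1 by rewrite ler_pdivrMr// mul1r hy// ltnW.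
  apply: le_trans (ler_wpM2l (normr_ge0 _) (hCr _ _ u1 u2)) _.
  rewrite normrM (ger0_norm (powR_ge0 _ _)) -mulrBl -[h.+1%:R - _]natrB// subSnn.
  have -> : `|t| * y `^ al * (Cr * (h.+1%:R / y) ^+ m.+2 * (1 / y)) = D * (h.+1%:R ^+ m.+2 * (y `^ al / y ^+ m.+3)).
    rewrite /D expr_div_n (exprS y m.+2) [(y * y ^+ _)^-1]invfM.
    move: (h.+1%:R ^+ m.+2) (y ^+ m.+2) => p q; ring.
  rewrite ler_wpM2l//.
  have -> : y `^ al / y ^+ m.+3 = y `^ (al - m.+3%:R).
    by rewrite powRB ?powR_mulrn ?(ltW y0)// (gt_eqF y0) implybT.
  apply: (@le_trans _ _ (H%:R ^+ m.+2 * lam al m N)).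
    apply: ler_pM; rewrite ?exprn_ge0 ?powR_ge0//; first by rewrite lerXn2r ?nnegrE// ler_nat ltnW.
    have neg : 0 <= m.+3%:R - al by rewrite subr_ge0 ltW.
    rewrite /lam -[al - _]opprB (powRN y) (powRN N%:R) lef_pV2 ?posrE ?powR_gt0//.
    by rewrite ge0_ler_powR ?nnegrE// ltW.
  rewrite -[leRHS]mul1r ler_pdivlMr//; apply: le_trans Hlam.
  by rewrite [H%:R ^+ m.+3]exprSr mulrAC.
have M0 : 0 <= M.
  by apply: le_trans (hM 0 _) => //; apply: sumr_ge0 => i _; exact: cmod_ge0.
have step : H%:R * cmod (\sum_(n < N1 - N) F n) <= (1 + D) * M + 2 * H%:R ^+ 2.
  apply: (le_trans (shift_average _ _ F1)); rewrite lerD2r.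
  apply: (@le_trans _ _ (\sum_(n < H * Qb) cmod (\sum_(h < H) F (n + h)%N))).
    apply: (sum_shift_le (a := 0) (f := fun n => cmod (\sum_(h < H) F (n + h)%N))).
      by move=> i; exact: cmod_ge0.
    by rewrite add0n (leq_trans _ NQ)// leq_subLR addnn -mul2n.
  apply: (le_trans (ler_sum _ (fun n _ => inner n))).
  rewrite big_split/= -mulr_sumr exchange_big/= mulrDl mul1r lerD ?hM//.
  apply: (@le_trans _ _ (D / H%:R * \sum_(h < H) M)).
    by rewrite ler_wpM2l ?divr_ge0 ?(ltW HR)//; apply: ler_sum => h _; apply: hM.
  rewrite sumr_const card_ord -[M *+ H]mulr_natr le_eqVlt; apply/orP; left; apply/eqP.
  by field; rewrite gt_eqF.
have tt : 2 * s%:R = m.+3%:R * m.+2%:R :> R by rewrite -!natrM tri2 mulnC.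
rewrite -tt.
have s1 : 1 <= s%:R :> R by rewrite ler1n tri_gt0.
(* The boundary error of the shifts is of order H <= N^(1/2), which is acceptable since the saving
   is at most 1/2. *)
have HNh : H%:R <= N%:R `^ (1 - (1 - th) / (2 * s%:R) + eps) :> R.
  apply: (@le_trans _ _ (N%:R `^ 2^-1)).
    rewrite powR12_sqrt// -[leLHS]ger0_norm// -sqrtr_sqr ler_wsqrtr// -natrX ler_nat//.
  rewrite ler_powR//.
  have : (1 - th) / (2 * s%:R) <= 2^-1.
    have s2 : 0 < 2 * s%:R :> R by rewrite mulr_gt0// (lt_le_trans ltr01).
    rewrite (ler_pdivrMr _ _ s2) mulrA mulVf ?mul1r ?pnatr_eq0//.
    by apply: le_trans s1; rewrite lerBlDr lerDl.
  by move: (_ / _) => q ?; lra.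
have ML : M <= 2 * C1 * H%:R * N%:R `^ (1 - (1 - th) / (2 * s%:R) + eps).
  apply: le_trans (ler_wpM2l _ (mean_factor_le N0)) _; first by rewrite !mulr_ge0 ?powR_ge0.
  have -> : 1 - (1 - th) / (2 * s%:R) + eps = 1 + eps + (th - 1) * rho by ring.
  rewrite powRD ?(gt_eqF Np) ?implybT// powRD ?(gt_eqF Np) ?implybT// powRr1//.
  by rewrite le_eqVlt; apply/orP; left; apply/eqP; ring.
rewrite -(ler_pM2l HR); apply: (le_trans step).
have -> (q : R) : H%:R * ((2 * (1 + D) * C1 + 2) * q) = (1 + D) * (2 * C1 * H%:R * q) + 2 * (H%:R * q) by ring.
rewrite lerD//; first by rewrite ler_wpM2l// addr_ge0.
by rewrite expr2 ler_wpM2l// ler_wpM2l.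
Qed.

End WeylBound.

(** * Fourier coefficients of functions of bounded variation *)

Section MonotoneIntegrals.
Variable R : realType.

Lemma le_of_le_add_div (a b c : R) : (forall Q : nat, (0 < Q)%N -> a <= b + c / Q%:R) -> a <= b.
Proof.
move=> h; apply/ler_addgt0Pr => e e0.
have [c0|c0] := lerP c 0.
  apply: le_trans (h 1%N isT) _; rewrite lerD2l divr1; exact: le_trans c0 (ltW e0).
have ce : 0 <= c / e by rewrite divr_ge0 ?ltW.
have hb := archi_boundP ce.
have Q0 : (0 < Num.bound (c / e))%N.
  by rewrite -(ltr_nat R); apply: le_lt_trans hb.
apply: le_trans (h _ Q0) _; rewrite lerD2l ler_pdivrMr ?ltr0n// mulrC -ler_pdivrMr//.
exact: ltW.
Qed.

Lemma sum_parts (P T : nat -> R) Q :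
  \sum_(q < Q) P q * (T q.+1 - T q) = P Q * T Q - P 0%N * T 0%N - \sum_(q < Q) (P q.+1 - P q) * T q.+1.
Proof.
elim: Q => [|Q IH]; first by rewrite !big_ord0 subrr subr0.
by rewrite !big_ord_recr/= IH; ring.
Qed.

Local Notation mu := (@lebesgue_measure R).

Variables (P k T : R -> R) (M K tau L : R).
Hypothesis P_nd : nondecreasing_fun P.
Hypothesis P_le : forall x, `|P x| <= M.
Hypothesis k_cont : continuous k.
Hypothesis T_der : forall x : R, is_derive x 1 T (k x).
Hypothesis k_le : forall x, `|k x| <= K.
Hypothesis T_le : forall x, `|T x| <= tau.
Hypothesis L_gt0 : 0 < L.

Lemma integrable_bounded_itv (f : R -> R) (a b B : R) : measurable_fun setT f -> (forall x, `|f x| <= B) ->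
  mu.-integrable `[a, b] (EFin \o f).
Proof.
move=> mf fB; apply: measurable_bounded_integrable => //.
- rewrite /= lebesgue_measure_itv/=; case: ifP => _; by rewrite -?EFinB ltry.
- exact: measurable_funS mf.
- by exists B; split; [exact: num_real|move=> x Bx y _; apply: le_trans (ltW Bx)].
Qed.

Let mP : measurable_fun setT P. Proof. exact: nondecreasing_measurable. Qed.
Let mk : measurable_fun setT k. Proof. exact: continuous_measurable_fun. Qed.
Let mPk : measurable_fun setT (fun x => P x * k x). Proof. exact: measurable_funM. Qed.

Let iPk (a b : R) : mu.-integrable `[a, b] (EFin \o (fun x => P x * k x)).
Proof.
apply: (@integrable_bounded_itv _ _ _ (M * K)) => // x.
by rewrite normrM ler_pM.
Qed.

Lemma FTC_itv (a b : R) : a < b -> \int[mu]_(x in `[a, b]) k x = T b - T a.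
Proof.
move=> ab; have cT : continuous T.
  by move=> x; apply/differentiable_continuous/derivable1_diffP; have := T_der x; case.
rewrite /Rintegral (@continuous_FTC2 R k T a b ab)//.
- exact: continuous_subspaceT.
- split; first by move=> x _; have := T_der x; case.
    by apply: cvg_at_right_filter; exact: cT.
  by apply: cvg_at_left_filter; exact: cT.
- by move=> x _; rewrite derive1E (@derive_val _ _ _ _ _ _ _ (T_der x)).
Qed.

Lemma integral_cell (a b : R) : a < b ->
  `|\int[mu]_(x in `[a, b]) (P x * k x) - P a * (T b - T a)| <= (P b - P a) * K * (b - a).
Proof.
move=> ab; rewrite -FTC_itv// -RintegralZl//; last by apply: (@integrable_bounded_itv _ _ _ K).
have iak : mu.-integrable `[a, b] (EFin \o (fun x => P a * k x)).
  apply: (@integrable_bounded_itv _ _ _ (M * K)) => [|x]; last by rewrite normrM ler_pM.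
  by apply: measurable_funM => //; exact: measurable_cst.
rewrite -RintegralB//.
have md : measurable_fun setT (fun x => P x * k x - P a * k x).
  apply: measurable_funB => //; apply: measurable_funM => //; exact: measurable_cst.
have dB x : `|P x * k x - P a * k x| <= M * K + M * K.
  by apply: le_trans (ler_normB _ _) _; rewrite !normrM lerD// ler_pM.
apply: le_trans (le_normr_Rintegral _ _) _ => //.
  exact: integrable_bounded_itv md dB.
have e : \int[mu]_(x in `[a, b]) ((P b - P a) * K) = (P b - P a) * K * (b - a).
  by rewrite Rintegral_cst//= ?lebesgue_measure_itv/= lte_fin ab -EFinB.
rewrite -e; apply: le_Rintegral => //.
- apply: (@integrable_bounded_itv _ _ _ (M * K + M * K)) => [|x]; last by rewrite normr_id.
  exact: measurableT_comp.
- by apply: (@integrable_bounded_itv _ _ _ `|(P b - P a) * K|) => //; exact: measurable_cst.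
move=> x /=; rewrite in_itv/= => /andP[ax xb].
rewrite -mulrBl normrM ler_pM// ger0_norm ?subr_ge0 ?P_nd// lerD2r P_nd//.
Qed.

(** Integration by parts for a merely monotone [P], done on Riemann sums. Freezing [P] at the left
    end of each of Q cells costs O(1/Q) in total, since the increments of [P] telescope; summation
    by parts then leaves only values of [T]. *)
Lemma integral_monotone_le : `|\int[mu]_(x in `[0, L]) (P x * k x)| <= 4 * M * tau.
Proof.
apply: (@le_of_le_add_div _ _ (2 * M * K * L)) => Q Q0.
have QR : 0 < (Q%:R : R) by rewrite ltr0n.
pose y (q : nat) : R := q%:R * (L / Q%:R).
have h0 : 0 < L / Q%:R by rewrite divr_gt0.
have yS q : y q < y q.+1 by rewrite /y ltr_pM2r// ltr_nat.
have y0 : y 0%N = 0 by rewrite /y mul0r.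
have yQ : y Q = L by rewrite /y; field; rewrite gt_eqF.
have split q : \int[mu]_(x in `[0, y q]) (P x * k x) =
   \sum_(i < q) \int[mu]_(x in `[y i, y i.+1]) (P x * k x).
  elim: q => [|q IH]; first by rewrite big_ord0 y0 set_itv1 Rintegral_set1.
  rewrite big_ord_recr/= -IH.
  have yq0 : 0 <= y q by rewrite /y mulr_ge0// ltW.
  have h := @Rintegral_itvB R (fun x => P x * k x) (BLeft 0) (BRight (y q.+1)) (y q) (iPk 0 (y q.+1)).
  rewrite -[LHS](subrK (\int[mu]_(x in `[0, y q]) (P x * k x))) h ?bnd_simp ?(ltW (yS q))//.
  rewrite Rintegral_itv_obnd_cbnd 1?addrC//.
  have := iPk (y q) (y q.+1); apply: integrableS => //; exact: subset_itv_oc_cc.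
have sp := split Q; rewrite yQ in sp; rewrite {}sp.
have -> : \sum_(i < Q) \int[mu]_(x in `[y i, y i.+1]) (P x * k x) =
  \sum_(i < Q) P (y i) * (T (y i.+1) - T (y i)) +
  \sum_(i < Q) (\int[mu]_(x in `[y i, y i.+1]) (P x * k x) - P (y i) * (T (y i.+1) - T (y i))).
  by rewrite -big_split/=; apply: eq_bigr => i _; rewrite addrC subrK.
have dP q : 0 <= P (y q.+1) - P (y q) by rewrite subr_ge0 P_nd// ltW.
have tele : \sum_(i < Q) (P (y i.+1) - P (y i)) <= 2 * M.
  rewrite -(big_mkord predT (fun i => P (y i.+1) - P (y i))) telescope_sumr//.
  rewrite mulrDl mul1r lerD//; first exact: le_trans (ler_norm _) (P_le _).
  by have /ler_normlP[] := P_le (y 0%N).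
have M0 : 0 <= M by apply: le_trans (P_le 0).
have K0 : 0 <= K by apply: le_trans (k_le 0).
have t0 : 0 <= tau by apply: le_trans (T_le 0).
apply: le_trans (ler_normD _ _) _; apply: lerD; last first.
  apply: le_trans (ler_norm_sum _ _ _) _.
  apply: (@le_trans _ _ (\sum_(i < Q) (P (y i.+1) - P (y i)) * (K * (L / Q%:R)))).
    apply: ler_sum => i _; apply: le_trans (integral_cell (yS i)) _.
    rewrite -mulrA ler_wpM2l// ler_wpM2l// /y -mulrBl -[i.+1%:R - _]natrB// subSnn mul1r//.
  rewrite -mulr_suml.
  have -> : 2 * M * K * L / Q%:R = 2 * M * (K * (L / Q%:R)) by ring.
  by rewrite ler_wpM2r// mulr_ge0// ltW.
rewrite (sum_parts (fun q => P (y q)) (fun q => T (y q))).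
have -> : 4 * M * tau = M * tau + M * tau + 2 * M * tau by ring.
apply: le_trans (ler_normB _ _) _; apply: lerD.
  by apply: le_trans (ler_normB _ _) _; rewrite !normrM lerD// ler_pM.
apply: le_trans (ler_norm_sum _ _ _) _.
apply: (@le_trans _ _ (\sum_(i < Q) (P (y i.+1) - P (y i)) * tau)).
  by apply: ler_sum => i _; rewrite normrM (ger0_norm (dP _)) ler_wpM2l.
by rewrite -mulr_suml ler_wpM2r.
Qed.

End MonotoneIntegrals.

(** * Functions of bounded variation on the torus *)

Section TorusIntegrals.
Variable R : realType.
Local Notation mu := (@lebesgue_measure R).
Local Notation tm := (torus_measure R).
Local Notation L := (2 * pi : R).

Lemma twopi_gt0 : 0 < L.
Proof. by rewrite mulr_gt0// pi_gt0. Qed.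

Lemma periodic_int (V : zmodType) (f : R -> V) (z : int) x : periodic f L -> f (x + z%:~R * L) = f x.
Proof.
have e (n : nat) : n%:~R * L = L *+ n by rewrite -pmulrn (mulr_natl L n).
move=> pf; case: z => n; first by rewrite e periodicn.
by rewrite NegzE mulrNz mulNr -[in RHS](subrK (n.+1%:~R * L) x) e periodicn.
Qed.

(** The torus measure lives on the whole line, so integrands must be measurable there, while the
    decomposition into monotone functions is available on one period only. *)
Lemma periodic_measurable (a f : R -> R) : periodic a L -> {in `[0, L]%R, a =1 f} ->
  measurable_fun setT f -> measurable_fun setT a.
Proof.
move=> pa af mf; have L0 := twopi_gt0.
pose r (x : R) : R := x - (Num.floor (x / L))%:~R * L.
have -> : a = f \o r.
  apply/funext => x /=; rewrite -af.
    by rewrite /r -mulNr -mulrNz periodic_int.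
  rewrite in_itv/= /r; apply/andP; split.
    by rewrite subr_ge0 -ler_pdivlMr// ge_floor.
  rewrite lerBlDr; have -> (v : R) : L + v * L = (1 + v) * L by ring.
  rewrite -ler_pdivrMr//.
  by have := floorD1_gt (x / L); rewrite intrD addrC => /ltW.
apply: measurableT_comp => //.
have mfl : measurable_fun setT (fun x : R => (Num.floor (x / L))%:~R : R).
  apply: nondecreasing_measurable => // x y xy.
  by rewrite ler_int; apply: le_floor; rewrite ler_pM2r ?invr_gt0.
apply: measurable_funB => //; apply: measurable_funM => //; exact: measurable_cst.
Qed.

Lemma BV_monotone_split (a : R -> R) : bounded_variation 0 L a ->
  exists P Q M, [/\ nondecreasing_fun P, nondecreasing_fun Q,
     (forall x, `|P x| <= M :> R), (forall x, `|Q x| <= M) & {in `[0, L]%R, a =1 P \- Q}].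
Proof.
move=> bv; have L0 := twopi_gt0.
(* Clamping to the period extends the two variation functions to bounded monotone functions on the
   line. *)
pose c (x : R) : R := Num.max 0 (Num.min x L).
have c_nd : nondecreasing_fun c.
  by move=> x y xy; rewrite /c le_max2// le_min2.
have c_in x : c x \in `[0, L]%R.
  by rewrite in_itv/= /c le_max lexx/= ge_max (ltW L0) ge_min lexx orbT.
have c_id x : x \in `[0, L]%R -> c x = x.
  by rewrite in_itv/= => /andP[x0 xL]; rewrite /c min_l// max_r.
pose P0 := fine \o pos_tv 0 a; pose Q0 := fine \o neg_tv 0 a.
have P0_nd : {in `[0, L]%R &, nondecreasing_fun P0}.
  by apply: fine_neg_tv_nondecreasing; exact/bounded_variationN.
have Q0_nd : {in `[0, L]%R &, nondecreasing_fun Q0} by exact: fine_neg_tv_nondecreasing.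
have i0 : 0 \in `[0, L]%R by rewrite in_itv/= lexx ltW.
have iL : L \in `[0, L]%R by rewrite in_itv/= lexx ltW.
have bnd (f : R -> R) : {in `[0, L]%R &, nondecreasing_fun f} ->
    forall x, `|f (c x)| <= `|f 0| + `|f L|.
  move=> fnd x; have := c_in x; rewrite in_itv/= => /andP[h1 h2].
  have k1 := fnd _ _ i0 (c_in x) h1; have k2 := fnd _ _ (c_in x) iL h2.
  have n1 := ler_norm (f L); have n2 : - f 0 <= `|f 0| by rewrite -normrN ler_norm.
  rewrite ler_norml; apply/andP; split.
    by have := normr_ge0 (f L); lra.
  by have := normr_ge0 (f 0); lra.
exists (P0 \o c), (Q0 \o c), (`|P0 0| + `|P0 L| + (`|Q0 0| + `|Q0 L|)); split.
- by move=> x y xy; apply: P0_nd => //; exact: c_nd.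
- by move=> x y xy; apply: Q0_nd => //; exact: c_nd.
- by move=> x; apply: le_trans (bnd _ P0_nd x) _; rewrite lerDl addr_ge0.
- by move=> x; apply: le_trans (bnd _ Q0_nd x) _; rewrite lerDr addr_ge0.
- by move=> x xi; rewrite /= c_id//; exact: (bounded_variation_pos_neg_tvE bv xi).
Qed.

Lemma torus_fin : (tm setT < +oo)%E.
Proof.
rewrite /torus_measure /= /mrestr setTI lebesgue_measure_itv/=.
by case: ifP => _; rewrite -?EFinB ltry.
Qed.

Lemma torus_integrable (f : R -> R) (B : R) : measurable_fun setT f -> (forall x, `|f x| <= B) ->
  tm.-integrable setT (EFin \o f).
Proof.
move=> mf fB; apply: measurable_bounded_integrable => //.
- exact: torus_fin.
- by exists B; split; [exact: num_real|move=> x Bx y _; apply: le_trans (ltW Bx)].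
Qed.

Lemma torus_Rintegral (f : R -> R) (B : R) : measurable_fun setT f -> (forall x, `|f x| <= B) ->
  Rintegral tm setT f = \int[mu]_(x in `[0, L]) f x.
Proof.
move=> mf fB; rewrite /Rintegral; congr fine.
rewrite (@negligible_integral _ _ _ tm setT (~` `[0, L])) //.
- rewrite setTD setCK; apply: eq_measure_integral => A mA AL.
  by rewrite /torus_measure /= /mrestr setIidl.
- exact: measurableC.
- exact: torus_integrable fB.
- by rewrite /torus_measure /= /mrestr setICl measure0.
Qed.

Variable a : R -> R.
Hypothesis a_per : periodic a L.
Hypothesis a_bv : bounded_variation 0 L a.

Lemma BV_measurable_bounded : measurable_fun setT a /\ exists M, forall x, `|a x| <= M.
Proof.
have [P [Q [M [Pn Qn PM QM e]]]] := BV_monotone_split a_bv.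
split.
  apply: (periodic_measurable a_per e).
  by apply: measurable_funB; apply: nondecreasing_measurable.
exists (M + M) => x.
have [z /andP[h1 h2]] := round_2pi (x - pi).
have -> : a x = a (x - z%:~R * L) by rewrite -[in RHS]mulNr -mulrNz periodic_int.
rewrite e; first by apply: le_trans (ler_normB _ _) _; rewrite lerD.
by rewrite in_itv/=; apply/andP; split; lra.
Qed.

(** The bound involves the antiderivative only, not [K]: bounded variation does the work of a
    derivative of [a]. *)
Lemma BV_integral_le : exists2 C, 0 <= C & forall (k T : R -> R) (K tau : R),
  continuous k -> (forall x : R, is_derive x 1 T (k x)) -> (forall x, `|k x| <= K) ->
  (forall x, `|T x| <= tau) -> `|Rintegral tm setT (fun x => a x * k x)| <= C * tau.
Proof.
have [P [Q [M [Pn Qn PM QM e]]]] := BV_monotone_split a_bv.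
have [ma [B aB]] := BV_measurable_bounded.
have M0 : 0 <= M by apply: le_trans (PM 0).
exists (8 * M); first by rewrite mulr_ge0.
move=> k T K tau ck dT kK Tt.
have mk : measurable_fun setT k by exact: continuous_measurable_fun.
have mP : measurable_fun setT P by exact: nondecreasing_measurable.
have mQ : measurable_fun setT Q by exact: nondecreasing_measurable.
rewrite (@torus_Rintegral _ (B * K)); last first.
- by move=> x; rewrite normrM ler_pM.
- exact: measurable_funM.
rewrite (@eq_Rintegral _ _ _ mu _ (fun x => P x * k x - Q x * k x)); last first.
  by move=> x; rewrite inE => xi; rewrite e//= mulrBl.
rewrite RintegralB//; last 2 first.
- apply: (@integrable_bounded_itv _ _ _ _ (M * K)); first exact: measurable_funM.
  by move=> x; rewrite normrM ler_pM.
- apply: (@integrable_bounded_itv _ _ _ _ (M * K)); first exact: measurable_funM.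
  by move=> x; rewrite normrM ler_pM.
apply: le_trans (ler_normB _ _) _.
have -> : 8 * M * tau = 4 * M * tau + 4 * M * tau by ring.
rewrite lerD//; exact: (integral_monotone_le _ _ _ dT kK Tt twopi_gt0).
Qed.

End TorusIntegrals.

(** * Finite blocks of the Fourier series *)

Section TorusBlocks.
Variable R : realType.
Local Notation tm := (torus_measure R).
Local Notation L := (2 * pi : R).

Lemma Re_le_cmod (z : R[i]) : `|complex.Re z| <= cmod z.
Proof. by case: z => a b; rewrite /cmod/= -sqrtr_sqr ler_wsqrtr// lerDl sqr_ge0. Qed.

Lemma Im_le_cmod (z : R[i]) : `|complex.Im z| <= cmod z.
Proof. by case: z => a b; rewrite /cmod/= -sqrtr_sqr ler_wsqrtr// lerDr sqr_ge0. Qed.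

Lemma cmod_le_ReIm (z : R[i]) : cmod z <= `|complex.Re z| + `|complex.Im z|.
Proof.
case: z => a b; rewrite /cmod/= -[leRHS]ger0_norm ?addr_ge0// -sqrtr_sqr ler_wsqrtr//.
by rewrite sqrrD !real_normK ?num_real// lerD2r lerDl mulrn_wge0//.
Qed.

Definition tame (f : R -> R[i]) := [/\ measurable_fun setT (fun x => complex.Re (f x)),
  measurable_fun setT (fun x => complex.Im (f x)) & exists B, forall x, cmod (f x) <= B].

Lemma tame_integrable f : tame f ->
  tm.-integrable setT (EFin \o (fun x => complex.Re (f x))) /\
  tm.-integrable setT (EFin \o (fun x => complex.Im (f x))).
Proof.
move=> [mr mi [B fB]]; split; apply: (@torus_integrable _ _ B) => // x.
  exact: le_trans (Re_le_cmod _) (fB x).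
exact: le_trans (Im_le_cmod _) (fB x).
Qed.

Lemma tameD f g : tame f -> tame g -> tame (fun x => f x + g x).
Proof.
move=> [fr fi [B fB]] [gr gi [B' gB]]; split.
- have -> : (fun x => complex.Re (f x + g x)) = (fun x => complex.Re (f x) + complex.Re (g x)).
    by apply/funext => x; rewrite raddfD.
  exact: measurable_funD.
- have -> : (fun x => complex.Im (f x + g x)) = (fun x => complex.Im (f x) + complex.Im (g x)).
    by apply/funext => x; rewrite raddfD.
  exact: measurable_funD.
by exists (B + B') => x; apply: le_trans (ler_cmodD _ _) _; exact: lerD.
Qed.

Lemma ReM (z w : R[i]) : complex.Re (z * w) = complex.Re z * complex.Re w - complex.Im z * complex.Im w.
Proof. by case: z => a b; case: w. Qed.

Lemma ImM (z w : R[i]) : complex.Im (z * w) = complex.Re z * complex.Im w + complex.Im z * complex.Re w.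
Proof. by case: z => a b; case: w. Qed.

Lemma tameM f g : tame f -> tame g -> tame (fun x => f x * g x).
Proof.
move=> [fr fi [B fB]] [gr gi [B' gB]]; split.
- have -> : (fun x => complex.Re (f x * g x)) =
    (fun x => complex.Re (f x) * complex.Re (g x) - complex.Im (f x) * complex.Im (g x)).
    by apply/funext => x; rewrite ReM.
  by apply: measurable_funB; apply: measurable_funM.
- have -> : (fun x => complex.Im (f x * g x)) =
    (fun x => complex.Re (f x) * complex.Im (g x) + complex.Im (f x) * complex.Re (g x)).
    by apply/funext => x; rewrite ImM.
  by apply: measurable_funD; apply: measurable_funM.
by exists (B * B') => x; rewrite cmodM ler_pM ?cmod_ge0.
Qed.

Lemma tame_cst (c : R[i]) : tame (fun=> c).
Proof. by split; [exact: measurable_cst|exact: measurable_cst|exists (cmod c)]. Qed.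

Lemma tame_sum n (F : nat -> R -> R[i]) : (forall i, tame (F i)) -> tame (fun x => \sum_(i < n) F i x).
Proof.
move=> tF; elim: n => [|n IH].
  have -> : (fun x => \sum_(i < 0) F i x) = (fun=> 0) by apply/funext => x; rewrite big_ord0.
  exact: tame_cst.
have -> : (fun x => \sum_(i < n.+1) F i x) = (fun x => \sum_(i < n) F i x + F n x).
  by apply/funext => x; rewrite big_ord_recr.
exact: tameD.
Qed.

Lemma torus_integralD f g : tame f -> tame g ->
  torus_integral (fun x => f x + g x) = torus_integral f + torus_integral g.
Proof.
move=> /tame_integrable[fr fi] /tame_integrable[gr gi]; rewrite /torus_integral.
apply/eqP; rewrite eq_complex/=; apply/andP; split; apply/eqP.
  rewrite -RintegralD//; apply: eq_Rintegral => x _; exact: raddfD.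
rewrite -RintegralD//; apply: eq_Rintegral => x _; exact: raddfD.
Qed.

Lemma torus_integralZ (c : R[i]) f : tame f ->
  torus_integral (fun x => c * f x) = c * torus_integral f.
Proof.
move=> tf; have [fr fi] := tame_integrable tf; rewrite /torus_integral.
have iZ r h : tm.-integrable setT (EFin \o h) -> tm.-integrable setT (EFin \o (fun x : R => r * h x)).
  move=> ih; have := integrableZl measurableT r ih; apply: eq_integrable => // x _.
case: c => a b; apply/eqP; rewrite eq_complex/=; apply/andP; split; apply/eqP.
  rewrite -RintegralZl// -RintegralZl// -RintegralB//; [|exact: iZ|exact: iZ].
  by apply: eq_Rintegral => x _; rewrite ReM.
rewrite -RintegralZl// -RintegralZl// -RintegralD//; [|exact: iZ|exact: iZ].
by apply: eq_Rintegral => x _; rewrite ImM addrC.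
Qed.

Lemma torus_integral_sum n (F : nat -> R -> R[i]) : (forall i, tame (F i)) ->
  torus_integral (fun x => \sum_(i < n) F i x) = \sum_(i < n) torus_integral (F i).
Proof.
move=> tF; elim: n => [|n IH].
  have -> : (fun x => \sum_(i < 0) F i x) = (fun x => 0 * F 0%N x) by apply/funext => x; rewrite big_ord0 mul0r.
  by rewrite torus_integralZ// mul0r big_ord0.
have -> : (fun x => \sum_(i < n.+1) F i x) = (fun x => \sum_(i < n) F i x + F n x).
  by apply/funext => x; rewrite big_ord_recr.
by rewrite torus_integralD ?big_ord_recr ?IH//; exact: tame_sum.
Qed.

Lemma is_derive_affine (u c x : R) : is_derive x 1 (fun y => u - c * y) (- c).
Proof.
have := is_deriveD (is_derive_cst u x (1 : R)) (is_deriveZ (- c) (is_derive_id x (1 : R))).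
rewrite add0r [_ *: _]mulr1; congr is_derive; apply/funext => y.
by rewrite /= -mulNr.
Qed.

Lemma is_derive_sin_affine (u c x : R) : is_derive x 1 (fun y => sin (u - c * y)) (- c * cos (u - c * x)).
Proof.
rewrite mulrC; apply: (is_derive1_comp (f := sin) (g := fun y => u - c * y)).
exact: is_derive_affine.
Qed.

Lemma is_derive_cos_affine (u c x : R) : is_derive x 1 (fun y => cos (u - c * y)) (c * sin (u - c * x)).
Proof.
have -> : c * sin (u - c * x) = - sin (u - c * x) * - c by ring.
apply: (is_derive1_comp (f := cos) (g := fun y => u - c * y)).
exact: is_derive_affine.
Qed.

Lemma is_derive_continuous (f f' : R -> R) : (forall x : R, is_derive x 1 f (f' x)) -> continuous f.
Proof.
by move=> df x; apply/differentiable_continuous/derivable1_diffP; have := df x; case.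
Qed.

Lemma tame_expi (u c : R) : tame (fun y => expi (u - c * y)).
Proof.
split; last by exists 1 => x; rewrite cmod_expi.
  apply: continuous_measurable_fun; exact: is_derive_continuous (is_derive_cos_affine u c).
apply: continuous_measurable_fun; exact: is_derive_continuous (is_derive_sin_affine u c).
Qed.

Lemma is_derive_sum_pt n (F F' : nat -> R -> R) (x : R) :
  (forall i, is_derive x 1 (F i) (F' i x)) ->
  is_derive x 1 (fun y => \sum_(i < n) F i y) (\sum_(i < n) F' i x).
Proof.
move=> dF; have := @is_derive_sum _ _ _ n (fun i : 'I_n => F i) x 1 (fun i : 'I_n => F' i x).
move=> /(_ (fun i => dF i)); congr is_derive.
by apply/funext => y; rewrite fct_sumE.
Qed.

Variable g : R -> R[i].
Hypothesis g_bv : BV_torus g.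

Lemma tame_BV : tame g.
Proof.
have [gp br bi] := g_bv.
have pr : periodic (fun x => complex.Re (g x)) L by move=> x; rewrite gp.
have pim : periodic (fun x => complex.Im (g x)) L by move=> x; rewrite gp.
have [mr [B hB]] := BV_measurable_bounded pr br.
have [mi [B' hB']] := BV_measurable_bounded pim bi.
split=> //; exists (B + B') => x; apply: le_trans (cmod_le_ReIm _) _; exact: lerD.
Qed.

Lemma fourier_coef_expi (n : int) (u : R) : fourier_coef g n * expi u =
  (L^-1)%:C * torus_integral (fun y => g y * expi (u - n%:~R * y)).
Proof.
rewrite /fourier_coef -mulrA; congr (_ * _).
have t : tame (fun y => g y * expi (- (n%:~R * y))).
  apply: tameM tame_BV _; have := tame_expi 0 n%:~R.
  by under eq_fun do rewrite sub0r.
rewrite mulrC -torus_integralZ//; congr torus_integral.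
by apply/funext => y; rewrite mulrCA expiD.
Qed.

(** The block is the integral of [g] against a trigonometric polynomial, whose antiderivative has
    the coefficients 1/[c n]. *)
Lemma BV_block : exists2 C, 0 <= C & forall (u : nat -> R) (c : nat -> int) P tau,
  (forall n, (c n)%:~R != 0 :> R) ->
  (forall y, cmod (\sum_(n < P) ((c n)%:~R^-1)%:C * expi (u n - (c n)%:~R * y)) <= tau) ->
  cmod (\sum_(n < P) fourier_coef g (c n) * expi (u n)) <= C * tau.
Proof.
have [gp br bi] := g_bv.
have pr : periodic (fun x => complex.Re (g x)) L by move=> x; rewrite gp.
have pim : periodic (fun x => complex.Im (g x)) L by move=> x; rewrite gp.
have [Ca Ca0 ha] := BV_integral_le pr br.
have [Cb Cb0 hb] := BV_integral_le pim bi.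
have L0 := twopi_gt0 R.
exists (L^-1 * (Ca + Cb + (Ca + Cb))); first by rewrite mulr_ge0 ?invr_ge0 ?addr_ge0// ltW.
move=> u c P tau c0 hT.
pose K (y : R) : R[i] := \sum_(n < P) expi (u n - (c n)%:~R * y).
have tK : tame K.
  by apply: (tame_sum P (F := fun n y => expi (u n - (c n)%:~R * y))) => i; exact: tame_expi.
have -> : \sum_(n < P) fourier_coef g (c n) * expi (u n) = (L^-1)%:C * torus_integral (fun y => g y * K y).
  under eq_bigr do rewrite fourier_coef_expi.
  rewrite -mulr_sumr -(torus_integral_sum P (F := fun n y => g y * expi (u n - (c n)%:~R * y))); last first.
    by move=> i; apply: tameM tame_BV _; exact: tame_expi.
  by congr (_ * torus_integral _); apply/funext => y; rewrite /K mulr_sumr.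
rewrite cmodM cmodC ger0_norm ?invr_ge0 ?(ltW L0)// -mulrA ler_wpM2l ?invr_ge0 ?(ltW L0)//.
pose kc (y : R) : R := \sum_(n < P) cos (u n - (c n)%:~R * y).
pose ks (y : R) : R := \sum_(n < P) sin (u n - (c n)%:~R * y).
pose Z (y : R) : R[i] := \sum_(n < P) ((c n)%:~R^-1)%:C * expi (u n - (c n)%:~R * y).
have KE y : K y = kc y +i* ks y.
  rewrite /K /kc /ks; move: (P) => p; elim: p => [|p IH]; first by rewrite !big_ord0.
  by rewrite !big_ord_recr/= IH /expi.
(* The antiderivatives of [kc] and [ks] are, up to sign, the imaginary and real parts of [Z], so
   both are bounded by [tau]. *)
pose Tc (y : R) : R := \sum_(n < P) - ((c n)%:~R^-1 * sin (u n - (c n)%:~R * y)).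
pose Ts (y : R) : R := \sum_(n < P) (c n)%:~R^-1 * cos (u n - (c n)%:~R * y).
have ZE y : Z y = Ts y +i* (- Tc y).
  rewrite /Z /Tc /Ts; move: (P) => p; elim: p => [|p IH]; first by rewrite !big_ord0 oppr0.
  rewrite !big_ord_recr/= IH /expi; apply/eqP; rewrite eq_complex/=; apply/andP; split; apply/eqP; ring.
have Tc_le y : `|Tc y| <= tau by have := Im_le_cmod (Z y); rewrite {1}ZE/= normrN => /le_trans; apply; exact: hT.
have Ts_le y : `|Ts y| <= tau by have := Re_le_cmod (Z y); rewrite {1}ZE/= => /le_trans; apply; exact: hT.
have dTc (y : R) : is_derive y 1 Tc (kc y).
  apply: (@is_derive_sum_pt P (fun n y => - ((c n)%:~R^-1 * sin (u n - (c n)%:~R * y))) (fun n y => cos (u n - (c n)%:~R * y))) => i.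
  have := is_deriveZ (- (c i)%:~R^-1) (is_derive_sin_affine (u i) (c i)%:~R y).
  have -> : - (c i)%:~R^-1 *: (- (c i)%:~R * cos (u i - (c i)%:~R * y)) = cos (u i - (c i)%:~R * y) :> R.
    by rewrite /GRing.scale/=; field; exact: c0.
  by congr is_derive; apply/funext => z; exact: (mulNr (c i)%:~R^-1).
have dTs (y : R) : is_derive y 1 Ts (ks y).
  apply: (@is_derive_sum_pt P (fun n y => (c n)%:~R^-1 * cos (u n - (c n)%:~R * y)) (fun n y => sin (u n - (c n)%:~R * y))) => i.
  have := is_deriveZ ((c i)%:~R^-1) (is_derive_cos_affine (u i) (c i)%:~R y).
  have -> : (c i)%:~R^-1 *: ((c i)%:~R * sin (u i - (c i)%:~R * y)) = sin (u i - (c i)%:~R * y) :> R.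
    by rewrite /GRing.scale/=; field; exact: c0.
  by [].
have kB (y : R) : cmod (K y) <= P%:R.
  rewrite (le_trans (ler_cmod_sum _ _ _))//.
  by under eq_bigr do rewrite cmod_expi; rewrite sumr_const card_ord.
have kc_le y : `|kc y| <= P%:R by have := Re_le_cmod (K y); rewrite {1}KE/= => /le_trans; apply.
have ks_le y : `|ks y| <= P%:R by have := Im_le_cmod (K y); rewrite {1}KE/= => /le_trans; apply.
have ckc : continuous kc.
  apply: (@is_derive_continuous _ (fun y => \sum_(n < P) (c n)%:~R * sin (u n - (c n)%:~R * y))) => y.
  apply: (@is_derive_sum_pt P (fun n y => cos (u n - (c n)%:~R * y)) (fun n y => (c n)%:~R * sin (u n - (c n)%:~R * y))) => i.
  exact: is_derive_cos_affine.
have cks : continuous ks.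
  apply: (@is_derive_continuous _ (fun y => \sum_(n < P) - (c n)%:~R * cos (u n - (c n)%:~R * y))) => y.
  apply: (@is_derive_sum_pt P (fun n y => sin (u n - (c n)%:~R * y)) (fun n y => - (c n)%:~R * cos (u n - (c n)%:~R * y))) => i.
  exact: is_derive_sin_affine.
have i1 (a k : R -> R) : measurable_fun setT a -> (exists B, forall x, `|a x| <= B) -> continuous k ->
    (forall y, `|k y| <= P%:R) -> tm.-integrable setT (EFin \o (fun y => a y * k y)).
  move=> ma [B aB] ck kP; apply: (@torus_integrable _ _ (B * P%:R)).
    by apply: measurable_funM => //; exact: continuous_measurable_fun.
  by move=> x; rewrite normrM ler_pM.
have [mr Br] := BV_measurable_bounded pr br.
have [mi Bi] := BV_measurable_bounded pim bi.
apply: le_trans (cmod_le_ReIm _) _; rewrite /torus_integral/= [leRHS]mulrDl; apply: lerD.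
  rewrite (@eq_Rintegral _ _ _ tm setT (fun y => complex.Re (g y) * kc y - complex.Im (g y) * ks y)); last first.
    by move=> y _; rewrite ReM KE.
  rewrite RintegralB//; [|exact: i1|exact: i1].
  rewrite mulrDl; apply: le_trans (ler_normB _ _) _; apply: lerD.
    exact: (ha _ _ _ _ ckc dTc kc_le).
  exact: (hb _ _ _ _ cks dTs ks_le).
rewrite (@eq_Rintegral _ _ _ tm setT (fun y => complex.Re (g y) * ks y + complex.Im (g y) * kc y)); last first.
  by move=> y _; rewrite ImM KE.
rewrite RintegralD//; [|exact: i1|exact: i1].
rewrite mulrDl; apply: le_trans (ler_normD _ _) _; apply: lerD.
  exact: (ha _ _ _ _ cks dTs ks_le).
exact: (hb _ _ _ _ ckc dTc kc_le).
Qed.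

End TorusBlocks.

(** * Convergence of the Fourier series *)

Section UniformLimits.
Variable R : realType.
Local Notation tm := (torus_measure R).

Lemma Lnorm_infty_le (f : R -> R) (M : R) : 0 <= M -> (forall x, `|f x| <= M) ->
  (Lnorm tm +oo%E (fun x => (f x)%:E) <= M%:E)%E.
Proof.
move=> M0 fM; rewrite unlock; case: ifP => _; last by rewrite lee_fin.
by apply/ess_supP; apply: nearW => x /=; rewrite lee_fin.
Qed.

Lemma torus_norm2_le (f : R -> R[i]) (e : R) : 0 <= e -> continuous (fun x => cmod (f x)) ->
  (forall x, cmod (f x) <= e) -> (torus_norm 2%:E f <= (e * (1 + fine (tm setT)))%:E)%E.
Proof.
move=> e0 fc fe; rewrite /torus_norm unlock.
have fin : tm setT \is a fin_num by rewrite ge0_fin_numE ?torus_fin.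
have T0 : 0 <= fine (tm setT) by rewrite fine_ge0.
have K0 : 0 <= e * (1 + fine (tm setT)) by rewrite mulr_ge0// addr_ge0.
apply: (@le_trans _ _ (((e * (1 + fine (tm setT))) ^+ 2)%:E `^ 2^-1)%E); last first.
  by rewrite poweR_EFin powR12_sqrt ?sqr_ge0// sqrtr_sqr ger0_norm.
have le1 : (\int[tm]_x (`|(cmod (f x))%:E| `^ 2) <= ((e * (1 + fine (tm setT))) ^+ 2)%:E)%E.
  apply: (@le_trans _ _ (\int[tm]_x (cst (e ^+ 2)%:E x))%E).
    apply: ge0_le_integral => //.
    - by move=> x _; exact: poweR_ge0.
    - have -> : (fun x => `|(cmod (f x))%:E| `^ 2)%E = (EFin \o (fun x => cmod (f x) * cmod (f x))).
        apply/funext => x /=; rewrite ?poweR_EFin ger0_norm ?cmod_ge0//.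
        by rewrite powR_mulrn ?cmod_ge0// expr2.
      apply/measurable_EFinP; have mf := continuous_measurable_fun fc; exact: measurable_funM.
    move=> x _; rewrite /= ?poweR_EFin lee_fin ger0_norm ?cmod_ge0// powR_mulrn ?cmod_ge0//.
    by rewrite lerXn2r ?nnegrE ?cmod_ge0.
  rewrite integral_cst// -(fineK fin) -EFinM lee_fin exprMn ler_wpM2l ?sqr_ge0//.
  apply: (@le_trans _ _ (1 + fine (tm setT))); first by rewrite lerDr.
  by rewrite expr2 ler_peMr ?lerDl// addr_ge0.
have i0 : (0 <= \int[tm]_x (`|(cmod (f x))%:E| `^ 2))%E.
  by apply: integral_ge0 => x _; exact: poweR_ge0.
apply: gt0_ler_poweR => //.
- by rewrite in_itv/= i0 leey.
- by rewrite in_itv/= lee_fin sqr_ge0 leey.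
Qed.

Lemma cauchy_limit (v e : nat -> R) :
  (forall eps, 0 < eps -> exists M, e M < eps) ->
  (forall M M', (M <= M')%N -> `|v M' - v M| <= e M) ->
  forall M, `|lim (v @ \oo) - v M| <= e M.
Proof.
move=> e0 vc M.
have cv : cvgn v.
  apply/cauchy_cvgP/cauchy_exP => eps eps0; have [M0 hM0] := e0 _ eps0.
  exists (v M0); exists M0 => // n /= M0n; rewrite /ball/= distrC.
  exact: le_lt_trans (vc _ _ M0n) hM0.
apply/ler_addgt0Pr => d d0.
have /cvgrPdist_lt /(_ _ d0) [N _ hN] := cv.
pose n := maxn N M.
have h1 := hN n (leq_maxl _ _).
have h2 := vc M n (leq_maxr _ _).
rewrite -(subrK (v n) (lim _)) -addrA addrC (le_trans (ler_normD _ _))// lerD//.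
exact: ltW.
Qed.

(** The norm of [R[i]^o] has values in [R[i]], where a positive radius has zero imaginary part. *)
Lemma continuous_RC (u : R -> R[i]^o) :
  (forall x eps : R, 0 < eps -> exists2 d, 0 < d & forall y, `|x - y| < d -> cmod (u x - u y) < eps) ->
  continuous u.
Proof.
move=> h x; apply/(@cvgrPdist_lt R[i] R[i]^o) => e e0.
have e1 : 0 < complex.Re e by move: e0; rewrite ltcE/= => /andP[].
have eE : e = (complex.Re e)%:C.
  by move: e0; case: (e) => a b; rewrite ltcE/= => /andP[/eqP-> _].
have [d d0 hd] := h x _ e1.
apply/nbhs_ballP; exists d => // y /= xy.
by rewrite eE ltcR; exact: hd.
Qed.

Variables (E : nat -> R -> R[i]) (e : nat -> R).
Hypothesis e_small : forall eps, 0 < eps -> exists M, forall n, (M <= n)%N -> e n < eps.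
Hypothesis E_cauchy : forall M M' x, (M <= M')%N -> cmod (E M' x - E M x) <= e M.
Hypothesis E_lip : forall M, exists2 B, 0 <= B & forall x y, cmod (E M x - E M y) <= B * `|x - y|.
Hypothesis E_per : forall M, periodic (E M) (2 * pi : R).

Lemma uniform_limit : exists u : R -> R[i]^o,
  [/\ continuous u, periodic u (2 * pi : R) &
    torus_norm 2%:E (fun x => E M x - u x) @[M --> \oo] --> (0 : \bar R)].
Proof.
have small eps : 0 < eps -> exists M, e M < eps.
  by move=> /e_small[M hM]; exists M; exact: hM.
pose u (x : R) : R[i]^o := lim ((fun M => complex.Re (E M x)) @ \oo) +i* lim ((fun M => complex.Im (E M x)) @ \oo).
(* The factor 2 comes from taking the limits of real and imaginary parts separately. *)
have ue M x : cmod (E M x - u x) <= 2 * e M.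
  apply: le_trans (cmod_le_ReIm _) _; rewrite mulrDl mul1r /u.
  have -> : forall z a b, complex.Re (z - (a +i* b)) = complex.Re z - a :> R by case.
  have -> : forall z a b, complex.Im (z - (a +i* b)) = complex.Im z - b :> R by case.
  rewrite distrC [X in _ + X]distrC; apply: lerD.
    apply: (@cauchy_limit (fun M => complex.Re (E M x)) e small _ M) => N N' NN'.
    by rewrite -raddfB (le_trans (Re_le_cmod _))// E_cauchy.
  apply: (@cauchy_limit (fun M => complex.Im (E M x)) e small _ M) => N N' NN'.
  by rewrite -raddfB (le_trans (Im_le_cmod _))// E_cauchy.
have uc (x eps : R) : 0 < eps -> exists2 d, 0 < d & forall y, `|x - y| < d -> cmod (u x - u y) < eps.
  (* Two errors [2 * e M] use up half of [eps]; the Lipschitz bound on [E M] takes the other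
     half. *)
  move=> eps0; have [M hM] : exists M, e M < eps / 8 by apply: small; rewrite divr_gt0.
  have [B B0 hB] := E_lip M.
  exists (eps / (2 * (B + 1))); first by rewrite divr_gt0// mulr_gt0// ltr_wpDl.
  move=> y; rewrite ltr_pdivlMr ?mulr_gt0 ?ltr_wpDl// => xy.
  have -> : u x - u y = - (E M x - u x) + ((E M x - E M y) + (E M y - u y)) by ring.
  have h1 := ue M x; have h2 := ue M y; have h3 := hB x y.
  have h4 := ler_cmodD (- (E M x - u x)) ((E M x - E M y) + (E M y - u y)).
  have h5 := ler_cmodD (E M x - E M y) (E M y - u y).
  rewrite cmodN in h4; have := normr_ge0 (x - y) => n0.
  move: h1 h2 h3 h4 h5; move: (cmod _) (cmod _) (cmod _) (cmod _) (cmod _) => c1 c2 c3 c4 c5 h1 h2 h3 h4 h5.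
  have : B * `|x - y| < eps / 2 by nra.
  lra.
exists u; split.
- exact: continuous_RC.
- by move=> x; rewrite /u; congr (lim (_ @ \oo) +i* lim (_ @ \oo)); apply/funext => M; rewrite E_per.
pose K : R := 2 * (1 + fine (tm setT)).
have K0 : 0 < K by rewrite mulr_gt0// ltr_pwDl// fine_ge0.
have e0 M : 0 <= e M by apply: le_trans (E_cauchy 0 (leqnn M)); exact: cmod_ge0.
apply: (@squeeze_cvge _ _ _ _ (cst 0%E) _ (fun M => (e M * K)%:E)); last 2 first.
- exact: cvg_cst.
- apply: cvg_EFin; first exact: nearW.
  apply/cvgrPdist_lt => d d0; have [M hM] := e_small (divr_gt0 d0 K0).
  exists M => // n /= Mn; rewrite sub0r normrN ger0_norm; last by rewrite mulr_ge0// ltW.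
  by rewrite -ltr_pdivlMr//; exact: hM.
apply: nearW => M; apply/andP; split; first exact: Lnorm_ge0.
have -> : e M * K = 2 * e M * (1 + fine (tm setT)) by rewrite /K; ring.
apply: torus_norm2_le => //; first by rewrite mulr_ge0.
move=> x; apply/cvgrPdist_lt => d d0.
have d20 : 0 < d / 2 by rewrite divr_gt0.
have [r r0 hr] := uc x _ d20.
have [B B0 hB] := E_lip M.
apply/nbhs_ballP; exists (Num.min r (d / (2 * (B + 1)))) => [|y /=].
  by rewrite /= lt_min r0 divr_gt0// mulr_gt0// ltr_wpDl.
rewrite /ball/= lt_min => /andP[/hr h1]; rewrite ltr_pdivlMr ?mulr_gt0 ?ltr_wpDl// => h2.
have rev (z w : R[i]) : `|cmod z - cmod w| <= cmod (z - w).
  rewrite ler_norml; apply/andP; split.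
    rewrite lerNl opprB lerBlDr -[in leLHS](subrK z w) (le_trans (ler_cmodD _ _))//.
    by rewrite lerD2r -cmodN opprB.
  by rewrite lerBlDr -[in leLHS](subrK w z) ler_cmodD.
apply: le_lt_trans (rev _ _) _.
have -> : E M x - u x - (E M y - u y) = (E M x - E M y) + - (u x - u y) by ring.
have h3 := ler_cmodD (E M x - E M y) (- (u x - u y)); rewrite cmodN in h3.
have h4 := hB x y; have := normr_ge0 (x - y) => n0.
apply: le_lt_trans h3 _.
have : B * `|x - y| < d / 2 by nra.
by move: h1 h4; move: (cmod _) (cmod _) => c1 c2; lra.
Qed.

End UniformLimits.

(** * Dyadic summation and the weights 1/n *)

Section DyadicSums.
Variable R : realType.

(** Induction on the length, splitting off the range from N to 2N. The constant is the solution D of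
    D = A + D 2^(-de). *)
Lemma dyadic_sum (F : nat -> R[i]) (A de : R) : 0 <= A -> 0 < de ->
  (forall N N1, (0 < N)%N -> (N <= N1 <= 2 * N)%N ->
    cmod (\sum_(N <= n < N1) F n) <= A * N%:R `^ (- de)) ->
  forall N N1, (0 < N)%N -> (N <= N1)%N ->
    cmod (\sum_(N <= n < N1) F n) <= A / (1 - 2 `^ (- de)) * N%:R `^ (- de).
Proof.
move=> A0 de0 hF N N1.
have q1 : 2 `^ (- de) < 1 :> R.
  have h : 1 < 2 `^ de :> R by have := @gt0_ltr_powR R de de0 1 2; rewrite powR1; apply; rewrite ?in_itv/= ?nnegrE ?ltr1n.
  by rewrite powRN invf_lt1 ?(lt_trans ltr01).
have q0 : 0 < 1 - 2 `^ (- de) :> R by rewrite subr_gt0.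
have AD : A <= A / (1 - 2 `^ (- de)).
  by rewrite ler_pdivlMr// ler_piMr// gerBl powR_ge0.
have [k] := ubnP (N1 - N)%N; elim: k N => // k IH N; rewrite ltnS => kN N0 NN1.
have p0 := powR_ge0 (N%:R : R) (- de).
have [le|lt] := leqP N1 (2 * N)%N.
  by apply: le_trans (hF _ _ N0 _) _; [rewrite NN1|rewrite ler_wpM2r].
have N2 : (N <= 2 * N)%N by rewrite mul2n -addnn leq_addr.
rewrite (big_cat_nat N2 (ltnW lt))/=.
apply: le_trans (ler_cmodD _ _) _.
have h1 : cmod (\sum_(N <= n < 2 * N) F n) <= A * N%:R `^ (- de) by apply: hF; rewrite ?N2 ?leqnn.
have h2 : cmod (\sum_(2 * N <= n < N1) F n) <= A / (1 - 2 `^ (- de)) * (2 * N)%N%:R `^ (- de).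
  apply: IH; rewrite ?muln_gt0 ?(ltnW lt)//.
  apply: leq_trans kN; rewrite ltn_sub2l//; first exact: leq_ltn_trans N2 lt.
  by rewrite mul2n -addnn -[X in (X < _)%N]addn0 ltn_add2l.
apply: le_trans (lerD h1 h2) _.
rewrite natrM powRM// le_eqVlt; apply/orP; left; apply/eqP.
by field; rewrite gt_eqF.
Qed.

(** Abel summation: the weights N/(N+i) are at most 1 and change by at most 1/N. The factor [e]
    carries the sign of the frequency. *)
Lemma weighted_block (phi : nat -> R) (A : R) N P y (e : R) : (0 < N)%N -> (P <= N)%N -> 0 <= A -> `|e| = 1 ->
  (forall P', (P' <= N)%N -> cmod (\sum_(i < P') expi (phi (N + i)%N + (N + i)%N%:R * y)) <= A) ->
  cmod (\sum_(i < P) ((e * (N + i)%N%:R)^-1)%:C * expi (phi (N + i)%N + (N + i)%N%:R * y)) <= 2 * A / N%:R.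
Proof.
move=> N0 PN A0 e1 hA.
have NR : 0 < (N%:R : R) by rewrite ltr0n.
pose w (i : nat) : R[i] := (N%:R / (N + i)%N%:R)%:C.
pose z (i : nat) : R[i] := expi (phi (N + i)%N + (N + i)%N%:R * y).
have NiR (i : nat) : 0 < ((N + i)%N%:R : R) by rewrite ltr0n addn_gt0 N0.
have -> : \sum_(i < P) ((e * (N + i)%N%:R)^-1)%:C * expi (phi (N + i)%N + (N + i)%N%:R * y) =
   ((e * N%:R)^-1)%:C * \sum_(i < P) z i * w i.
  rewrite mulr_sumr; apply: eq_bigr => i _; rewrite /z /w mulrCA -rmorphM mulrC; congr (_ * _%:C).
  have e0 : e != 0 by rewrite -normr_eq0 e1 oner_eq0.
  by move: (NiR i); move: ((N + i)%N%:R : R) => v v0; field; rewrite e0 ?(gt_eqF NR) ?(gt_eqF v0).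
rewrite cmodM cmodC normfV normrM e1 mul1r ger0_norm// mulrC ler_wpM2r ?invr_ge0//.
apply: le_trans (@abel_le R z w P N%:R^-1 _ _ _) _.
- by rewrite invr_ge0.
- move=> i; rewrite cmodC ger0_norm ?divr_ge0//.
  by rewrite ler_pdivrMr// mul1r ler_nat leq_addr.
- move=> i iP; rewrite -rmorphB cmodC addnS.
  have -> : N%:R / (N + i)%N%:R - N%:R / (N + i).+1%:R = N%:R / ((N + i)%N%:R * (N + i).+1%:R) :> R.
    rewrite -[(N + i).+1%:R]natr1; move: (NiR i); move: ((N + i)%N%:R : R) => v v0.
    by field; rewrite !gt_eqF ?addr_gt0.
  have v1 : 0 < ((N + i)%N%:R * (N + i).+1%:R : R) by rewrite mulr_gt0 ?NiR ?ltr0n.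
  rewrite ger0_norm ?divr_ge0 ?(ltW v1)// (ler_pdivrMr _ _ v1) mulrC ler_pdivlMr//.
  by rewrite -!natrM ler_nat leq_mul ?leq_addr// (leq_trans (leq_addr i N)).
have -> : 2 * A = A + A by ring.
rewrite lerD ?hA//.
apply: (@le_trans _ _ (N%:R^-1 * \sum_(h < P) A)).
  rewrite ler_wpM2l ?invr_ge0//; apply: ler_sum => h _; apply: hA.
  by rewrite (leq_trans (ltn_ord h)).
rewrite sumr_const card_ord -[A *+ P]mulr_natl mulrA ler_piMl// mulrC ler_pdivrMr// mul1r.
by rewrite ler_nat.
Qed.

End DyadicSums.

(** * Uniform convergence of the evolution *)

Section Evolution.
Variable R : realType.
Variables (al t : R) (A sg : R).
Hypothesis A_ge0 : 0 <= A.
Hypothesis sg_lt1 : sg < 1.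
Hypothesis weyl : forall N N1 x, (0 < N)%N -> (N <= N1 <= 2 * N)%N ->
  cmod (\sum_(N <= n < N1) expi (t * n%:R `^ al + n%:R * x)) <= A * N%:R `^ sg.
Variable g : R -> R[i].
Hypothesis g_bv : BV_torus g.

Local Notation E := (evolution_partial_sum (omega al) t g).

(** The symmetric partial sums grow by the frequencies n and -n together. As [omega] is even, the
    second term is written with positive frequency at -x, so that one exponential sum bound serves
    both. *)
Definition pair_term (n : nat) (x : R) : R[i] :=
  fourier_coef g n%:Z * expi (t * n%:R `^ al + n%:R * x) +
  fourier_coef g (- n%:Z) * expi (t * n%:R `^ al + n%:R * (- x)).

Lemma pair_block : exists2 C, 0 <= C & forall N N1 x, (0 < N)%N -> (N <= N1 <= 2 * N)%N ->
  cmod (\sum_(N <= n < N1) pair_term n x) <= C * N%:R `^ (- (1 - sg)).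
Proof.
have [C C0 hC] := BV_block g_bv.
exists (C * (2 * A) + C * (2 * A)); first by rewrite addr_ge0 ?mulr_ge0.
move=> N N1 x N0 /andP[NN1 N1N].
have NR : 0 < (N%:R : R) by rewrite ltr0n.
have PN : (N1 - N <= N)%N by rewrite leq_subLR addnn -mul2n.
have AN : 0 <= A * N%:R `^ sg by rewrite mulr_ge0// powR_ge0.
have hW y P' : (P' <= N)%N -> cmod (\sum_(i < P') expi (t * (N + i)%N%:R `^ al + (N + i)%N%:R * y)) <= A * N%:R `^ sg.
  move=> P'N; have h : (N <= N + P' <= 2 * N)%N by rewrite leq_addr mul2n -addnn leq_add2l.
  have := weyl y N0 h; rewrite -{1}[N]add0n big_addn addKn big_mkord.
  by congr (cmod _ <= _); apply: eq_bigr => i _; rewrite addnC.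
have N1sg : 2 * (A * N%:R `^ sg) / N%:R = 2 * A * N%:R `^ (- (1 - sg)).
  have -> : N%:R `^ (- (1 - sg)) = N%:R `^ sg / N%:R :> R.
    by rewrite opprB powRB ?powRr1// ?(ltW NR)// (gt_eqF NR) implybT.
  by ring.
have -> : \sum_(N <= n < N1) pair_term n x = \sum_(i < N1 - N) pair_term (N + i)%N x.
  by rewrite -{1}[N]add0n big_addn big_mkord; apply: eq_bigr => i _; rewrite addnC.
rewrite /pair_term big_split/= mulrDl; apply: le_trans (ler_cmodD _ _) _; apply: lerD.
  rewrite -mulrA -N1sg.
  apply: (hC (fun i => t * (N + i)%N%:R `^ al + (N + i)%N%:R * x) (fun i => (N + i)%N%:Z)).
    by move=> n; rewrite -pmulrn pnatr_eq0 -lt0n addn_gt0 N0.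
  move=> y.
  have := @weighted_block R (fun n => t * n%:R `^ al) _ N (N1 - N) (x - y) 1 N0 PN AN (normr1 _) (hW (x - y)).
  congr (cmod _ <= _); apply: eq_bigr => i _; rewrite mul1r; congr (_ * expi _); rewrite -pmulrn; ring.
rewrite -mulrA -N1sg.
apply: (hC (fun i => t * (N + i)%N%:R `^ al + (N + i)%N%:R * - x) (fun i => - (N + i)%N%:Z)).
  by move=> n; rewrite mulrNz oppr_eq0 -pmulrn pnatr_eq0 -lt0n addn_gt0 N0.
move=> y.
have := @weighted_block R (fun n => t * n%:R `^ al) _ N (N1 - N) (y - x) (-1) N0 PN AN (normrN1 _) (hW (y - x)).
by congr (cmod _ <= _); apply: eq_bigr => i _; rewrite mulrNz -pmulrn mulN1r; congr (_ * expi _); ring.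
Qed.

Lemma partial_sumS M x : E M.+1 x - E M x = pair_term M.+1 x.
Proof.
rewrite /evolution_partial_sum.
pose F (n : int) : R[i] := fourier_coef g n * expi (t * omega al n + n%:~R * x).
have -> : \sum_(0 <= j < (2 * M.+1).+1) (let n := j%:Z - M.+1%:Z in fourier_coef g n * expi (t * omega al n + n%:~R * x)) =
  F (- M.+1%:Z) + \sum_(0 <= j < (2 * M).+1) F (j%:Z - M%:Z) + F M.+1%:Z.
  have -> : (2 * M.+1).+1 = (2 * M).+3 by rewrite mulnS.
  rewrite big_nat_recr//= big_nat_recl//= sub0r; congr (_ + _ + _).
    apply: eq_bigr => j _; rewrite -/(F _); congr F; lia.
  rewrite -/(F _); congr F; lia.
rewrite -/(F _) [X in X - _]addrAC addrK /pair_term /F /omega addrC.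
rewrite mulrNz normrN -!pmulrn normr_nat; congr (_ + _ * expi (_ + _)).
by rewrite mulrN mulNr.
Qed.

Lemma partial_sum_diff M M' x : (M <= M')%N ->
  E M' x - E M x = \sum_(M.+1 <= n < M'.+1) pair_term n x.
Proof.
move=> MM; rewrite -(subnK MM); elim: (M' - M)%N => [|k IH]; first by rewrite add0n subrr big_geq.
rewrite addSn big_nat_recr/=; last by rewrite ltnS leq_addl.
by rewrite -IH -partial_sumS; ring.
Qed.

Lemma partial_sum_lip M : exists2 B, 0 <= B & forall x y, cmod (E M x - E M y) <= B * `|x - y|.
Proof.
pose c (j : nat) : int := j%:Z - M%:Z.
exists (\sum_(0 <= j < (2 * M).+1) cmod (fourier_coef g (c j)) * `|(c j)%:~R|).
  by apply: sumr_ge0 => j _; rewrite mulr_ge0// cmod_ge0.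
move=> x y; rewrite /evolution_partial_sum -sumrB mulr_suml.
apply: le_trans (ler_cmod_sum _ _ _) _; apply: ler_sum => j _; cbv zeta; rewrite -/(c j).
rewrite -mulrBr cmodM -mulrA ler_wpM2l ?cmod_ge0//; apply: le_trans (cmod_expiB _ _) _.
by rewrite opprD addrACA subrr add0r -mulrBr normrM.
Qed.

Lemma partial_sum_periodic M : periodic (E M) (2 * pi : R).
Proof.
move=> x; apply: eq_bigr => j _; cbv zeta; congr (_ * _).
by rewrite mulrDr addrA expiD expi2piz mulr1.
Qed.

Lemma evolution_continuous : exists u : R -> R[i]^o,
  continuous u /\ represents_evolution (omega al) t g u.
Proof.
have [C C0 hC] := pair_block.
have de0 : 0 < 1 - sg by rewrite subr_gt0.
pose D := C / (1 - 2 `^ (- (1 - sg))).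
pose e (M : nat) : R := D * M.+1%:R `^ (- (1 - sg)).
have hE M M' x : (M <= M')%N -> cmod (E M' x - E M x) <= e M.
  by move=> MM; rewrite partial_sum_diff//; apply: (dyadic_sum C0 de0 (fun N N1 => hC N N1 x)).
have small eps : 0 < eps -> exists M, forall n, (M <= n)%N -> e n < eps.
  move=> eps0; have D0 : 0 < `|D| + 1 by rewrite ltr_wpDl.
  (* Chosen so that (|D| + 1) X^(-(1-sg)) = eps; the added 1 makes the final inequality strict. *)
  pose X : R := ((`|D| + 1) / eps) `^ (1 - sg)^-1.
  exists (Num.bound X) => n Xn.
  have X0 : 0 <= X by exact: powR_ge0.
  have nX : X <= n.+1%:R.
    by rewrite (le_trans (ltW (archi_boundP X0)))// ler_nat ltnW.
  have h : (`|D| + 1) / eps <= n.+1%:R `^ (1 - sg).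
    have -> : (`|D| + 1) / eps = X `^ (1 - sg).
      by rewrite /X -powRrM mulVf ?gt_eqF// powRr1// divr_ge0// ltW.
    by rewrite ge0_ler_powR ?nnegrE// ltW.
  have p0 : 0 < n.+1%:R `^ (1 - sg) :> R by rewrite powR_gt0.
  rewrite /e powRN ltr_pdivrMr//; move: h; rewrite ler_pdivrMr// mulrC => h.
  by apply: lt_le_trans h; rewrite (le_lt_trans (ler_norm _))// ltrDl.
have [u [cu pu lu]] := uniform_limit small hE partial_sum_lip partial_sum_periodic.
by exists u.
Qed.

End Evolution.

(** * From exponential sum bounds to the theorem *)

Section LinfBound.
Variable R : realType.

(** As [omega] is even, the sign of the frequency can be moved to [x]. *)
Lemma H_weyl minus (al : R) N x t : H minus (omega al) N x t =
  cmod (\sum_(N <= n < 2 * N) expi (t * n%:R `^ al + n%:R * ((-1) ^+ minus * x))).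
Proof.
rewrite /H; congr cmod; apply: eq_bigr => n _; congr (expi (_ + _)).
  rewrite /omega; congr (_ * _ `^ _).
  by case: minus; rewrite ?expr1 ?expr0 ?mulN1r ?mul1r ?mulrNz ?normrN -pmulrn normr_nat.
by case: minus; rewrite ?expr1 ?expr0 ?mulN1r ?mul1r ?mulrNz -pmulrn ?mulrN ?mulNr.
Qed.

Lemma H_lesssim (al t sg : R) :
  (forall eps, 0 < eps -> exists2 C : R, 0 <= C & forall N N1 x, (0 < N)%N -> (N <= N1 <= 2 * N)%N ->
    cmod (\sum_(N <= n < N1) expi (t * n%:R `^ al + n%:R * x)) <= C * N%:R `^ (sg + eps)) ->
  forall minus : bool, lesssim_plus (fun N => Lnorm (torus_measure R) +oo%E
     (fun x => (H minus (omega al) N x t)%:E)) sg.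
Proof.
move=> W minus eps eps0; have [C C0 hC] := W _ eps0.
exists C => N N0; apply: Lnorm_infty_le; first by rewrite mulr_ge0// powR_ge0.
move=> x; rewrite H_weyl ger0_norm ?cmod_ge0//; apply: hC => //.
by rewrite leqnn andbT mul2n -addnn leq_addr.
Qed.

End LinfBound.

Section NonIntegerExponent.
Variable R : realType.
Variables (m : nat) (alpha : R).
Hypothesis alpha_gt : m.+2%:R < alpha.
Hypothesis alpha_lt : alpha < m.+3%:R.

Lemma frac_part_between : frac_part alpha = alpha - m.+2%:R.
Proof.
rewrite /frac_part; congr (_ - _).
have -> : Num.floor alpha = m.+2%:Z; last by rewrite -pmulrn.
by apply: floor_def; rewrite intrD -!pmulrn natr1 (ltW alpha_gt).
Qed.

Lemma not_nat_between (i : nat) : alpha != i%:R.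
Proof.
apply/eqP => e; move: alpha_gt alpha_lt; rewrite e !ltr_nat ltnS => h1 h2.
by move: (leq_trans h1 h2); rewrite ltnn.
Qed.

(** No factor alpha - i vanishes because alpha lies strictly between consecutive integers. *)
Lemma top_coef_neq0 (t : R) k : t != 0 -> t * gbinom alpha k.+2 * (alpha - k.+2%:R) != 0.
Proof.
move=> t0; apply: mulf_neq0; last by rewrite subr_eq0 not_nat_between.
by apply: mulf_neq0 => //; apply: gbinom_neq0 => i _; exact: not_nat_between.
Qed.

Lemma weyl_bound_d (t eps : R) : t != 0 -> 0 < eps -> exists2 C : R, 0 <= C &
  forall N N1 x, (0 < N)%N -> (N <= N1 <= 2 * N)%N ->
  cmod (\sum_(N <= n < N1) expi (t * n%:R `^ alpha + n%:R * x)) <=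
  C * N%:R `^ (1 - (1 - frac_part alpha) / (m.+3%:R * m.+2%:R) + eps).
Proof.
move=> t0 eps0; rewrite frac_part_between.
apply: (@weyl_bound R alpha t m) => //.
- have := alpha_gt; rewrite -[m.+3%:R]natr1 => h.
  have m1 : 1 <= m.+2%:R :> R by rewrite ler1n.
  by move: (m.+2%:R) h m1 => q h m1; lra.
- exact: top_coef_neq0.
- by rewrite subr_ge0 ltW.
Qed.

(** With the degree raised by one, alpha < m+3 makes N [lam N] at most 1, so [th] = 0 is allowed and
    the saving no longer depends on the fractional part. *)
Lemma weyl_bound_dS (t eps : R) : t != 0 -> 0 < eps -> exists2 C : R, 0 <= C &
  forall N N1 x, (0 < N)%N -> (N <= N1 <= 2 * N)%N ->
  cmod (\sum_(N <= n < N1) expi (t * n%:R `^ alpha + n%:R * x)) <=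
  C * N%:R `^ (1 - (1 - 0) / (m.+4%:R * m.+3%:R) + eps).
Proof.
move=> t0 eps0.
apply: (@weyl_bound R alpha t m.+1) => //.
- by rewrite (lt_trans alpha_lt)// ltr_nat.
- have := alpha_gt; rewrite -[m.+4%:R]natr1 -[m.+3%:R]natr1 => h.
  have m1 : 2 <= m.+2%:R :> R by rewrite ler_nat.
  by move: (m.+2%:R) h m1 => q h m1; lra.
- exact: top_coef_neq0.
- by rewrite subr_le0 ltW.
Qed.

End NonIntegerExponent.

Theorem mainTheorem18 (R : realType) (d : nat) (alpha : R) :
  (3 <= d)%N -> d%:R - 1 < alpha -> alpha < d%:R ->
  forall t : R, t != 0 ->
  [/\ 2 / (d%:R + 1) < frac_part alpha ->
        forall minus : bool,
        lesssim_plus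
          (fun N => Lnorm (torus_measure R) +oo%E
                      (fun x => (H minus (omega alpha) N x t)%:E))
          (1 - 1 / (d%:R * (d%:R + 1))),
      frac_part alpha <= 2 / (d%:R + 1) ->
        forall minus : bool,
        lesssim_plus
          (fun N => Lnorm (torus_measure R) +oo%E
                      (fun x => (H minus (omega alpha) N x t)%:E))
          (1 - (1 - frac_part alpha) / (d%:R * (d%:R - 1))) &
      forall g : R -> R[i], BV_torus g ->
        exists u : R -> R[i]^o,
          continuous u /\ represents_evolution (omega alpha) t g u].

Proof.
case: d => [|[|[|m]]]// _; rewrite -natr1 addrK => alpha_gt.
rewrite natr1 => alpha_lt t t0.
have fr := frac_part_between alpha_gt alpha_lt.
have fr1 : 0 < 1 - frac_part alpha.
  rewrite fr; move: alpha_lt; rewrite -[m.+3%:R]natr1.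
  by move: (m.+2%:R) => q h; lra.
split.
- move=> _ minus; apply: H_lesssim => eps eps0.
  have := weyl_bound_dS alpha_gt alpha_lt t0 eps0.
  by rewrite subr0 natr1 [m.+4%:R * _]mulrC.
- by move=> _ minus; apply: H_lesssim => eps eps0; exact: weyl_bound_d.
move=> g g_bv.
(* Half of the saving is given up to the epsilon loss; the exponent 1 - eps that remains is still
   below 1. *)
pose eps := (1 - frac_part alpha) / (m.+3%:R * m.+2%:R) / 2.
have eps0 : 0 < eps by rewrite !divr_gt0 ?mulr_gt0 ?ltr0n.
have [C C0 hC] := weyl_bound_d alpha_gt alpha_lt t0 eps0.
apply: (evolution_continuous C0 _ hC g_bv).
have -> : (1 - frac_part alpha) / (m.+3%:R * m.+2%:R) = eps + eps by rewrite /eps -splitr.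
by move: (eps) eps0 => q q0; lra.
Qed.
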